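(* For any $3/2<p\leq 2$ there is a constant $C_p$ so that for any integer $N\geq 1$, any interval $I\subset\mathbb{Z}$ with length $|I|=N^2$, and any function $f$ supported on $2I$, we have $$\langle A_N f\rangle_{I,p'}\leq C_p\,\langle f\rangle_{2I,p},$$ where $p'=\frac{p}{p-1}$. Moreover, for $1<p<3/2$ the inequality cannot hold, i.e. there is no constant $C_p$ for which it holds for all such $N$, $I$, $f$.
   Context: For $f:\mathbb{Z}\to\mathbb{C}$ and an integer $N\ge 1$, $A_Nf(x):=\frac1N\sum_{k=1}^N f(x+k^2)$. An interval in $\mathbb{Z}$ is a set $I=[a,b]\cap\mathbb{Z}$ with $a\le b$ integers; its length $|I|$ is its number of elements, and $2I:=[a,2b-a+1]\cap\mathbb{Z}$ (doubling to the right). For $1\le p<\infty$, $\langle f\rangle_{I,p}:=\left(\frac1{|I|}\sum_{x\in I}|f(x)|^p\right)^{1/p}$. *)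

(* Defs.v *)
From HB Require Import structures.
From mathcomp Require Import all_boot all_order all_algebra finmap.
From mathcomp Require Import all_classical all_reals all_analysis.
From mathcomp Require Import complex.

Set Implicit Arguments.
Unset Strict Implicit.
Unset Printing Implicit Defensive.

Import Order.TTheory GRing.Theory Num.Theory.

Local Open Scope classical_set_scope.
Local Open Scope ring_scope.

Definition zitv (a b : int) : set int := [set x | a <= x <= b].

Definition zitv_double (a b : int) : set int := zitv a (b *+ 2 - a + 1).

(* Meant for finite [I]; [fset_set] and [\sum_(x \in _)] are junk otherwise. *)
Definition zlength (I : set int) : nat := #|` fset_set I|.

Section SquareAverages.
Variable R : realType.

Definition square_avg (N : nat) (f : int -> R[i]) (x : int) : R[i] :=
  N%:R^-1 * \sum_(1 <= k < N.+1) f (x + (k ^ 2)%N%:Z).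

(* [complex.Re `|z|] is the modulus of [z] as an element of [R]: in [R[i]] the
   norm is itself [R[i]]-valued, with zero imaginary part. *)
Definition lp_mean (I : set int) (p : R) (f : int -> R[i]) : R :=
  ((zlength I)%:R^-1 * \sum_(x \in I) complex.Re `|f x| `^ p) `^ p^-1.

Definition supported_on (f : int -> R[i]) (A : set int) : Prop :=
  [set x | f x != 0] `<=` A.

Definition improving_ineq (p C : R) : Prop :=
  forall (N : nat) (a b : int) (f : int -> R[i]),
    (1 <= N)%N -> a <= b -> zlength (zitv a b) = (N ^ 2)%N ->
    supported_on f (zitv_double a b) ->
    lp_mean (zitv a b) (p / (p - 1)) (square_avg N f)
      <= C * lp_mean (zitv_double a b) p f.

End SquareAverages.

(* Main.v *)
Require Import Defs.
From mathcomp Require Import all_boot all_order all_algebra.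
From mathcomp Require Import all_classical all_reals all_analysis.
From mathcomp Require Import complex zify ring lra.

Import Order.TTheory GRing.Theory Num.Theory numFieldNormedType.Exports.

Set Implicit Arguments.
Unset Strict Implicit.
Unset Printing Implicit Defensive.

Local Open Scope ring_scope.

(** For 3/2 < p it is enough, by duality and after replacing f by its modulus,
    to bound the form sum_{k <= N} sum_x f(x + k^2) g(x) by
    C N^(3 - 4/p) |f|_p |g|_p for nonnegative f and g on the naturals
    ([square_sums_bound], [mean_bound]).  As 3 - 4/p > 0, cutting [1, N] into
    dyadic blocks leaves a convergent geometric series, so that only the block
    N/2 < k <= N has to be treated.

    The heart is a family of high-low decompositions ([high_low]).  For every
    integer 1 <= Q <= N and every small e, the sum of the Dirac masses at the
    k^2 is a low part with kernel O(N^-1 Q^(1+e)), bounded from l^1 to l^oo,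
    plus a high part with Fourier transform O(N Q^(-1/2+e)), bounded on l^2.
    If f has size 4^i, g has size 4^j and i + j = c > 0, the choice Q = 2^c
    makes both contributions smaller than needed by the factors
    Q^(3-2p+e) and Q^(3/2-p+e); these decay precisely because p > 3/2.  Summing
    over all pairs of levels (i, j) is then a geometric sum along c
    ([pair_bound], [dyadic_bound_unit]).

    The decomposition is made on Z/M, with M divisible by 4N^2 and by every
    q <= Q, so that the fractions a/q are frequencies of Z/M.  The low part
    is cut out by a sum of Fejer triangles of half-width Q/(4 N^2 q) centred at
    the reduced fractions a/q with q <= Q; these arcs are disjoint
    ([near_fraction_uniq]).
    - High part ([high_part]): off the arcs, Weyl differencing bounds the
      exponential sum over squares by N Q^(-1/2+e) ([weyl_minor]), with a loss
      depending on Q only, not on N.  Inside the arc of a/q, at distance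
      beta from a/q, the frequency is off the smaller arcs of level
      D = 4 N^2 q beta < Q; Weyl's bound at that level, times the defect D/Q of
      the triangle, is again O(N Q^(-1/2+e)).
    - Low part ([low_part]): its kernel is a sum over q of a Ramanujan sum
      c_q(n) times a Fejer kernel.  As |c_q(n)| is at most the sum of the common
      divisors of q and n, one has to count the k with d | z - k^2 for which
      z - k^2 is small.  Fixing one root k0 and factoring
      k^2 - k0^2 = (k - k0)(k + k0) sorts these k into residue classes modulo
      lcm(e, d/e), for e | d ([sum_squares_root]); summing over all q <= Q
      costs Q times the cube of a harmonic sum ([sum_gcd_le]).

    For p < 3/2 the inequality fails for the Dirac mass at N^2 + 1 on the
    interval [1, N^2]: its average takes the value 1/N at N points, and the
    two sides compare like N^(-2 + 1/p) and N^(-2/p) ([not_improving_below]). *)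

(** * Complex moduli and additive characters *)

Section Modulus.
Variable R : realType.
Implicit Types z w : R[i].

(** The norm of [R[i]] takes its values in [R[i]]; sums of moduli are compared
    in [R], where order automation applies. *)
Definition cabs z : R := complex.Re `|z|.

Lemma cabsE z : (cabs z)%:C%C = `|z|.
Proof. by rewrite /cabs RRe_real. Qed.

Lemma cabs_le z (x : R) : (cabs z <= x) = (`|z| <= x%:C%C).
Proof. by rewrite -cabsE lecR. Qed.

Lemma cabs_ge0 z : 0 <= cabs z.
Proof. by rewrite -ler0c cabsE. Qed.

Lemma cabs0 : cabs 0 = 0 :> R.
Proof. by apply: complexI; rewrite cabsE normr0. Qed.

Lemma cabs1 : cabs 1 = 1 :> R.
Proof. by apply: complexI; rewrite cabsE normr1. Qed.

Lemma cabsM z w : cabs (z * w) = cabs z * cabs w.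
Proof. by apply: complexI; rewrite rmorphM /= !cabsE normrM. Qed.

Lemma cabsN z : cabs (- z) = cabs z.
Proof. by apply: complexI; rewrite !cabsE normrN. Qed.

Lemma cabs_conj z : cabs z^*%C = cabs z.
Proof. by apply: complexI; rewrite !cabsE normcJ. Qed.

Lemma cabs_real (x : R) : cabs x%:C%C = `|x|.
Proof. by rewrite /cabs normc_def /= expr0n /= addr0 sqrtr_sqr. Qed.

Lemma cabsD z w : cabs (z + w) <= cabs z + cabs w.
Proof. by rewrite cabs_le rmorphD /= !cabsE ler_normD. Qed.

Lemma cabsB z w : cabs (z - w) <= cabs z + cabs w.
Proof. by rewrite (le_trans (cabsD _ _)) ?cabsN. Qed.

Lemma cabs_sum (I : Type) (r : seq I) (P : pred I) (F : I -> R[i]) :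
  cabs (\sum_(i <- r | P i) F i) <= \sum_(i <- r | P i) cabs (F i).
Proof.
elim/big_rec2: _ => [|i x z _ le]; first by rewrite cabs0.
by apply: le_trans (cabsD _ _) _; rewrite lerD2l.
Qed.

Lemma cabs_sqr z : (cabs z ^+ 2)%:C%C = z * z^*%C.
Proof. by rewrite rmorphXn /= cabsE sqr_normc. Qed.

Lemma Re_le_cabs z : complex.Re z <= cabs z.
Proof.
apply: le_trans (ler_norm _) _.
by rewrite -lecR cabsE normc_ge_Re.
Qed.

End Modulus.

Section Characters.
Variable R : realType.
Implicit Types t u : R.

(** The character e(t) = exp(2 pi i t). *)
Definition expi t : R[i] := (cos (2 * pi * t) +i* sin (2 * pi * t))%C.

Lemma expi0 : expi 0 = 1.
Proof. by rewrite /expi mulr0 cos0 sin0. Qed.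

Lemma expiD t u : expi (t + u) = expi t * expi u.
Proof.
rewrite /expi mulrDr cosD sinD; apply/eqP; rewrite eq_complex /= eqxx /=.
by apply/eqP; ring.
Qed.

Lemma expiN t : expi (- t) = (expi t)^*%C.
Proof. by rewrite /expi mulrN cosN sinN. Qed.

Lemma cabs_expi t : cabs (expi t) = 1.
Proof. by rewrite /cabs normc_def /= cos2Dsin2 sqrtr1. Qed.

Lemma expiMn t n : expi (t *+ n) = expi t ^+ n.
Proof. by elim: n => [|n IH]; rewrite ?expi0 // mulrS exprS expiD IH. Qed.

Lemma expi_nat n : expi n%:R = 1.
Proof.
rewrite -[n%:R]/(1 *+ n) expiMn [expi 1](_ : _ = 1) ?expr1n //.
by rewrite /expi mulr1 mulrC mulr_natr cos2pi sin2pi.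
Qed.

Lemma expi_int (n : int) : expi n%:~R = 1.
Proof.
case: (intP n) => [|m|m]; first by rewrite expi0.
  by rewrite -pmulrn expi_nat.
by rewrite mulrNz expiN -pmulrn expi_nat conjc1.
Qed.

Lemma expiDint t (n : int) : expi (t + n%:~R) = expi t.
Proof. by rewrite expiD expi_int mulr1. Qed.

(** Up to pi/4 the cosine is at least 1/2, so the mean value theorem applies;
    beyond pi/4 the sine itself is at least 1/2. *)
Lemma sin_ge_lin u : 0 <= u <= 2^-1 -> u <= 2 * sin (pi * u).
Proof.
move=> /andP[u0 u1]; have p0 := pi_gt0 R; have p2 := pi_ge2 R.
have c4 : cos (pi / 4 : R) ^+ 2 = 2^-1.
  have := cos_mulr2n (pi / 4 : R).
  have -> : (pi / 4 : R) *+ 2 = pi / 2 by rewrite -mulr_natr; field.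
  by rewrite cos_pihalf => /eqP; rewrite eq_sym subr_eq0 => /eqP h; lra.
have c40 : 0 < cos (pi / 4 : R) by apply: cos_gt0_pihalf; lra.
have c4g : 2^-1 <= cos (pi / 4 : R).
  by rewrite leNgt; apply/negP => h; nra.
have [small|big] := leP u 4^-1.
  have [u00|u00] := eqVneq u 0; first by rewrite u00 mulr0 sin0 mulr0.
  have up : 0 < pi * u by rewrite mulr_gt0 // lt_neqAle eq_sym u00.
  have cs : {within `[0, pi * u], continuous (@sin R)}%classic.
    by apply: continuous_subspaceT => x; exact: continuous_sin.
  have [c cin] := MVT up (fun x _ => is_derive_sin x) cs.
  rewrite sin0 !subr0 => ->.
  move: cin; rewrite in_itv /= => /andP[c0 cu].
  have pu4 : pi * u <= pi / 4 by rewrite ler_pM2l.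
  have : cos (pi / 4) <= cos c.
    by rewrite leNgt ltr_cos ?in_itv /= -?leNgt; lra.
  nra.
have s4 : sin (pi / 4 : R) = cos (pi / 4).
  rewrite -cosBpihalf; have -> : pi / 4 - pi / 2 = - (pi / 4) :> R by lra.
  by rewrite cosN.
have pu4 : pi / 4 <= pi * u by rewrite ler_pM2l // ltW.
have pu2 : pi * u <= pi / 2 by rewrite ler_pM2l.
have : sin (pi / 4) <= sin (pi * u).
  by rewrite leNgt ltr_sin ?in_itv /= -?leNgt; lra.
lra.
Qed.

Lemma cabs_1Bexpi t : cabs (1 - expi t) = 2 * `|sin (pi * t)|.
Proof.
have h : 2 * pi * t = (pi * t) *+ 2 :> R by rewrite -mulr_natr; ring.
rewrite /cabs normc_def /= h cos_mulr2n sin_mulr2n.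
rewrite (_ : _ + _ = (2 * sin (pi * t)) ^+ 2).
  by rewrite sqrtr_sqr normrM ger0_norm.
rewrite !mulr2n; have := cos2Dsin2 (pi * t); move: (cos _) (sin _) => c s e.
have c2 : c ^+ 2 = 1 - s ^+ 2 by lra.
have -> : (0 - (c * s + c * s)) ^+ 2 = 4 * (c ^+ 2) * s ^+ 2 by ring.
by rewrite c2; ring.
Qed.

(** On [0, 1] the minimum of u and 1 - u is the distance to the nearest
    integer. *)
Lemma cabs_1Bexpi_ge u : 0 <= u <= 1 -> Num.min u (1 - u) <= cabs (1 - expi u).
Proof.
move=> /andP[u0 u1]; rewrite cabs_1Bexpi.
have [h|h] := leP u 2^-1.
  rewrite ge_min; apply/orP; left; apply: le_trans (sin_ge_lin _) _; first lra.
  by rewrite ler_wpM2l // ler_norm.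
rewrite ge_min; apply/orP; right.
have -> : pi * u = - (pi * (1 - u)) + pi by ring.
rewrite sinDpi sinN opprK; apply: le_trans (sin_ge_lin _) _; first lra.
by rewrite ler_wpM2l // ler_norm.
Qed.

Definition geom (n : nat) t : R[i] := \sum_(l < n) expi (l%:R * t).

Lemma geom_mul n t : (1 - expi t) * geom n t = 1 - expi (n%:R * t).
Proof.
rewrite /geom; elim: n => [|n IH]; first by rewrite big_ord0 mulr0 mul0r expi0 subrr.
have -> : n.+1%:R * t = t + n%:R * t by rewrite -natr1 mulrDl mul1r addrC.
by rewrite big_ord_recr /= mulrDr IH expiD; ring.
Qed.

Lemma cabs_geom_le n t : cabs (geom n t) <= n%:R.
Proof.
apply: le_trans (cabs_sum _ _ _) _.
by under eq_bigr do rewrite cabs_expi; rewrite sumr_const card_ord.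
Qed.

Lemma cabs_geom_mul n t : cabs (1 - expi t) * cabs (geom n t) <= 2.
Proof.
by rewrite -cabsM geom_mul (le_trans (cabsB _ _)) ?cabs1 ?cabs_expi.
Qed.

End Characters.

(** * Rearrangement and elementary sums *)
Section Sums.
Variable R : realType.

(** The i-th smallest of distinct naturals is at least i. *)
Lemma sum_uniq_nat_le (F : nat -> R) (n : nat) (s : seq nat) :
  (forall i, 0 <= F i) -> (forall i j, (i <= j)%N -> F j <= F i) ->
  uniq s -> (size s <= n)%N -> \sum_(i <- s) F i <= \sum_(i < n) F i.
Proof.
move=> F0 Fd; elim: n s => [|n IH] s us.
  by rewrite leqn0 size_eq0 => /eqP ->; rewrite big_nil big_ord0.
rewrite leq_eqVlt ltnS => /orP[/eqP sn|sn]; last first.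
  by rewrite big_ord_recr /= -[leLHS]addr0 lerD // IH.
have [x xs nx] : exists2 x, x \in s & (n <= x)%N.
  have : ~~ all (fun x => x < n)%N s.
    apply/negP => /allP h.
    have ss : {subset s <= iota 0 n} by move=> x /h; rewrite mem_iota.
    by have := uniq_leq_size us ss; rewrite size_iota sn ltnn.
  by case/allPn => x xs; rewrite -leqNgt; exists x.
rewrite (perm_big _ (perm_to_rem xs)) big_cons big_ord_recr /= addrC lerD ?Fd //.
by apply: IH; rewrite ?rem_uniq // size_rem // sn.
Qed.

(** The main counting device: a sum of a decreasing function of well-spaced
    quantities is estimated by numbering the spacing cells they occupy. *)
Lemma sum_inj_le (T : eqType) (s : seq T) (P : pred T) (v : T -> nat)
    (F : nat -> R) (n : nat) :
  (forall i, 0 <= F i) -> (forall i j, (i <= j)%N -> F j <= F i) ->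
  uniq s -> {in [seq t <- s | P t] &, injective v} -> (count P s <= n)%N ->
  \sum_(t <- s | P t) F (v t) <= \sum_(i < n) F i.
Proof.
move=> F0 Fd us vi cn; rewrite -big_filter -(big_map v xpredT F).
by apply: sum_uniq_nat_le; rewrite // ?size_map ?size_filter // map_inj_in_uniq // filter_uniq.
Qed.

(** Concavity of t^k, obtained from Young's inequality for t^k and 1. *)
Lemma powR_le_tangent (t k : R) : 0 <= t -> 0 < k -> k <= 1 -> t `^ k <= 1 + k * (t - 1).
Proof.
move=> t0 k0; rewrite le_eqVlt => /orP[/eqP ->|k1].
  by rewrite powRr1 //; lra.
have h : 0 < 1 - k by lra.
have := @conjugate_powR R (t `^ k) 1 k^-1 (1 - k)^-1 (powR_ge0 _ _) ler01.
rewrite !invr_gt0 !invrK -powRrM mulfV ?gt_eqF // powRr1 // powR1 mulr1.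
by move=> /(_ k0 h) H; apply: le_trans (H _) _; lra.
Qed.

Lemma sum_powR_le (k : R) (n : nat) : 0 < k -> k <= 1 ->
  \sum_(i < n) i.+1%:R `^ (k - 1) <= n%:R `^ k / k.
Proof.
move=> k0 k1; elim: n => [|n IH].
  by rewrite big_ord0 divr_ge0 ?powR_ge0 // ltW.
rewrite big_ord_recr /=; apply: le_trans (lerD IH (lexx _)) _.
set x : R := n.+1%:R; have x0 : 0 < x by rewrite ltr0n.
have x0' := ltW x0.
have xn : n%:R = x - 1 :> R by rewrite /x -natr1 addrK.
have n0 : 0 <= n%:R / x :> R by rewrite divr_ge0 // ltW.
have := powR_le_tangent n0 k0 k1.
rewrite -(ler_pM2r (powR_gt0 k x0)) -powRM // divfK ?gt_eqF // => h.
rewrite powRB ?(gt_eqF x0) ?implybT //. rewrite powRr1 //.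
rewrite -(ler_pM2r k0) mulrDl !divfK ?gt_eqF //.
move: h; rewrite xn; have -> : (x - 1) / x - 1 = - x^-1 by field; rewrite gt_eqF.
by move=> h; apply: le_trans (lerD h (lexx _)) _; rewrite le_eqVlt; apply/orP; left; apply/eqP; ring.
Qed.

(** Telescoping, from 1/(u^2 + j^2) <= 2/((u + j - 1)(u + j)) for j >= 1. *)
Lemma sum_lorentz_le (u : R) (n : nat) : 1 <= u ->
  \sum_(i < n) u ^+ 2 / (u ^+ 2 + i%:R ^+ 2) <= 3 * u.
Proof.
move=> u1; have u0 : 0 < u by lra.
suff h m : \sum_(i < m.+1) u ^+ 2 / (u ^+ 2 + i%:R ^+ 2)
    <= 1 + 2 * u - 2 * u ^+ 2 / (u + m%:R).
  case: n => [|n]; first by rewrite big_ord0; lra.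
  apply: le_trans (h n) _.
  have : 0 <= 2 * u ^+ 2 / (u + n%:R) by rewrite divr_ge0 ?addr_ge0 ?mulr_ge0 ?sqr_ge0 // ltW.
  lra.
elim: m => [|m IH].
  rewrite big_ord1 expr0n /= !addr0 divff ?gt_eqF ?exprn_gt0 //.
  by rewrite expr2 mulrA mulfK ?gt_eqF //; lra.
rewrite big_ord_recr /=; apply: le_trans (lerD IH (lexx _)) _.
rewrite -[m.+1%:R]natr1; have m0 : 0 <= m%:R :> R by [].
move: (m%:R : R) m0 => x x0.
have a0 : 0 < u + x by lra.
have b0 : 0 < u + (x + 1) by lra.
have -> : 2 * u ^+ 2 / (u + x) = 2 * u ^+ 2 / (u + (x + 1)) + 2 * u ^+ 2 / ((u + x) * (u + (x + 1))).
  by field; rewrite !gt_eqF.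
suff : u ^+ 2 / (u ^+ 2 + (x + 1) ^+ 2) <= 2 * u ^+ 2 / ((u + x) * (u + (x + 1))).
  lra.
have -> : 2 * u ^+ 2 / ((u + x) * (u + (x + 1)))
    = u ^+ 2 / ((u + x) * (u + (x + 1)) / 2) by field; rewrite !gt_eqF.
rewrite ler_pM2l ?exprn_gt0 // lef_pV2 ?posrE ?divr_gt0 ?mulr_gt0 //.
  by have := sqr_ge0 (u - (x + 1)); lra.
by rewrite addr_gt0 ?exprn_gt0 //; lra.
Qed.

End Sums.

(** * Squares close to a given integer *)
Section Squares.
Variable R : realType.

(** A smooth substitute for the indicator of |n| <= X that still dominates the
    tail of a Fejer kernel. *)
Definition lorentz (X : R) (n : int) : R := X ^+ 2 / (X ^+ 2 + n%:~R ^+ 2).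

Lemma lorentz_ge0 X n : 0 <= lorentz X n.
Proof. by rewrite divr_ge0 ?addr_ge0 ?sqr_ge0. Qed.

(** Two such k with k < k' satisfy k'^2 - k^2 = (k' - k)(k' + k) >= l N, because
    both exceed N/2.  So on either side of z the distances |z - k^2| lie in
    different cells of length l N. *)
Lemma sum_squares_class (N l : nat) (z : int) (X : R) (P : pred nat) :
  (0 < N)%N -> (0 < l)%N -> (l * N)%:R <= X ->
  (forall k k', P k -> P k' -> (l%:Z %| k%:Z - k'%:Z)%Z) ->
  \sum_(N./2.+1 <= k < N.+1 | P k) lorentz X (z - (k ^ 2)%N%:Z)
    <= 6 * X / (l * N)%:R.
Proof.
move=> N0 l0 slX Pl; set s := (l * N)%N in slX *.
have s0 : (0 < s)%N by rewrite muln_gt0 l0.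
have s0R : 0 < s%:R :> R by rewrite ltr0n.
have X0 : 0 < X by apply: lt_le_trans slX.
set u := X / s%:R; have u1 : 1 <= u by rewrite ler_pdivlMr // mul1r.
have u0 : 0 < u by lra.
pose F (i : nat) := u ^+ 2 / (u ^+ 2 + i%:R ^+ 2).
pose v k := (`|z - (k ^ 2)%N%:Z|%N %/ s)%N.
have dpos (i : nat) : 0 < u ^+ 2 + i%:R ^+ 2 by rewrite ltr_pwDl ?exprn_gt0 ?sqr_ge0.
have F0 i : 0 <= F i by rewrite divr_ge0 ?sqr_ge0 // ltW.
have Fd i j : (i <= j)%N -> F j <= F i.
  move=> ij; rewrite ler_pM2l ?exprn_gt0 // lef_pV2 ?posrE // lerD2l.
  by rewrite ler_sqr ?nnegrE // ler_nat.
have lF k : lorentz X (z - (k ^ 2)%N%:Z) <= F (v k).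
  have -> : F (v k) = X ^+ 2 / (X ^+ 2 + (v k)%:R ^+ 2 * s%:R ^+ 2).
    rewrite /F /u; field.
    by rewrite (gt_eqF s0R) gt_eqF // ltr_pwDl ?exprn_gt0 ?sqr_ge0.
  have X2 : 0 < X ^+ 2 by rewrite exprn_gt0.
  have pos (y : R) : 0 <= y -> 0 < X ^+ 2 + y by move=> y0; rewrite ltr_pwDl.
  rewrite /lorentz ler_pM2l // lef_pV2 ?lerD2l; last 2 first.
  - by rewrite posrE pos ?sqr_ge0.
  - by rewrite posrE pos // mulr_ge0 ?sqr_ge0.
  rewrite -exprMn -[leRHS]real_normK ?num_real // ler_sqr ?nnegrE ?mulr_ge0 //.
  by rewrite -intr_norm -natr_absz -natrM ler_nat leq_divM.
have half (Q : pred nat) : {in [seq k <- index_iota N./2.+1 N.+1 | P k && Q k] &, injective v} ->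
    \sum_(N./2.+1 <= k < N.+1 | P k && Q k) lorentz X (z - (k ^ 2)%N%:Z) <= 3 * u.
  move=> vi; apply: le_trans (ler_sum _ (fun k _ => lF k)) _.
  apply: le_trans (sum_inj_le F0 Fd (iota_uniq _ _) vi (leqnn _)) _.
  exact: sum_lorentz_le.
have gap k k' : (N./2.+1 <= k)%N -> (k < k')%N -> P k -> P k' -> (k ^ 2 + s <= k' ^ 2)%N.
  move=> kN kk Pk Pk'.
  have /dvdn_leq : (l %| k' - k)%N.
    by have := Pl _ _ Pk' Pk; rewrite dvdzE /= distnEl // ltnW.
  rewrite subn_gt0 => /(_ kk) lk.
  have -> : (k' ^ 2 = k ^ 2 + (k' - k) * (k + k'))%N by rewrite [(k + k')%N]addnC -subn_sqr subnKC // leq_sqr ltnW.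
  rewrite leq_add2l leq_mul //; lia.
have dlt a b : (a + s <= b)%N -> (a %/ s < b %/ s)%N.
  by move=> ab; apply: leq_trans (leq_div2r s ab); rewrite divnDr ?dvdnn // divnn s0 addn1.
have -> : 6 * X / s%:R = 3 * u + 3 * u by rewrite /u; field; rewrite gt_eqF.
rewrite (bigID (fun k => (k ^ 2)%N%:Z <= z)) /=; apply: lerD; apply: half.
- move=> k k'; rewrite !mem_filter !mem_index_iota.
  move=> /andP[/andP[Pk kz] /andP[k1 _]] /andP[/andP[Pk' kz'] /andP[k1' _]] vk.
  case: (ltngtP k k') => // kk; exfalso.
    have g := gap _ _ k1 kk Pk Pk'.
    suff : (v k' < v k)%N by rewrite vk ltnn.
    apply: dlt; lia.
  have g := gap _ _ k1' kk Pk' Pk.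
  suff : (v k < v k')%N by rewrite vk ltnn.
  apply: dlt; lia.
- move=> k k'; rewrite !mem_filter !mem_index_iota -!ltNge.
  move=> /andP[/andP[Pk kz] /andP[k1 _]] /andP[/andP[Pk' kz'] /andP[k1' _]] vk.
  case: (ltngtP k k') => // kk; exfalso.
    have g := gap _ _ k1 kk Pk Pk'.
    suff : (v k < v k')%N by rewrite vk ltnn.
    apply: dlt; lia.
  have g := gap _ _ k1' kk Pk' Pk.
  suff : (v k' < v k)%N by rewrite vk ltnn.
  apply: dlt; lia.
Qed.

End Squares.

Section Divisors.
Variable R : realType.

(** If d divides z - k^2 and z - k0^2, it divides (k - k0)(k + k0); with
    e = gcd(d, k - k0) this gives e | k - k0 and d/e | k + k0, which fixes k
    modulo lcm(e, d/e).  Since lcm(e, d/e) gcd(e, d/e) = d, each class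
    contributes gcd(e, d/e)/d. *)
Lemma sum_squares_root (N d : nat) (z : int) (X : R) :
  (0 < N)%N -> (0 < d)%N -> (d * N)%:R <= X ->
  \sum_(N./2.+1 <= k < N.+1 | (d%:Z %| z - (k ^ 2)%N%:Z)%Z)
     lorentz X (z - (k ^ 2)%N%:Z)
  <= 6 * X / (d * N)%:R * \sum_(1 <= e < d.+1 | (e %| d)%N) (gcdn e (d %/ e))%:R.
Proof.
move=> N0 d0 dX; pose D (k : nat) := (d%:Z %| z - (k ^ 2)%N%:Z)%Z.
rewrite [leLHS](_ : _ = \sum_(N./2.+1 <= k < N.+1 | D k) lorentz X (z - (k ^ 2)%N%:Z)) //.
have X0 : 0 <= X by apply: le_trans dX.
have [hD|nD] := boolP (has D (index_iota N./2.+1 N.+1)); last first.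
  rewrite -big_filter; have -> : [seq k <- index_iota N./2.+1 N.+1 | D k] = [::].
    by apply/eqP; rewrite -(negbK (_ == _)) -has_filter.
  by rewrite big_nil mulr_ge0 ?divr_ge0 ?mulr_ge0 ?sumr_ge0.
case/hasP: hD => k0 _ Dk0.
pose P e k := ((e%:Z %| k%:Z - k0%:Z) && ((d %/ e)%N%:Z %| k%:Z + k0%:Z))%Z.
have cover k : D k -> exists2 e, e \in index_iota 1 d.+1 & ((e %| d)%N && P e k).
  move=> Dk; pose m := `|k%:Z - k0%:Z|%N; exists (gcdn d m).
    rewrite mem_index_iota gcdn_gt0 d0 /= ltnS dvdn_leq ?dvdn_gcdl //.
  rewrite dvdn_gcdl /P !dvdzE /= dvdn_gcdr /=.
  have : (d %| m * (k + k0))%N.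
    have := rpredB Dk0 Dk; rewrite dvdzE /=.
    suff -> : `|(z - (k0 ^ 2)%N%:Z - (z - (k ^ 2)%N%:Z))%R|%N = (m * (k + k0))%N by [].
    rewrite /m; have -> : z - (k0 ^ 2)%N%:Z - (z - (k ^ 2)%N%:Z) = (k%:Z - k0%:Z) * (k + k0)%N%:Z.
      by rewrite !PoszD !PoszM; ring.
    by rewrite abszM.
  have g0 : (0 < gcdn d m)%N by rewrite gcdn_gt0 d0.
  rewrite -[X in (X %| _)%N](divnK (dvdn_gcdl d m)).
  rewrite -[X in (_ %| X * _)%N](divnK (dvdn_gcdr d m)).
  rewrite mulnAC dvdn_pmul2r // Gauss_dvdr //.
  by rewrite /coprime -(eqn_pmul2r g0) muln_gcdl !divnK ?dvdn_gcdl ?dvdn_gcdr // mul1n.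
have step : \sum_(N./2.+1 <= k < N.+1 | D k) lorentz X (z - (k ^ 2)%N%:Z) <=
   \sum_(1 <= e < d.+1 | (e %| d)%N) \sum_(N./2.+1 <= k < N.+1 | P e k) lorentz X (z - (k ^ 2)%N%:Z).
  rewrite (exchange_big_dep xpredT) //= big_mkcond; apply: ler_sum => k _.
  case: ifP => Dk; last by rewrite sumr_ge0 // => *; apply: lorentz_ge0.
  have [e es Pe] := cover k Dk.
  rewrite (big_rem e) //= Pe lerDl sumr_ge0 // => *; exact: lorentz_ge0.
apply: le_trans step _; rewrite mulr_sumr big_nat_cond [leRHS]big_nat_cond.
apply: ler_sum => e /andP[/andP[e1 _] ed]; pose l := lcmn e (d %/ e).
have de0 : (0 < d %/ e)%N by rewrite divn_gt0 // dvdn_leq.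
have lg : (l * gcdn e (d %/ e) = d)%N by rewrite /l muln_lcm_gcd mulnC divnK.
have l0 : (0 < l)%N by rewrite lcmn_gt0 e1.
have g0 : (0 < gcdn e (d %/ e))%N by rewrite gcdn_gt0 e1.
have lX : (l * N)%:R <= X.
  by apply: le_trans dX; rewrite ler_nat leq_mul // dvdn_leq // -lg dvdn_mulr.
have cls := @sum_squares_class R N l z X (P e) N0 l0 lX. apply: le_trans (cls _) _.
  move=> k k' /andP[a b] /andP[a' b'].
  rewrite dvdzE /= dvdn_lcm; apply/andP; split.
    by have := rpredB a a'; rewrite dvdzE /=; congr (_ %| `|_|)%N; ring.
  by have := rpredB b b'; rewrite dvdzE /=; congr (_ %| `|_|)%N; ring.
have -> : (d * N)%:R = l%:R * (gcdn e (d %/ e))%:R * N%:R :> R.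
  by rewrite -!natrM lg.
rewrite natrM le_eqVlt; apply/orP; left; apply/eqP; field.
by rewrite !pnatr_eq0 -!lt0n l0 N0 g0.
Qed.

Lemma sum_one_hit (T : eqType) (r : seq T) (P : pred T) (c : T) (x : R) :
  uniq r -> 0 <= x -> (forall a, P a -> a = c) -> \sum_(a <- r | P a) x <= x.
Proof.
move=> ur x0 Pc; rewrite big_const_seq iter_addr_0 -[leRHS]mulr1n ler_wpMn2l //.
apply: leq_trans (_ : count_mem c r <= 1)%N; last by rewrite count_uniq_mem ?leq_b1.
by apply: sub_count => a /Pc ->; rewrite /= eqxx.
Qed.

Lemma gcdn_le_sum a b Q : (0 < a <= Q)%N ->
  (gcdn a b <= \sum_(1 <= g < Q.+1 | (g %| a) && (g %| b)) g)%N.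
Proof.
move=> /andP[a0 aQ]; rewrite (big_rem (gcdn a b)) /=.
  by rewrite dvdn_gcdl dvdn_gcdr leq_addr.
by rewrite mem_index_iota gcdn_gt0 a0 ltnS (leq_trans _ aQ) // dvdn_leq ?dvdn_gcdl.
Qed.

Definition harmonic (Q : nat) : R := \sum_(1 <= i < Q.+1) i%:R^-1.

Lemma harmonic_ge0 Q : 0 <= harmonic Q.
Proof. by rewrite sumr_ge0 // => *; rewrite invr_ge0. Qed.

Lemma sum_inv_multiples g Q : (0 < g)%N ->
  \sum_(1 <= a < Q.+1 | (g %| a)%N) (a%:R^-1 : R) <= g%:R^-1 * harmonic Q.
Proof.
move=> g0; rewrite /harmonic mulr_sumr.
apply: (@le_trans _ _ (\sum_(1 <= a < Q.+1 | (g %| a)%N)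
    \sum_(1 <= c < Q.+1 | a == (g * c)%N) g%:R^-1 * c%:R^-1 : R)).
  rewrite big_nat_cond [leRHS]big_nat_cond.
  apply: ler_sum => a /andP[/andP[a1 aQ] ga].
  have ca : a = (g * (a %/ g))%N by rewrite mulnC divnK.
  rewrite (big_rem (a %/ g)%N) /=; last first.
    by rewrite mem_index_iota divn_gt0 // dvdn_leq //= (leq_ltn_trans (leq_div _ _)).
  rewrite -ca eqxx {1}ca natrM invfM lerDl sumr_ge0 //.
rewrite (exchange_big_dep xpredT) //=; apply: ler_sum => c _.
apply: (@sum_one_hit _ _ _ (g * c)%N); rewrite ?iota_uniq ?mulr_ge0 ?invr_ge0 //.
by move=> a /andP[_ /eqP].
Qed.

Lemma divisors_widen (d Q : nat) (F : nat -> nat) : (0 < d <= Q)%N ->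
  (\sum_(1 <= e < d.+1 | e %| d) F e = \sum_(1 <= e < Q.+1 | e %| d) F e)%N.
Proof.
move=> /andP[d0 dQ]; rewrite (big_nat_widen _ _ Q.+1) ?ltnS //.
by apply: eq_bigl => e; case ed: (e %| d)%N; rewrite //= ltnS dvdn_leq.
Qed.

(** Substitute d = a b with a = e: the multiples of a b up to Q number Q/(a b). *)
Lemma sum_divisor_pairs (Q : nat) (G : nat -> nat -> nat) :
  (\sum_(1 <= q < Q.+1) \sum_(1 <= d < q.+1 | d %| q)
     \sum_(1 <= e < d.+1 | e %| d) G e (d %/ e)
   <= \sum_(1 <= a < Q.+1) \sum_(1 <= b < Q.+1) Q %/ (a * b) * G a b)%N.
Proof.
have -> : (\sum_(1 <= a < Q.+1) \sum_(1 <= b < Q.+1) Q %/ (a * b) * G a b =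
   \sum_(1 <= q < Q.+1) \sum_(1 <= a < Q.+1) \sum_(1 <= b < Q.+1 | a * b %| q) G a b)%N.
  rewrite [RHS]exchange_big; apply: eq_bigr => a _; rewrite /= [RHS](exchange_big_dep xpredT) //=.
  apply: eq_bigr => b _; rewrite divn_count_dvd big_distrl /= [RHS]big_mkcond /=.
  by apply: eq_bigr => q _; case: dvdn; rewrite ?mul1n ?mul0n.
rewrite big_nat_cond [X in (_ <= X)%N]big_nat_cond.
apply: leq_sum => q /andP[/andP[q1 qQ] _]; rewrite ltnS in qQ.
rewrite (@divisors_widen q Q) ?q1 //.
apply: (@leq_trans (\sum_(1 <= d < Q.+1 | d %| q) \sum_(1 <= a < Q.+1)
    \sum_(1 <= b < Q.+1 | a * b == d) G a b)%N).
  rewrite big_nat_cond [X in (_ <= X)%N]big_nat_cond.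
  apply: leq_sum => d /andP[/andP[d1 dQ] dq]; rewrite ltnS in dQ.
  rewrite (@divisors_widen d Q) ?d1 // big_mkcond /= big_nat_cond [X in (_ <= X)%N]big_nat_cond.
  apply: leq_sum => e /andP[/andP[e1 eQ] _]; case: ifP => // ed.
  rewrite (big_rem (d %/ e)%N) /=; last first.
    by rewrite mem_index_iota divn_gt0 // dvdn_leq //= ltnS (leq_trans (leq_div _ _)).
  by rewrite mulnC divnK // eqxx leq_addr.
rewrite (exchange_big_dep xpredT) //=; apply: leq_sum => a _.
rewrite (exchange_big_dep xpredT) //= [X in (_ <= X)%N]big_mkcond; apply: leq_sum => b _ /=.
case: ifP => abq; last first.
  rewrite big1 // => d /andP[/andP[dq _] /eqP abd]; move: abq; rewrite abd dq //.
rewrite big_const_seq iter_addn_0 -[X in (_ <= X)%N]muln1 leq_mul2l; apply/orP; right.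
apply: leq_trans (_ : count_mem (a * b)%N (index_iota 1 Q.+1) <= 1)%N.
  by apply: sub_count => d /andP[_ /eqP <-]; rewrite /= eqxx.
by rewrite count_uniq_mem ?leq_b1 ?iota_uniq.
Qed.

(** Bound gcd(a, b) by the sum of the common divisors g of a and b, and sum first
    over the multiples a and b of g: what remains is a product of three harmonic
    sums. *)
Lemma sum_gcd_le (Q : nat) :
  (\sum_(1 <= q < Q.+1) \sum_(1 <= d < q.+1 | d %| q)
     \sum_(1 <= e < d.+1 | e %| d) gcdn e (d %/ e))%:R <= Q%:R * harmonic Q ^+ 3 :> R.
Proof.
apply: le_trans (_ : (\sum_(1 <= a < Q.+1) \sum_(1 <= b < Q.+1) Q %/ (a * b) * gcdn a b)%:R <= _).
  by rewrite ler_nat sum_divisor_pairs.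
apply: (@le_trans _ _ (\sum_(1 <= a < Q.+1) \sum_(1 <= b < Q.+1)
   \sum_(1 <= g < Q.+1 | (g %| a)%N && (g %| b)%N) Q%:R * g%:R * (a%:R^-1 * b%:R^-1))).
  rewrite natr_sum big_nat_cond [leRHS]big_nat_cond.
  apply: ler_sum => a /andP[/andP[a1 aQ] _].
  rewrite natr_sum big_nat_cond [leRHS]big_nat_cond.
  apply: ler_sum => b /andP[/andP[b1 bQ] _].
  rewrite -mulr_suml -mulr_sumr -natr_sum natrM mulrAC ler_pM //.
    rewrite -invfM -natrM ler_pdivlMr ?ltr0n ?muln_gt0 ?a1 // -natrM ler_nat.
    exact: leq_divM.
  by rewrite ler_nat gcdn_le_sum // a1.
under eq_bigr => a _ do rewrite (exchange_big_dep xpredT) //=.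
rewrite (exchange_big_dep xpredT) //=.
have -> : Q%:R * harmonic Q ^+ 3 = \sum_(1 <= g < Q.+1) Q%:R * harmonic Q ^+ 2 * g%:R^-1.
  by rewrite -mulr_sumr /harmonic exprSr mulrA.
rewrite big_nat_cond [leRHS]big_nat_cond; apply: ler_sum => g /andP[/andP[g1 _] _].
apply: (@le_trans _ _ (Q%:R * g%:R * ((\sum_(1 <= a < Q.+1 | (g %| a)%N) a%:R^-1) *
    (\sum_(1 <= b < Q.+1 | (g %| b)%N) b%:R^-1)))).
  rewrite mulr_suml mulr_sumr big_mkcond [leRHS]big_mkcond; apply: ler_sum => a _ /=.
  case ga: (g %| a)%N; last by rewrite big_pred0.
  by rewrite -!mulr_sumr.
have h := @sum_inv_multiples g Q g1.
have h0 : 0 <= \sum_(1 <= a < Q.+1 | (g %| a)%N) (a%:R^-1 : R).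
  by rewrite sumr_ge0 // => *; rewrite invr_ge0.
apply: (@le_trans _ _ (Q%:R * g%:R * ((g%:R^-1 * harmonic Q) * (g%:R^-1 * harmonic Q)))).
  by rewrite ler_wpM2l ?mulr_ge0 // ler_pM.
rewrite le_eqVlt; apply/orP; left; apply/eqP; field.
by rewrite pnatr_eq0 -lt0n.
Qed.

Lemma harmonic_le (k : R) Q : 0 < k -> k <= 1 -> harmonic Q <= Q%:R `^ k / k.
Proof.
move=> k0 k1; apply: le_trans (sum_powR_le Q k0 k1).
rewrite /harmonic big_add1 /= big_mkord; apply: ler_sum => i _.
rewrite -powR_inv1 // ler_powR ?ler1n //; lra.
Qed.

End Divisors.

(** * Ramanujan sums *)
Section Ramanujan.
Variable R : realType.

Lemma cabs_nat n : cabs n%:R = n%:R :> R.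
Proof. by rewrite -(rmorph_nat (real_complex R)) cabs_real ger0_norm. Qed.

Lemma expi_neq1 (u : R) : 0 < u < 1 -> expi u != 1.
Proof.
move=> /andP[u0 u1]; apply/eqP => e.
have h : 0 <= u <= 1 by lra.
by have := cabs_1Bexpi_ge h; rewrite e subrr cabs0 ge_min; lra.
Qed.

(** Orthogonality of the characters of Z/q. *)
Lemma geom_dvd (q : nat) (n : int) : (0 < q)%N ->
  geom q (n%:~R / q%:R : R) = if (q%:Z %| n)%Z then q%:R else 0.
Proof.
move=> q0; have q0R : q%:R != 0 :> R by rewrite pnatr_eq0 -lt0n.
case: ifP => [/dvdzP[m ->]|qn].
  rewrite /geom (eq_bigr (fun=> 1)) ?sumr_const ?card_ord // => l _.
  by rewrite intrM -pmulrn mulfK // -[l%:R]/(l%:Z%:~R) -intrM expi_int.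
have nE : n%:~R / q%:R = (n %% q)%Z%:~R / q%:R + (n %/ q)%Z%:~R :> R.
  rewrite {1}(divz_eq n q) intrD intrM -[q%:Z%:~R]/(q%:R) mulrDl mulfK //.
  by rewrite addrC.
have := geom_mul q (n%:~R / q%:R : R); rewrite mulrCA mulfV // mulr1 expi_int subrr.
move=> /eqP; rewrite mulf_eq0 => /orP[|/eqP //].
rewrite subr_eq0 eq_sym nE expiDint => /eqP h; exfalso.
suff : expi ((n %% q)%Z%:~R / q%:R : R) != 1 by rewrite h eqxx.
apply: expi_neq1.
have r0 : 0 < (n %% q)%Z.
  rewrite lt_neqAle modz_ge0 ?andbT; last by lia.
  by rewrite eq_sym; apply/eqP => /dvdz_mod0P; rewrite qn.
rewrite divr_gt0 ?ltr0n ?ltr0z // ltr_pdivrMr ?ltr0n // mul1r.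
rewrite -[ltRHS]/(q%:Z%:~R) ltr_int; have := ltz_mod n (_ : q%:Z != 0); lia.
Qed.

(** A Ramanujan sum in which only the primes of [ps] are sieved out; the list of
    primes is the induction variable that replaces the Moebius function. *)
Definition sifted_sum (ps : seq nat) (q : nat) (n : int) : R[i] :=
  \sum_(0 <= a < q | all (fun p => ~~ (p %| a)%N) ps) expi (a%:R * (n%:~R / q%:R)).

Lemma big_multiples (V : nmodType) (p q : nat) (P : pred nat) (F : nat -> V) :
  (0 < p)%N ->
  \sum_(0 <= a < p * q | (p %| a)%N && P a) F a = \sum_(0 <= b < q | P (p * b)%N) F (p * b)%N.
Proof.
move=> p0; rewrite -(big_map (muln p) P F) -[LHS]big_filter -[RHS]big_filter.
apply: perm_big; apply: uniq_perm.
- by rewrite filter_uniq ?iota_uniq.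
- by rewrite filter_uniq // map_inj_uniq ?iota_uniq // => x y /eqP; rewrite eqn_pmul2l // => /eqP.
move=> x; rewrite !mem_filter mem_index_iota /=.
case Px: (P x); rewrite ?andbF ?andbT //=; apply/andP/mapP.
  move=> [/dvdnP[y ->]]; rewrite mulnC ltn_pmul2l // => yq.
  by exists y; rewrite ?mem_index_iota // mulnC.
by move=> [y yq ->]; rewrite dvdn_mulr // ltn_pmul2l //; move: yq; rewrite mem_index_iota.
Qed.

(** The residues divisible by p, divided by p, run over the residues modulo q/p. *)
Lemma sifted_sum_cons (p : nat) (ps : seq nat) (q : nat) (n : int) :
  prime p -> all prime ps -> p \notin ps -> (0 < q)%N -> (p %| q)%N ->
  sifted_sum (p :: ps) q n = sifted_sum ps q n - sifted_sum ps (q %/ p) n.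
Proof.
move=> pp pps pn q0 pq; have p0 := prime_gt0 pp.
apply/eqP; rewrite -subr_eq opprK; apply/eqP.
rewrite [sifted_sum ps q n]/sifted_sum (bigID (fun a => (p %| a)%N)) /= addrC; congr (_ + _).
  by rewrite /sifted_sum; apply: eq_bigl => a /=; rewrite andbC.
have qE : q = (p * (q %/ p))%N by rewrite mulnC divnK.
rewrite [in RHS]qE; under eq_bigl do rewrite andbC.
rewrite big_multiples // /sifted_sum; apply: eq_big => [b|b _].
  apply: eq_in_all => r rps; congr (~~ _); rewrite Euclid_dvdM ?(allP pps) //.
  rewrite (dvdn_prime2 (allP pps r rps) pp).
  by case: eqP => // rp; rewrite -rp rps in pn.
congr expi; rewrite !natrM; field.
by rewrite !pnatr_eq0 -!lt0n p0 divn_gt0 // dvdn_leq.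
Qed.

(** Restricting to the d such that q/d has all its prime factors in [ps] is what
    makes the induction work: the d coming from q and from q/p are then told apart
    by the divisibility of q/d by p, so their sums simply add up. *)
Lemma cabs_sifted_sum_le (ps : seq nat) (q : nat) (n : int) :
  uniq ps -> all prime ps -> (0 < q)%N -> (forall p, p \in ps -> (p %| q)%N) ->
  cabs (sifted_sum ps q n) <=
    (\sum_(1 <= d < q.+1 | [&& (d %| q)%N, (d%:Z %| n)%Z & [pred r in ps].-nat (q %/ d)%N]) d)%:R.
Proof.
elim: ps q => [|p ps IH] q /=.
  move=> _ _ q0 _; rewrite /sifted_sum big_mkord -/(geom q _) geom_dvd //.
  case: ifP => qn; last by rewrite cabs0.
  rewrite (big_rem q) /= ?mem_index_iota ?q0 ?ltnSn // dvdnn qn divnn q0 /=.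
  by rewrite cabs_nat ler_nat leq_addr.
move=> /andP[pn ups] /andP[pp pps] q0 hp.
have pq : (p %| q)%N by rewrite hp ?mem_head.
have psq r : r \in ps -> (r %| q)%N by move=> rps; rewrite hp // inE rps orbT.
have p0 := prime_gt0 pp.
have qE : q = (p * (q %/ p))%N by rewrite mulnC divnK.
have qp0 : (0 < q %/ p)%N by rewrite divn_gt0 // dvdn_leq.
have psqp r : r \in ps -> (r %| q %/ p)%N.
  move=> rps; have := psq r rps; rewrite {1}qE Euclid_dvdM ?(allP pps) //.
  rewrite (dvdn_prime2 (allP pps r rps) pp).
  by case: eqP => // rp; rewrite -rp rps in pn.
rewrite sifted_sum_cons //; apply: le_trans (cabsB _ _) _.
apply: le_trans (lerD (IH q ups pps q0 psq) (IH _ ups pps qp0 psqp)) _.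
rewrite -natrD ler_nat.
rewrite [X in (_ + X)%N](big_nat_widen _ _ q.+1) ?ltnS ?leq_div //.
rewrite [X in (_ <= X)%N](bigID (fun d => p %| q %/ d)%N) /= addnC leq_add //.
  rewrite big_mkcond [X in (_ <= X)%N]big_mkcond /=; apply: leq_sum => d _.
  case: ifP => // /andP[/and3P[dqp dn pd] _].
  have [m mE] : exists m, (q %/ p = m * d)%N by apply/dvdnP.
  have d0 : (0 < d)%N by rewrite lt0n; apply/eqP => d0; move: qp0; rewrite mE d0 muln0.
  have qd : (q %/ d = p * (q %/ p %/ d))%N.
    by rewrite mE mulnK // {1}qE mE mulnA mulnK.
  have -> : (d %| q)%N by rewrite (dvdn_trans dqp) // dvdn_div.
  rewrite dn qd dvdn_mulr //= pnatM pnatE // inE eqxx /=.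
  by rewrite (sub_in_pnat _ pd) // => r _ rp; rewrite inE rp orbT.
rewrite big_mkcond [X in (_ <= X)%N]big_mkcond /=; apply: leq_sum => d _.
case: ifP => // /and3P[dq dn pd].
have -> : ~~ (p %| q %/ d)%N.
  apply/negP => pqd; move/negP: pn; apply.
  have qd0 : (0 < q %/ d)%N by case/andP: pd.
  exact: (elimT (pnatP [pred r in ps] qd0) pd).
rewrite dq dn /= andbT (sub_in_pnat _ pd) // => r _ rp; by rewrite inE rp orbT.
Qed.

Lemma coprime_all_primes (a q : nat) : (0 < q)%N ->
  coprime a q = all (fun p => ~~ (p %| a)%N) (primes q).
Proof.
move=> q0; apply/idP/allP => [cop p|h].
  rewrite mem_primes => /and3P[pp _ pq]; apply/negP => pa.
  by have := dvdn_gcd p a q; rewrite pa pq (eqP cop) dvdn1 => /eqP p1; rewrite p1 in pp.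
rewrite /coprime; case: (ltngtP (gcdn a q) 1) => // g.
  by have := gcdn_gt0 a q; rewrite q0 orbT; lia.
have := h (pdiv (gcdn a q)); rewrite mem_primes pdiv_prime // q0.
rewrite (dvdn_trans (pdiv_dvd _)) ?dvdn_gcdr // (dvdn_trans (pdiv_dvd _)) ?dvdn_gcdl //.
by move=> /(_ isT).
Qed.

Definition ramanujan (q : nat) (n : int) : R[i] :=
  \sum_(0 <= a < q | coprime a q) expi (a%:R * (n%:~R / q%:R)).

Lemma cabs_ramanujan_le (q : nat) (n : int) : (0 < q)%N ->
  cabs (ramanujan q n) <= (\sum_(1 <= d < q.+1 | (d %| q)%N && (d%:Z %| n)%Z) d)%:R.
Proof.
move=> q0; rewrite /ramanujan; rewrite (eq_bigl _ _ (fun a => coprime_all_primes a q0)).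
apply: le_trans (cabs_sifted_sum_le _ (primes_uniq q) _ q0 _) _.
- by apply/allP => p; rewrite mem_primes => /andP[].
- by move=> p; rewrite mem_primes => /and3P[].
rewrite ler_nat big_mkcond [X in (_ <= X)%N]big_mkcond; apply: leq_sum => d _ /=.
by case: ifP => // /and3P[-> ->].
Qed.

End Ramanujan.

(** * The kernel of the low part *)
Section Kernel.
Variable R : realType.

Definition fejer (B M : nat) (n : int) : R :=
  (M%:R * B%:R)^-1 * cabs (geom B (n%:~R / M%:R : R)) ^+ 2.

Lemma fejer_ge0 B M n : 0 <= fejer B M n.
Proof. by rewrite mulr_ge0 ?sqr_ge0 // invr_ge0 mulr_ge0. Qed.

(** Square and add the two bounds M |geom| <= M B and B |n| |geom| <= 2 M B; the
    second holds because |n| <= M/2 is the distance from n to the multiples of M. *)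
Lemma fejer_le (B M : nat) (n : int) : (0 < B)%N -> (0 < M)%N -> (2 * `|n| <= M)%N ->
  fejer B M n <= 5 / (M%:R / B%:R) * lorentz (M%:R / B%:R) n.
Proof.
move=> B0 M0 nM; rewrite /fejer; set g := cabs (geom _ _).
have b0 : 0 < B%:R :> R by rewrite ltr0n.
have m0 : 0 < M%:R :> R by rewrite ltr0n.
have gB : g <= B%:R := cabs_geom_le _ _.
have g0 : 0 <= g := cabs_ge0 _.
have u2 : 2 * `|n%:~R| <= M%:R :> R.
  by rewrite -intr_norm -natr_absz -natrM ler_nat.
have u1 : 2 * (`|n%:~R| / M%:R) <= 1 :> R.
  by rewrite mulrA ler_pdivrMr // mul1r.
have u0 : 0 <= `|n%:~R| / M%:R :> R by rewrite divr_ge0.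
have ng : `|n%:~R| / M%:R * g <= 2.
  apply: le_trans (cabs_geom_mul B (n%:~R / M%:R : R)); rewrite ler_wpM2r //.
  have [n0|n0] := leP 0 n.
    rewrite ger0_norm ?ler0z // in u1 u0 *.
    by apply: le_trans (cabs_1Bexpi_ge _); [rewrite le_min; lra | lra].
  rewrite -(expiDint _ 1); rewrite ltr0_norm ?ltrz0 // in u1 u0 *.
  by apply: le_trans (cabs_1Bexpi_ge _); [rewrite le_min; lra | lra].
have ng2 : `|n%:~R| * g <= 2 * M%:R.
  by rewrite -ler_pdivrMr // mulrAC.
have h2 : n%:~R ^+ 2 * g ^+ 2 <= 4 * M%:R ^+ 2.
  rewrite -[X in X * _]real_normK ?num_real // -exprMn.
  have -> : 4 * M%:R ^+ 2 = (2 * M%:R) ^+ 2 :> R by ring.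
  by rewrite ler_sqr ?nnegrE ?mulr_ge0.
have h1 : g ^+ 2 <= B%:R ^+ 2 by rewrite ler_sqr ?nnegrE.
rewrite /lorentz.
have d0 : 0 < M%:R ^+ 2 + n%:~R ^+ 2 * B%:R ^+ 2 :> R.
  by rewrite ltr_pwDl ?exprn_gt0 // mulr_ge0 ?sqr_ge0.
have -> : 5 / (M%:R / B%:R) * ((M%:R / B%:R) ^+ 2 / ((M%:R / B%:R) ^+ 2 + n%:~R ^+ 2))
  = (M%:R * B%:R)^-1 * (5 * M%:R ^+ 2 * B%:R ^+ 2 / (M%:R ^+ 2 + n%:~R ^+ 2 * B%:R ^+ 2)) :> R.
  by field; rewrite exprMn (gt_eqF d0) (gt_eqF b0) (gt_eqF m0).
rewrite ler_wpM2l ?invr_ge0 ?mulr_ge0 // ler_pdivlMr //.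
have h3 : g ^+ 2 * M%:R ^+ 2 <= B%:R ^+ 2 * M%:R ^+ 2 by rewrite ler_wpM2r ?sqr_ge0.
have h4 : n%:~R ^+ 2 * g ^+ 2 * B%:R ^+ 2 <= 4 * M%:R ^+ 2 * B%:R ^+ 2 by rewrite ler_wpM2r ?sqr_ge0.
lra.
Qed.

(** The relation for [B] says that the q-th Fejer kernel lives at scale
    X = M / B q = 4 N^2 q / Q.  As Q <= N, this is at least d N for every divisor d
    of q, as [sum_squares_root] requires. *)
Lemma kernel_sup (N Q M : nat) (B : nat -> nat) (z : int) :
  (0 < N)%N -> (0 < Q <= N)%N -> (0 < M)%N ->
  (forall q, (0 < q <= Q)%N -> 0 < B q)%N ->
  (forall q, (0 < q <= Q)%N -> 4 * N ^ 2 * q * B q = M * Q)%N ->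
  (2 * (`|z| + N ^ 2) <= M)%N ->
  \sum_(N./2.+1 <= k < N.+1) \sum_(1 <= q < Q.+1)
     cabs (ramanujan R q (z - (k ^ 2)%N%:Z)) * fejer (B q) M (z - (k ^ 2)%N%:Z)
  <= 30 / N%:R * (Q%:R * harmonic R Q ^+ 3).
Proof.
move=> N0 /andP[Q0 QN] M0 B0 BE zM.
pose X q : R := M%:R / (B q)%:R.
(* Exchange the sums so that k is innermost, for fixed q and d. *)
pose Z k := z - (k ^ 2)%N%:Z.
have n0 : 0 < N%:R :> R by rewrite ltr0n.
apply: (@le_trans _ _ (\sum_(1 <= q < Q.+1) \sum_(1 <= d < q.+1 | (d %| q)%N)
    d%:R * (5 / X q) * \sum_(N./2.+1 <= k < N.+1 | (d%:Z %| Z k)%Z) lorentz (X q) (Z k))).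
  rewrite exchange_big big_nat_cond [leRHS]big_nat_cond.
  apply: ler_sum => q /andP[/andP[q1 qQ] _]; rewrite ltnS in qQ.
  have q1Q : (0 < q <= Q)%N by rewrite q1.
  under [leRHS]eq_bigr => d _ do rewrite mulr_sumr.
  rewrite (exchange_big_dep xpredT) //= big_nat_cond [leRHS]big_nat_cond.
  apply: ler_sum => k /andP[/andP[k1 kN] _].
  rewrite -mulr_suml -mulr_suml -natr_sum -mulrA.
  apply: ler_pM; rewrite ?cabs_ge0 ?fejer_ge0 //; first exact: cabs_ramanujan_le.
  apply: fejer_le; rewrite ?B0 //; apply: leq_trans zM; rewrite leq_mul2l /=.
  have : (k ^ 2 <= N ^ 2)%N by rewrite leq_sqr -ltnS.
  by move: (k ^ 2)%N (N ^ 2)%N => a b; lia.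
apply: le_trans (_ : _ <= 30 / N%:R * _) (ler_wpM2l _ (sum_gcd_le R Q)); last by rewrite divr_ge0.
rewrite natr_sum mulr_sumr big_nat_cond [leRHS]big_nat_cond.
apply: ler_sum => q /andP[/andP[q1 qQ] _]; rewrite ltnS in qQ.
have q1Q : (0 < q <= Q)%N by rewrite q1.
have b0 : 0 < (B q)%:R :> R by rewrite ltr0n B0.
have m0 : 0 < M%:R :> R by rewrite ltr0n.
have X0 : 0 < X q by rewrite divr_gt0.
rewrite natr_sum mulr_sumr big_nat_cond [leRHS]big_nat_cond.
apply: ler_sum => d /andP[/andP[d1 _] dq].
have dlq : (d <= q)%N by rewrite dvdn_leq.
have dX : (d * N)%:R <= X q.
  rewrite /X ler_pdivlMr // -natrM ler_nat -(leq_pmul2r Q0) -(BE q q1Q).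
  rewrite mulnAC; apply: leq_mul => //.
  have dQ : (d * Q <= q * N)%N by apply: leq_mul.
  apply: (@leq_trans (N * (q * N))%N); last by rewrite expnS expn1; lia.
  by rewrite mulnAC [X in (X <= _)%N]mulnC leq_mul2l dQ orbT.
apply: le_trans (ler_wpM2l _ (sum_squares_root _ N0 d1 dX)) _.
  by rewrite mulr_ge0 ?divr_ge0 // ltW.
rewrite -natr_sum natrM le_eqVlt; apply/orP; left; apply/eqP; field.
by rewrite !gt_eqF // ltr0n.
Qed.

End Kernel.

(** * From multipliers to bilinear forms *)
Section Transference.
Variable R : realType.
Local Notation "x %:C" := (real_complex R x) : ring_scope.

Definition sqsum (N : nat) (al : R) : R[i] :=
  \sum_(N./2.+1 <= k < N.+1) expi ((k ^ 2)%:R * al).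

Lemma conjcM (z w : R[i]) : (z * w)^*%C = z^*%C * w^*%C.
Proof. exact: rmorphM. Qed.

Lemma realcM (x y : R) : (x * y)%:C = x%:C * y%:C.
Proof. exact: rmorphM. Qed.

Lemma conjc_sum (I : Type) (r : seq I) (P : pred I) (F : I -> R[i]) :
  (\sum_(i <- r | P i) F i)^*%C = \sum_(i <- r | P i) (F i)^*%C.
Proof. exact: rmorph_sum. Qed.

Lemma realc_sum (I : Type) (r : seq I) (P : pred I) (F : I -> R) :
  (\sum_(i <- r | P i) F i)%:C = \sum_(i <- r | P i) (F i)%:C.
Proof. exact: rmorph_sum. Qed.

Lemma realc_nat (n : nat) : (n%:R)%:C = n%:R.
Proof. exact: rmorph_nat. Qed.

Variables (M W : nat).
Hypothesis M0 : (0 < M)%N.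

Definition freq (b : nat) : R := b%:R / M%:R.

Definition fourier (f : nat -> R) (b : nat) : R[i] :=
  \sum_(y < W) (f y)%:C * expi (y%:R * freq b).

Definition inv_fourier (mu : nat -> R[i]) (n : int) : R[i] :=
  \sum_(b < M) mu b * expi (n%:~R * freq b).

(** Both Plancherel's formula and the transference below are instances, for
    different multipliers [mu]. *)
Lemma fourier_bilinear (f g : nat -> R) (mu : nat -> R[i]) :
  \sum_(b < M) fourier f b * (fourier g b)^*%C * mu b =
  \sum_(y < W) \sum_(x < W) (f y * g x)%:C * inv_fourier mu (y%:Z - x%:Z).
Proof.
have E b : fourier f b * (fourier g b)^*%C * mu b = \sum_(y < W) \sum_(x < W)
    (f y * g x)%:C * (mu b * expi ((y%:Z - x%:Z)%:~R * freq b)).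
  rewrite /fourier conjc_sum !mulr_suml; apply: eq_bigr => y _.
  rewrite mulr_sumr mulr_suml; apply: eq_bigr => x _.
  rewrite conjcM conjc_real realcM -expiN.
  by rewrite intrB -!pmulrn mulrBl expiD; ring.
under eq_bigr do rewrite E.
rewrite exchange_big; apply: eq_bigr => y _.
rewrite exchange_big; apply: eq_bigr => x _.
by rewrite mulr_sumr.
Qed.

Lemma sum_freq (n : int) :
  \sum_(b < M) expi (n%:~R * freq b) = if (M%:Z %| n)%Z then M%:R else 0.
Proof.
rewrite -geom_dvd //; apply: eq_bigr => b _; congr expi.
by rewrite /freq; ring.
Qed.

Lemma small_dvd (n : int) : (`|n| < M)%N -> (M%:Z %| n)%Z = (n == 0).
Proof.
move=> nM; apply/idP/eqP => [|->]; last exact: dvdz0.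
rewrite dvdzE /= => d; apply/eqP; rewrite -absz_eq0.
by apply/negPn/negP => n0; have := dvdn_leq (_ : 0 < `|n|)%N d; lia.
Qed.

Lemma plancherel (f : nat -> R) : (W <= M)%N ->
  \sum_(b < M) cabs (fourier f b) ^+ 2 = M%:R * \sum_(y < W) f y ^+ 2.
Proof.
move=> WM; apply: complexI; rewrite realc_sum.
apply: etrans (etrans (fourier_bilinear f f (fun=> 1)) _).
  by apply: eq_bigr => b _; rewrite cabs_sqr mulr1.
rewrite realcM realc_sum mulr_sumr; apply: eq_bigr => y _.
rewrite (bigD1 y) //= big1 ?addr0 => [|x xy].
  rewrite subrr /inv_fourier; under eq_bigr do rewrite mul1r.
  by rewrite sum_freq dvdz0 mulrC realc_nat -expr2.
rewrite /inv_fourier; under eq_bigr do rewrite mul1r.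
rewrite sum_freq small_dvd; last by have := ltn_ord x; have := ltn_ord y; lia.
by rewrite subr_eq0 eqz_nat eq_sym (negPf xy : (x == y :> nat) = false) mulr0.
Qed.

(** No wrap-around occurs modulo M: the arguments of the form are smaller than
    W + N^2 < M, so divisibility by M detects y - x = k^2.  The factor [m] is split
    off the Fourier transform of the squares; the remainder is bounded by
    Plancherel's formula. *)
Lemma transference (N : nat) (f g : nat -> R) (m : nat -> R[i]) (A H : R) :
  (W + N ^ 2 < M)%N -> (forall y, 0 <= f y) -> (forall y, 0 <= g y) ->
  (forall y, (W <= y)%N -> f y = 0) ->
  (forall n : int, (`|n| < W)%N ->
     cabs (inv_fourier (fun b => (sqsum N (freq b))^*%C * m b) n) <= M%:R * A) ->
  (forall b, (b < M)%N -> cabs ((sqsum N (freq b)) ^*%C * (1 - m b)) <= H) ->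
  \sum_(N./2.+1 <= k < N.+1) \sum_(x < W) f (x + k ^ 2)%N * g x <=
    A * (\sum_(y < W) f y) * (\sum_(x < W) g x)
    + H * ((\sum_(y < W) f y ^+ 2 + \sum_(x < W) g x ^+ 2) / 2).
Proof.
move=> WM f0 g0 fW hA hH.
have m0 : 0 < M%:R :> R by rewrite ltr0n.
have WM' : (W <= M)%N by lia.
pose T b := (sqsum N (freq b))^*%C.
have invT n : (`|n| < W)%N -> inv_fourier T n =
   (M%:R * \sum_(N./2.+1 <= k < N.+1) (n == (k ^ 2)%N%:Z)%:R)%:C.
  move=> nW; rewrite /inv_fourier /T.
  have E (b : 'I_M) : (sqsum N (freq b))^*%C * expi (n%:~R * freq b) =
      \sum_(N./2.+1 <= k < N.+1) expi ((n - (k ^ 2)%N%:Z)%:~R * freq b).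
    rewrite /sqsum conjc_sum mulr_suml; apply: eq_bigr => k _.
    by rewrite -expiN -expiD intrB mulrBl addrC.
  rewrite (eq_bigr _ (fun b _ => E b)).
  rewrite exchange_big realcM realc_sum mulr_sumr.
  rewrite big_nat_cond [RHS]big_nat_cond; apply: eq_bigr => k /andP[/andP[_ kN] _].
  rewrite sum_freq small_dvd ?subr_eq0; last first.
    have : (k ^ 2 <= N ^ 2)%N by rewrite leq_sqr -ltnS.
    by move: WM; move: (k ^ 2)%N (N ^ 2)%N => a b; lia.
  by case: eqP; rewrite !realc_nat ?mulr1 ?mulr0.
pose S := \sum_(b < M) fourier f b * (fourier g b)^*%C * T b.
have Sge : M%:R * \sum_(N./2.+1 <= k < N.+1) \sum_(x < W) f (x + k ^ 2)%N * g x <= complex.Re S.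
  rewrite /S fourier_bilinear.
  have -> : \sum_(y < W) \sum_(x < W) (f y * g x)%:C * inv_fourier T (y%:Z - x%:Z) =
     (M%:R * \sum_(N./2.+1 <= k < N.+1) \sum_(x < W) \sum_(y < W) f y * g x * (y%:Z - x%:Z == (k ^ 2)%N%:Z)%:R)%:C.
    have E (y x : 'I_W) : (f y * g x)%:C * inv_fourier T (y%:Z - x%:Z) =
        (M%:R * \sum_(N./2.+1 <= k < N.+1) f y * g x * (y%:Z - x%:Z == (k ^ 2)%N%:Z)%:R)%:C.
      rewrite invT; last by have := ltn_ord x; have := ltn_ord y; lia.
      rewrite -realcM; congr (_%:C); by rewrite mulrCA -mulr_sumr.
    under eq_bigr => y _ do rewrite (eq_bigr _ (fun x _ => E y x)) -realc_sum -mulr_sumr.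
    rewrite -realc_sum -mulr_sumr; congr ((_ * _)%:C).
    rewrite exchange_big [RHS]exchange_big /=; apply: eq_bigr => x _.
    by rewrite exchange_big.
  rewrite /= ler_pM2l //; apply: ler_sum => k _; apply: ler_sum => x _.
  have [xW|xW] := ltnP (x + k ^ 2)%N W; last first.
    by rewrite fW // mul0r sumr_ge0 // => y _; rewrite !mulr_ge0.
  rewrite (bigD1 (Ordinal xW)) //= PoszD addrAC subrr add0r eqxx mulr1 lerDl.
  by rewrite sumr_ge0 // => y _; rewrite !mulr_ge0.
have Sle : cabs S <= M%:R * (A * (\sum_(y < W) f y) * (\sum_(x < W) g x)
    + H * ((\sum_(y < W) f y ^+ 2 + \sum_(x < W) g x ^+ 2) / 2)).
  have -> : S = \sum_(b < M) fourier f b * (fourier g b)^*%C * (T b * m b)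
     + \sum_(b < M) fourier f b * (fourier g b)^*%C * (T b * (1 - m b)).
    by rewrite -big_split; apply: eq_bigr => b _ /=; ring.
  apply: le_trans (cabsD _ _) _; rewrite mulrDr; apply: lerD.
    rewrite (fourier_bilinear f g (fun b => T b * m b)); apply: le_trans (cabs_sum _ _ _) _.
    have -> : M%:R * (A * (\sum_(y < W) f y) * (\sum_(x < W) g x)) =
      \sum_(y < W) \sum_(x < W) f y * g x * (M%:R * A).
      under [RHS]eq_bigr do rewrite -mulr_suml -mulr_sumr.
      by rewrite -!mulr_suml; ring.
    apply: ler_sum => y _; apply: le_trans (cabs_sum _ _ _) _; apply: ler_sum => x _.
    rewrite cabsM cabs_real ger0_norm ?mulr_ge0 //.
    rewrite ler_wpM2l ?mulr_ge0 // hA //.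
    by have := ltn_ord x; have := ltn_ord y; lia.
  apply: le_trans (cabs_sum _ _ _) _.
  have -> : M%:R * (H * ((\sum_(y < W) f y ^+ 2 + \sum_(x < W) g x ^+ 2) / 2)) =
     \sum_(b < M) (cabs (fourier f b) ^+ 2 + cabs (fourier g b) ^+ 2) / 2 * H.
    rewrite -mulr_suml -mulr_suml big_split /= !plancherel //; ring.
  apply: ler_sum => b _; rewrite cabsM [cabs (_ * (_)^*%C)]cabsM cabs_conj.
  apply: ler_pM; rewrite ?cabs_ge0 ?mulr_ge0 ?cabs_ge0 ?hH //.
  have := sqr_ge0 (cabs (fourier f b) - cabs (fourier g b)); lra.
by rewrite -(ler_pM2l m0); apply: le_trans Sge _; apply: le_trans (Re_le_cabs _) Sle.
Qed.

End Transference.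

(** * Weyl sums on minor arcs *)
Section Weyl.
Variable R : realType.

(** Grouping the pairs j < i by their difference. *)
Lemma sum_triangle (V : nmodType) (n : nat) (F : nat -> nat -> V) :
  \sum_(i < n) \sum_(j < i) F i j =
  \sum_(h < n) \sum_(j < n - h.+1) F (j + h.+1)%N j.
Proof.
elim: n => [|n IH]; first by rewrite !big_ord0.
rewrite big_ord_recr /= IH [RHS]big_ord_recr /= subnn big_ord0 addr0.
rewrite [X in _ + X](reindex_inj rev_ord_inj) -big_split /=; apply: eq_bigr => h _.
rewrite subSS -(subnSK (ltn_ord h)) big_ord_recr /= subnK //.
Qed.

Lemma cabs_sum_sqr_le (n : nat) (z : nat -> R[i]) : (forall i, cabs (z i) = 1) ->
  cabs (\sum_(i < n) z i) ^+ 2 <=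
    n%:R + 2 * cabs (\sum_(i < n) \sum_(j < i) z i * (z j)^*%C).
Proof.
move=> z1; set D := \sum_(i < n) _.
suff h : (cabs (\sum_(i < n) z i) ^+ 2)%:C%C = n%:R + (D + D^*%C).
  rewrite -[leLHS]ger0_norm ?sqr_ge0 // -cabs_real h.
  apply: le_trans (cabsD _ _) _; rewrite cabs_nat lerD2l.
  by apply: le_trans (cabsD _ _) _; rewrite cabs_conj; lra.
rewrite {}/D cabs_sqr; elim: n => [|n IH]; first by rewrite !big_ord0 conjc0 mul0r !addr0.
have zz : z n * (z n)^*%C = 1 by rewrite -cabs_sqr z1 expr1n.
have cD (x y : R[i]) : (x + y)^*%C = x^*%C + y^*%C by exact: rmorphD.
rewrite !big_ord_recr /= -mulr_sumr -conjc_sum.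
move: IH; set S := \sum_(i < n) z i; set D := \sum_(i < n) _ => IH.
rewrite !cD conjcM conjcK mulrDl !mulrDr IH zz -natr1; ring.
Qed.

(** The phase (k + h)^2 - k^2 is linear in k, so that every difference h leaves a
    geometric sum. *)
Lemma weyl_differencing (s n : nat) (al : R) :
  cabs (\sum_(i < n) expi (((s + i) ^ 2)%:R * al)) ^+ 2 <=
    n%:R + 2 * \sum_(h < n) cabs (geom (n - h.+1) (2 * h.+1%:R * al)).
Proof.
pose z i := expi (((s + i) ^ 2)%:R * al).
apply: le_trans (@cabs_sum_sqr_le n z (fun i => cabs_expi _)) _.
rewrite lerD2l ler_pM2l // (sum_triangle n (fun i j => z i * (z j)^*%C)).
apply: le_trans (cabs_sum _ _ _) _; apply: ler_sum => h _.
set c := expi ((h.+1%:R ^+ 2 + 2 * h.+1%:R * s%:R) * al).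
have -> : \sum_(j < n - h.+1) z (j + h.+1)%N * (z j)^*%C = c * geom (n - h.+1) (2 * h.+1%:R * al).
  rewrite /geom mulr_sumr; apply: eq_bigr => j _.
  rewrite /z /c -expiN -!expiD; congr expi.
  by rewrite !natrX !natrD; ring.
by rewrite cabsM cabs_expi mul1r.
Qed.

Definition frac (t : R) : R := t - (Num.floor t)%:~R.

Lemma frac_itv t : 0 <= frac t < 1.
Proof.
by rewrite /frac subr_ge0 floor_le_tmp /= ltrBlDl -[_%:~R + 1](intrD _ _ 1) floorD1_gt.
Qed.

(** Bound for a geometric sum of at most N terms whose frequency has its
    fractional part in the i-th cell of length 1/K; in the cell 0 only the trivial
    bound is available. *)
Definition majorant (N K : nat) (i : nat) : R :=
  if i == 0%N then N%:R else Num.min N%:R (2 * K%:R / i%:R).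

Lemma majorant_ge0 N K i : 0 <= majorant N K i.
Proof.
by rewrite /majorant; case: ifP.
Qed.

Lemma majorant_mono N K i j : (i <= j)%N -> majorant N K j <= majorant N K i.
Proof.
move=> ij; rewrite /majorant; have [_|i0] := posnP i.
  by case: ifP => // _; rewrite ge_min lexx.
have j0 : (0 < j)%N := leq_trans i0 ij.
rewrite !gtn_eqF // le_min ge_min lexx /= ge_min; apply/orP; right.
by rewrite ler_wpM2l ?mulr_ge0 // lef_pV2 ?posrE ?ltr0n // ler_nat.
Qed.

(** The minimum is at most the geometric mean N^k (2K/i)^(1-k), whose sum over i
    has no logarithm.  A logarithm of N at this place would be fatal, since the
    final constant may not depend on N. *)
Lemma sum_majorant_le (N K n : nat) (k : R) : (0 < N)%N -> (0 < K)%N -> 0 < k -> k <= 1 ->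
  \sum_(i < n) majorant N K i <=
    N%:R + N%:R `^ k * (2 * K%:R) `^ (1 - k) * (n%:R `^ k / k).
Proof.
move=> N0 K0 k0 k1; have NR : 0 < N%:R :> R by rewrite ltr0n.
have KR : 0 < 2 * K%:R :> R by rewrite mulr_gt0 // ltr0n.
case: n => [|n]; first by rewrite big_ord0 addr_ge0 ?mulr_ge0 ?powR_ge0 ?invr_ge0 // ltW.
rewrite big_ord_recl /= lerD2l.
apply: le_trans (_ : _ <= N%:R `^ k * (2 * K%:R) `^ (1 - k) * (n%:R `^ k / k)) _; last first.
  rewrite ler_wpM2l ?mulr_ge0 ?powR_ge0 // ler_wpM2r ?invr_ge0 ?(ltW k0) //.
  by rewrite ge0_ler_powR ?nnegrE ?(ltW k0) // ler_nat.
apply: le_trans (ler_wpM2l _ (sum_powR_le n k0 k1)); last by rewrite mulr_ge0 ?powR_ge0.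
rewrite mulr_sumr; apply: ler_sum => i _; rewrite /majorant /=.
have iR : 0 < i.+1%:R :> R by rewrite ltr0n.
have y0 : 0 < 2 * K%:R / i.+1%:R :> R by rewrite divr_gt0.
have -> : i.+1%:R `^ (k - 1) = i.+1%:R^-1 `^ (1 - k) :> R.
  by rewrite -powR_inv1 ?(ltW iR) // -powRrM mulN1r opprB.
rewrite -[leRHS]mulrA -powRM ?invr_ge0 ?(ltW iR) ?(ltW KR) //.
set m := Num.min _ _; have m0 : 0 < m by rewrite lt_min NR.
have -> : m = m `^ k * m `^ (1 - k).
  by rewrite -powRD ?(gt_eqF m0) ?implybT // addrC subrK powRr1 // ltW.
apply: ler_pM; rewrite ?powR_ge0 //; apply: ge0_ler_powR; rewrite ?nnegrE ?(ltW m0) ?(ltW NR) ?(ltW y0) ?(ltW k0) ?subr_ge0 //.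
  by rewrite ge_min lexx.
by rewrite ge_min lexx orbT.
Qed.

(** One summand takes care of fractional parts near 0, the other of those near 1. *)
Lemma geom_le_majorant (N n K : nat) (t : R) : (0 < K)%N -> (n <= N)%N ->
  cabs (geom n t) <= majorant N K (Num.truncn (K%:R * frac t))
                   + majorant N K (Num.truncn (K%:R * (1 - frac t))).
Proof.
move=> K0 nN; have KR : 0 < K%:R :> R by rewrite ltr0n.
have /andP[u0 u1] := frac_itv t; set u := frac t in u0 u1 *.
have g0 : 0 <= cabs (geom n t) := cabs_ge0 _.
have gN : cabs (geom n t) <= N%:R by apply: le_trans (cabs_geom_le _ _) _; rewrite ler_nat.
have gu : Num.min u (1 - u) * cabs (geom n t) <= 2.
  apply: le_trans (cabs_geom_mul n t); rewrite ler_wpM2r //.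
  have -> : expi t = expi u by rewrite -[t in LHS](subrK (Num.floor t)%:~R) expiDint.
  by apply: cabs_1Bexpi_ge; lra.
(* Either fractional part works as soon as it is the smaller of the two. *)
have key x : 0 <= x -> x * cabs (geom n t) <= 2 ->
    cabs (geom n t) <= majorant N K (Num.truncn (K%:R * x)).
  move=> x0 xg; rewrite /majorant; have [_//|v0] := posnP (Num.truncn _).
  rewrite le_min gN /= ler_pdivlMr ?ltr0n //.
  have /andP[vx _] := truncn_itv (mulr_ge0 (ltW KR) x0).
  apply: le_trans (ler_wpM2l g0 vx) _.
  by rewrite mulrCA [cabs _ * _]mulrC [2 * _]mulrC ler_pM2l.
have [h|h] := leP u (1 - u).
  by rewrite -[leLHS]addr0 lerD ?majorant_ge0 // key //; move: gu; rewrite (min_idPl h).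
rewrite -[leLHS]add0r lerD ?majorant_ge0 // key //; first lra.
by move: gu; rewrite (min_idPr (ltW h)).
Qed.

(** When |d| <= q/4, replacing [al] by a/q moves 2 d al by at most 1/(2q), so the
    integer 2 d a - n q has absolute value less than 1 and q divides 2 d, which is
    smaller than q in absolute value. *)
Lemma rational_separation (al : R) (a : int) (q : nat) (d n : int) :
  (0 < q)%N -> coprime `|a| q -> `|al - a%:~R / q%:R| <= q%:R ^- 2 ->
  (4 * `|d| <= q)%N -> `|2 * d%:~R * al - n%:~R| < (2 * q%:R)^-1 -> d = 0.
Proof.
move=> q0 cop beta dq near.
have qR : 0 < q%:R :> R by rewrite ltr0n.
have dqR : 4 * `|d%:~R| <= q%:R :> R by rewrite -intr_norm -natr_absz -natrM ler_nat.
have small : `|(2 * d * a - n * q%:Z)%:~R| < 1 :> R.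
  have -> : (2 * d * a - n * q%:Z)%:~R =
     q%:R * ((2 * d%:~R * al - n%:~R) - 2 * d%:~R * (al - a%:~R / q%:R)) :> R.
    by rewrite intrB !intrM -[q%:Z%:~R]/(q%:R); field; rewrite gt_eqF.
  rewrite normrM (ger0_norm (ltW qR)).
  have b2 : `|2 * d%:~R * (al - a%:~R / q%:R)| <= (2 * q%:R)^-1.
    rewrite !normrM (ger0_norm (ler0n _ 2)).
    apply: le_trans (ler_wpM2l _ beta) _; first by rewrite mulr_ge0.
    rewrite ler_pdivrMr ?exprn_gt0 //.
    have -> : (2 * q%:R)^-1 * q%:R ^+ 2 = q%:R / 2 :> R by field; rewrite gt_eqF.
    lra.
  have b3 := ler_normB (2 * d%:~R * al - n%:~R) (2 * d%:~R * (al - a%:~R / q%:R)).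
  have b4 : q%:R * (2 * q%:R)^-1 = 2^-1 :> R by field; rewrite gt_eqF.
  apply: le_lt_trans (ler_wpM2l (ltW qR) b3) _.
  have b5 : q%:R * `|2 * d%:~R * (al - a%:~R / q%:R)| <= 2^-1.
    by rewrite -b4 ler_wpM2l // ltW.
  have b6 : q%:R * `|2 * d%:~R * al - n%:~R| < 2^-1 by rewrite -b4 ltr_pM2l.
  by rewrite mulrDr; lra.
have z0 : 2 * d * a - n * q%:Z = 0.
  by move: small; rewrite -intr_norm -[1]/(1%:~R) ltr_int; lia.
have : (q %| `|d| * 2)%N.
  rewrite -(@Gauss_dvdl _ _ `|a|) 1?coprime_sym //.
  suff : (q%:Z %| 2 * d * a)%Z by rewrite dvdzE /= !abszM mulnAC mulnC mulnA.
  by apply/dvdzP; exists n; lia.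
by case: (posnP `|d|%N) => [/eqP|d0 /dvdn_leq]; rewrite ?absz_eq0; [move=> /eqP|lia].
Qed.

End Weyl.

Section Minor.
Variable R : realType.

Lemma truncn_eq_dist (x y : R) : 0 <= x -> 0 <= y -> Num.truncn x = Num.truncn y -> `|x - y| < 1.
Proof.
move=> x0 y0 e; have /andP[a b] := truncn_itv x0; have /andP[c d] := truncn_itv y0.
by rewrite -e -natr1 in c d b *; rewrite ltr_norml; lra.
Qed.

(** By [rational_separation], within a block of length at most q/4 the fractional
    parts of 2 h al lie in different cells of length 1/(2q). *)
Lemma block_sum_le (N n L j q : nat) (al : R) (a : int) (c : nat) :
  (n <= N)%N -> (0 < q)%N -> coprime `|a| q -> `|al - a%:~R / q%:R| <= q%:R ^- 2 ->
  (0 < L)%N -> (4 * L.-1 <= q)%N -> (L <= c)%N || (n <= c)%N ->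
  \sum_(0 <= h < n | (h %/ L == j)%N) cabs (geom (n - h.+1) (2 * h.+1%:R * al))
    <= 2 * \sum_(i < c) majorant R N (2 * q) i.
Proof.
move=> nN q0 cop beta L0 Lq Lc; set K := (2 * q)%N.
have K0 : (0 < K)%N by rewrite muln_gt0.
have KR : 0 < K%:R :> R by rewrite ltr0n.
pose u (h : nat) := frac (2 * h.+1%:R * al).
have u0 h : 0 <= u h by have /andP[] := frac_itv (2 * h.+1%:R * al).
have u1 h : 0 <= 1 - u h by rewrite subr_ge0; have /andP[_ /ltW] := frac_itv (2 * h.+1%:R * al).
have cnt : (count (fun h => h %/ L == j)%N (index_iota 0 n) <= c)%N.
  case/orP: Lc => [Lc|nc]; apply: leq_trans (_ : _ <= _)%N; [|exact: Lc| |exact: nc].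
    rewrite -size_filter -[X in (_ <= X)%N](size_iota (j * L) L); apply: uniq_leq_size.
      by rewrite filter_uniq ?iota_uniq.
    move=> h; rewrite mem_filter !mem_iota => /andP[/eqP <- _].
    by rewrite leq_divM /= addnC -mulSn ltn_ceil.
  by apply: leq_trans (count_size _ _) _; rewrite size_iota subn0.
have sep h h' : (h %/ L == j)%N -> (h' %/ L == j)%N -> K%:R * `|u h - u h'| < 1 -> h = h'.
  move=> /eqP hj /eqP hj' near.
  suff : h%:Z - h'%:Z = 0 by lia.
  pose m := Num.floor (2 * h.+1%:R * al) - Num.floor (2 * h'.+1%:R * al).
  apply: (@rational_separation R al a q _ m) => //.
    have := divn_eq h L; have := divn_eq h' L; rewrite hj hj'.
    have := ltn_mod h L; have := ltn_mod h' L; rewrite L0.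
    by move: (h %% L)%N (h' %% L)%N (j * L)%N => r r' w; lia.
  have -> : 2 * (h%:Z - h'%:Z)%:~R * al - m%:~R = u h - u h' :> R.
    by rewrite /u /frac /m !intrB -!pmulrn -![_.+1%:R]natr1; ring.
  have -> : 2 * q%:R = K%:R :> R by rewrite natrM.
  by rewrite -(ltr_pM2l KR) mulfV ?gt_eqF.
apply: le_trans (ler_sum _ (fun h _ => geom_le_majorant _ K0 (leq_trans (leq_subr _ _) nN))) _.
rewrite big_split mulr2n mulrDl mul1r /=; apply: lerD.
  apply: (sum_inj_le (v := fun h => Num.truncn (K%:R * u h))) cnt.
  - exact: majorant_ge0.
  - exact: majorant_mono.
  - exact: iota_uniq.
  move=> h h'; rewrite !mem_filter => /andP[hj _] /andP[hj' _] e.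
  apply: sep => //; rewrite -[X in X * _](ger0_norm (ltW KR)) -normrM mulrBr.
  by apply: truncn_eq_dist => //; rewrite mulr_ge0.
apply: (sum_inj_le (v := fun h => Num.truncn (K%:R * (1 - u h)))) cnt.
- exact: majorant_ge0.
- exact: majorant_mono.
- exact: iota_uniq.
move=> h h'; rewrite !mem_filter => /andP[hj _] /andP[hj' _] e.
apply: sep => //; rewrite -normrN -[X in X * _](ger0_norm (ltW KR)) -normrM.
have -> : K%:R * - (u h - u h') = K%:R * (1 - u h) - K%:R * (1 - u h') by ring.
by apply: truncn_eq_dist => //; rewrite mulr_ge0.
Qed.

(** The differences h <= N fall into at most 4N/q + 1 blocks of length about q/4.
    The number [c] of cells that can be occupied is bounded by q and by N; which
    bound is used depends on whether q <= N. *)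
Lemma weyl_sum_le (N q : nat) (al : R) (a : int) (c : nat) :
  (0 < N)%N -> (0 < q)%N -> coprime `|a| q -> `|al - a%:~R / q%:R| <= q%:R ^- 2 ->
  (q <= c)%N || (N <= c)%N ->
  cabs (sqsum N al) ^+ 2 <=
    N%:R + 4 * (4 * N%:R / q%:R + 1) * \sum_(i < c) majorant R N (2 * q) i.
Proof.
move=> N0 q0 cop beta qc; pose n := (N - N./2)%N; pose L := ((q + 3) %/ 4)%N.
have nN : (n <= N)%N by rewrite leq_subr.
have L0 : (0 < L)%N by rewrite divn_gt0 //; lia.
have Lq : (4 * L.-1 <= q)%N by rewrite /L; lia.
have LQ : (L <= q)%N by rewrite /L; lia.
have qL : (q <= 4 * L)%N by rewrite /L; lia.
have -> : sqsum N al = \sum_(i < n) expi (((N./2.+1 + i) ^ 2)%:R * al).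
  rewrite /sqsum -{1}[N./2.+1]add0n big_addn subSS big_mkord.
  by apply: eq_bigr => i _; rewrite addnC.
apply: le_trans (weyl_differencing _ _ _) _.
set S := \sum_(i < c) _.
have S0 : 0 <= S by rewrite sumr_ge0 // => *; apply: majorant_ge0.
apply: lerD; first by rewrite ler_nat.
have -> : 4 * (4 * N%:R / q%:R + 1) * S = 2 * (2 * ((4 * N%:R / q%:R + 1) * S)) by ring.
rewrite ler_pM2l //.
pose F h := cabs (geom (n - h.+1) (2 * h.+1%:R * al)).
rewrite -(big_mkord xpredT F).
have -> : \sum_(0 <= h < n) F h = \sum_(j < (N %/ L).+1) \sum_(0 <= h < n | (h %/ L == j)%N) F h.
  rewrite (exchange_big_dep xpredT) //=; rewrite big_nat_cond [RHS]big_nat_cond.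
  apply: eq_bigr => h /andP[/andP[_ hn] _].
  have hj : (h %/ L < (N %/ L).+1)%N by rewrite ltnS leq_div2r // ltnW // (leq_trans hn).
  by rewrite (big_pred1 (Ordinal hj)) // => j; rewrite -val_eqE /= eq_sym.
have blk j : \sum_(0 <= h < n | (h %/ L == j)%N) F h <= 2 * S.
  apply: (block_sum_le j nN q0 cop beta L0 Lq).
  by case/orP: qc => [qc|Nc]; [rewrite (leq_trans LQ qc) | rewrite (leq_trans nN Nc) orbT].
apply: le_trans (ler_sum _ (fun (j : 'I_(N %/ L).+1) _ => blk j)) _.
rewrite sumr_const card_ord -[leLHS]mulr_natl [leLHS]mulrCA ler_pM2l // ler_wpM2r //.
rewrite -natr1 lerD2r ler_pdivlMr ?ltr0n // -!natrM ler_nat.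
apply: leq_trans (leq_mul (leqnn _) qL) _.
by rewrite mulnCA leq_mul2l leq_divM.
Qed.

(** Dirichlet's approximation theorem: by the pigeonhole principle two of the
    P + 1 fractional parts of j al lie in the same of P cells; then reduce the
    fraction. *)
Lemma dirichlet (al : R) (P : nat) : (0 < P)%N ->
  exists (a : int) (q : nat), [/\ (0 < q <= P)%N, coprime `|a| q & `|q%:R * al - a%:~R| < P%:R^-1].
Proof.
move=> P0; have PR : 0 < P%:R :> R by rewrite ltr0n.
have lt_P (j : 'I_P.+1) : (Num.truncn (P%:R * frac (j%:R * al)) < P)%N.
  have /andP[f0 f1] := frac_itv (j%:R * al).
  rewrite truncn_lt_nat ?mulr_ge0 // ?ltW //.
  by rewrite -[ltRHS]mulr1 ltr_pM2l.
pose f j := Ordinal (lt_P j).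
have : ~~ injectiveb f.
  apply/negP => /injectiveP /leq_card; by rewrite !card_ord ltnn.
case/injectivePn => i [j ij fij].
have fe : Num.truncn (P%:R * frac (i%:R * al)) = Num.truncn (P%:R * frac (j%:R * al)).
  by have := congr1 val fij.
have [q [b [q0 qP bd]]] : exists (q : nat) (b : int), [/\ (0 < q)%N, (q <= P)%N & `|q%:R * al - b%:~R| < P%:R^-1].
  have gen (s t : 'I_P.+1) : (s < t)%N ->
      Num.truncn (P%:R * frac (t%:R * al)) = Num.truncn (P%:R * frac (s%:R * al)) ->
      exists (q : nat) (b : int), [/\ (0 < q)%N, (q <= P)%N & `|q%:R * al - b%:~R| < P%:R^-1].
    move=> st e; exists (t - s)%N, (Num.floor (t%:R * al) - Num.floor (s%:R * al)); split.
    - by rewrite subn_gt0.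
    - by have := ltn_ord t; lia.
    have -> : (t - s)%:R * al - (Num.floor (t%:R * al) - Num.floor (s%:R * al))%:~R =
        frac (t%:R * al) - frac (s%:R * al).
      by rewrite /frac natrB ?(ltnW st) // intrB; ring.
    rewrite -(ltr_pM2l PR) mulfV ?gt_eqF // -[X in X * _](ger0_norm (ltW PR)) -normrM mulrBr.
    by apply: truncn_eq_dist => //; rewrite mulr_ge0 //; [have /andP[] := frac_itv (t%:R * al) | have /andP[] := frac_itv (s%:R * al)].
  case: (ltngtP i j) => [lt|lt|e]; first exact: gen lt (esym fe).
    exact: gen lt fe.
  by move: ij; rewrite -val_eqE /= e eqxx.
pose g := gcdn `|b| q; have g0 : (0 < g)%N by rewrite gcdn_gt0 q0 orbT.
have gR : 1 <= g%:R :> R by rewrite ler1n.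
have gq : (q = q %/ g * g)%N by rewrite divnK // dvdn_gcdr.
have gb : b = (b %/ g)%Z * g.
  by rewrite divzK // dvdzE /= dvdn_gcdl.
exists (b %/ g)%Z, (q %/ g)%N; split.
- by rewrite divn_gt0 // dvdn_leq ?dvdn_gcdr //= (leq_trans (leq_div _ _)).
- rewrite /coprime -(eqn_pmul2r g0) muln_gcdl -gq mul1n.
  have -> : (`|(b %/ g)%Z| * g = `|b|)%N by rewrite {2}gb abszM.
  by [].
apply: le_lt_trans bd.
have -> : q%:R * al - b%:~R = g%:R * ((q %/ g)%:R * al - (b %/ g)%Z%:~R).
  by rewrite {1}gq {1}gb natrM intrM -[g%:Z%:~R]/(g%:R); ring.
by rewrite normrM (ger0_norm (ler0n _ g)) ler_peMl.
Qed.

End Minor.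

Section MinorArcs.
Variable R : realType.

(** The frequency [al] lies on the major arc of level [Q] around the reduced
    fraction a/q. *)
Definition near_fraction (N : nat) (Q al : R) (a : int) (q : nat) : bool :=
  [&& (0 < q)%N, q%:R <= Q, coprime `|a| q &
      `|al - a%:~R / q%:R| < Q / (4 * N%:R ^+ 2 * q%:R)].

(** Dirichlet's theorem with denominators up to about 4 N^2/Q yields a fraction a/q
    which, by hypothesis, has q > Q.  If q <= N, the N/q blocks give
    N^2/q + N^(1+k); if q > N, a bounded number of blocks gives
    N^(2k) q^(1-k) with q <= 5 N^2/Q.  Both are O(N^2 Q^(k-1)). *)
Lemma weyl_minor (k : R) (N : nat) (Q al : R) : 0 < k -> k <= 1 ->
  (0 < N)%N -> 1 <= Q -> Q <= N%:R -> (forall a q, ~~ near_fraction N Q al a q) ->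
  cabs (sqsum N al) ^+ 2 <= 500 / k * (N%:R ^+ 2 * Q `^ (k - 1)).
Proof.
move=> k0 k1 N0 Q1 QN minor.
have NR : 0 < N%:R :> R by rewrite ltr0n.
have N1 : 1 <= N%:R :> R by rewrite ler1n.
have Q0 : 0 < Q by lra.
have N2 : 0 < N%:R ^+ 2 :> R by rewrite exprn_gt0.
have kV : 1 <= k^-1 by rewrite invf_ge1.
set Y := _ * (Q `^ (k - 1)).
have y0 : 0 <= 4 * N%:R ^+ 2 / Q by rewrite divr_ge0 ?mulr_ge0 // ltW.
have Qk : Q^-1 <= Q `^ (k - 1) by rewrite -powR_inv1 ?(ltW Q0) // ler_powR //; lra.
have YQ : N%:R ^+ 2 / Q <= Y by rewrite ler_wpM2l // ltW.
have NQ : N%:R <= N%:R ^+ 2 / Q by rewrite ler_pdivlMr // expr2 ler_pM2l.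
have NY := le_trans NQ YQ.
(* An integer P with 4 N^2/Q < P <= 5 N^2/Q, so that a fraction obtained from
   Dirichlet's theorem is within the arc radius of al. *)
pose P := (Num.truncn (4 * N%:R ^+ 2 / Q)).+1.
have /andP[P1 P2] := truncn_itv y0; rewrite -/P in P2.
have PR : 0 < P%:R :> R by rewrite ltr0n.
have P5 : P%:R <= 5 * N%:R ^+ 2 / Q.
  by rewrite /P -natr1; apply: le_trans (lerD P1 (lexx _)) _; lra.
have [a [q [/andP[q0 qP] cop bd]]] := dirichlet al (ltn0Sn _ : 0 < P)%N.
have qR : 0 < q%:R :> R by rewrite ltr0n.
have qPR : q%:R <= P%:R :> R by rewrite ler_nat.
have bd' : `|al - a%:~R / q%:R| < (P%:R * q%:R)^-1.
  rewrite -(ltr_pM2l qR) invfM mulrCA mulfV ?gt_eqF // mulr1.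
  by rewrite -[X in X * _](ger0_norm (ltW qR)) -normrM mulrBr mulrCA mulfV ?gt_eqF // mulr1.
have beta : `|al - a%:~R / q%:R| <= q%:R ^- 2.
  apply: le_trans (ltW bd') _; rewrite expr2 lef_pV2 ?posrE ?mulr_gt0 //.
  by rewrite ler_pM2r.
have Qq : Q < q%:R.
  rewrite ltNge; apply/negP => qQ; move/negP: (minor a q); apply.
  rewrite /near_fraction q0 qQ cop /=; apply: lt_trans bd' _.
  rewrite -[ltRHS]invrK ltf_pV2 ?posrE ?mulr_gt0 ?invr_gt0 ?divr_gt0 ?mulr_gt0 //.
  by rewrite invf_div mulrAC ltr_pM2r.
have nQq : N%:R ^+ 2 / q%:R <= Y.
  by apply: le_trans YQ; rewrite ler_pM2l // lef_pV2 ?posrE // ltW.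
have q20 : (0 < 2 * q)%N by rewrite muln_gt0.
have E4 : 2 * (2 * q)%:R = 4 * q%:R :> R by rewrite natrM; ring.
have q4 : 0 < 4 * q%:R :> R by rewrite mulr_gt0.
have Y0 : 0 <= Y := le_trans (ltW NR) NY.
have kY : Y <= Y / k by rewrite ler_peMr.
have [qN|qN] := leP q%:R (N%:R : R).
  apply: le_trans (weyl_sum_le (c := q) N0 q0 cop beta _) _; first by rewrite leqnn.
  set S := \sum_(i < q) _.
  have Sle : S <= N%:R + N%:R `^ k * (4 * q%:R) / k.
    apply: le_trans (sum_majorant_le q N0 q20 k0 k1) _; rewrite lerD2l E4.
    rewrite -!mulrA ler_wpM2l ?powR_ge0 //.
    have e : (4 * q%:R) `^ (1 - k) * (4 * q%:R) `^ k = 4 * q%:R :> R.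
      by rewrite -powRD ?(gt_eqF q4) ?implybT // subrK powRr1 // ltW.
    rewrite [leRHS]mulrA -[X in _ <= X / k]e -mulrA ler_wpM2l ?powR_ge0 //.
    rewrite ler_wpM2r ?invr_ge0 ?(ltW k0) // ge0_ler_powR ?nnegrE ?(ltW k0) ?(ltW q4) //.
    lra.
  have S0 : 0 <= S by rewrite sumr_ge0 // => *; apply: majorant_ge0.
  have f5 : 4 * N%:R / q%:R + 1 <= 5 * N%:R / q%:R :> R.
    have : 1 <= N%:R / q%:R :> R by rewrite ler_pdivlMr // mul1r.
    lra.
  have NkY : N%:R `^ k * N%:R <= Y.
    have -> : N%:R `^ k * N%:R = N%:R ^+ 2 * N%:R `^ (k - 1).
      rewrite -[X in _ * X = _]powRr1 ?ltW // -powRD ?(gt_eqF NR) ?implybT //.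
      rewrite -powR_mulrn ?ltW // -powRD ?(gt_eqF NR) ?implybT //; congr (_ `^ _); lra.
    rewrite ler_pM2l // -[k - 1]opprB !powRN lef_pV2 ?posrE ?powR_gt0 //.
    by rewrite ge0_ler_powR ?nnegrE ?subr_ge0 ?(ltW Q0) ?(ltW NR).
  have t1 : 4 * (4 * N%:R / q%:R + 1) * S <=
      20 * (N%:R ^+ 2 / q%:R) + 80 * (N%:R `^ k * N%:R) / k.
    apply: (@le_trans _ _ (4 * (5 * N%:R / q%:R) * (N%:R + N%:R `^ k * (4 * q%:R) / k))).
      apply: ler_pM => //.
      by rewrite ler_pM2l.
    by rewrite le_eqVlt; apply/orP; left; apply/eqP; field; rewrite (gt_eqF k0) (gt_eqF qR).
  have t2 : (N%:R `^ k * N%:R) / k <= Y / k by rewrite ler_wpM2r // invr_ge0 ltW.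
  have -> : 500 / k * Y = 500 * (Y / k) by ring.
  lra.
apply: le_trans (weyl_sum_le (c := N) N0 q0 cop beta _) _; first by rewrite leqnn orbT.
set S := \sum_(i < N) _.
have Sle : S <= N%:R + 20 * (Y / k).
  apply: le_trans (sum_majorant_le N N0 q20 k0 k1) _; rewrite lerD2l E4.
  have b1 : (4 * q%:R) `^ (1 - k) <= 20 * ((N%:R ^+ 2) `^ (1 - k) * Q `^ (k - 1)).
    apply: (@le_trans _ _ ((20 * (N%:R ^+ 2 / Q)) `^ (1 - k))).
      rewrite ge0_ler_powR ?nnegrE ?subr_ge0 ?mulr_ge0 ?invr_ge0 ?(ltW Q0) //.
      by have := le_trans qPR P5; lra.
    rewrite powRM ?divr_ge0 ?(ltW Q0) ?(ltW N2) // powRM ?invr_ge0 ?(ltW Q0) ?(ltW N2) //.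
    rewrite -[Q^-1]powR_inv1 ?(ltW Q0) // -powRrM mulN1r opprB.
    rewrite ler_wpM2r ?mulr_ge0 ?powR_ge0 // ler1_powR //; lra.
  have b2 : N%:R `^ k * N%:R `^ k * (N%:R ^+ 2) `^ (1 - k) = N%:R ^+ 2 :> R.
    rewrite -powRM ?ltW // -expr2 -powRD ?(gt_eqF N2) ?implybT //.
    by rewrite addrC subrK powRr1 // ltW.
  have -> : 20 * (Y / k) = N%:R `^ k * (20 * ((N%:R ^+ 2) `^ (1 - k) * Q `^ (k - 1))) * (N%:R `^ k / k).
    by rewrite /Y -{1}b2; ring.
  by rewrite ler_wpM2r ?divr_ge0 ?powR_ge0 ?(ltW k0) // ler_wpM2l ?powR_ge0.
have S0 : 0 <= S by rewrite sumr_ge0 // => *; apply: majorant_ge0.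
have f5 : 4 * N%:R / q%:R + 1 <= 5 :> R.
  have : N%:R / q%:R <= 1 :> R by rewrite ler_pdivrMr // mul1r ltW.
  lra.
have t1 : 4 * (4 * N%:R / q%:R + 1) * S <= 20 * S.
  rewrite ler_wpM2r //; lra.
have -> : 500 / k * Y = 500 * (Y / k) by ring.
lra.
Qed.

(** Distinct reduced fractions are at least 1/(q q') apart, while the radii of the
    arcs sum to at most 1/(2 q q') because q, q' <= Q <= N. *)
Lemma near_fraction_uniq (N : nat) (Q al : R) (a a' : int) (q q' : nat) :
  Q <= N%:R -> near_fraction N Q al a q -> near_fraction N Q al a' q' ->
  a = a' /\ q = q'.
Proof.
move=> QN /and4P[q0 qQ cop near] /and4P[q'0 q'Q cop' near'].
have qR : 0 < q%:R :> R by rewrite ltr0n.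
have q'R : 0 < q'%:R :> R by rewrite ltr0n.
have Q0 : 0 < Q by apply: lt_le_trans qQ.
have NR : 0 < N%:R :> R by apply: lt_le_trans QN.
have d1 : `|(a * q'%:Z - a' * q%:Z)%:~R| < 1 :> R.
  have -> : (a * q'%:Z - a' * q%:Z)%:~R =
      q%:R * q'%:R * ((al - a'%:~R / q'%:R) - (al - a%:~R / q%:R)) :> R.
    rewrite intrB !intrM -[q%:Z%:~R]/(q%:R) -[q'%:Z%:~R]/(q'%:R); field.
    by rewrite !gt_eqF.
  rewrite normrM ger0_norm ?mulr_ge0 //.
  have tri := ler_normB (al - a'%:~R / q'%:R) (al - a%:~R / q%:R).
  apply: (@lt_le_trans _ _ (q%:R * q'%:R * (Q / (4 * N%:R ^+ 2 * q'%:R) + Q / (4 * N%:R ^+ 2 * q%:R)))).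
    by rewrite ltr_pM2l ?mulr_gt0 //; lra.
  have -> : q%:R * q'%:R * (Q / (4 * N%:R ^+ 2 * q'%:R) + Q / (4 * N%:R ^+ 2 * q%:R)) =
     Q * (q%:R + q'%:R) / (4 * N%:R ^+ 2).
    by field; rewrite !gt_eqF.
  rewrite ler_pdivrMr ?mulr_gt0 ?exprn_gt0 // mul1r.
  have h1 : Q * (q%:R + q'%:R) <= N%:R * (N%:R + N%:R).
    by apply: ler_pM; rewrite ?addr_ge0 ?(ltW Q0) //; lra.
  have : 0 <= N%:R ^+ 2 :> R by rewrite sqr_ge0.
  lra.
have e : a * q'%:Z = a' * q%:Z.
  by apply/eqP; rewrite -subr_eq0; move: d1; rewrite -intr_norm -[1]/(1%:~R) ltr_int; lia.
have qq : (q %| q')%N.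
  rewrite -(@Gauss_dvdr _ `|a|) 1?coprime_sym //.
  by have := congr1 absz e; rewrite !abszM /= => ->; rewrite dvdn_mull.
have qq' : (q' %| q)%N.
  rewrite -(@Gauss_dvdr _ `|a'|) 1?coprime_sym //.
  by have := congr1 absz e; rewrite !abszM /= => <-; rewrite dvdn_mull.
have eq : q = q' by apply/eqP; rewrite eqn_dvd qq.
split=> //; move: e; rewrite eq; apply: mulIf; lia.
Qed.

End MinorArcs.

(** * The major arc multiplier *)
Section Multiplier.
Variable R : realType.
Local Notation "x %:C" := (real_complex R x) : ring_scope.

Variables (N Q M : nat) (B : nat -> nat).
Hypothesis N0 : (0 < N)%N.
Hypothesis Q0 : (0 < Q)%N.
Hypothesis QN : (Q <= N)%N.
Hypothesis M0 : (0 < M)%N.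
Hypothesis B0 : forall q, (0 < q <= Q)%N -> (0 < B q)%N.
Hypothesis BE : forall q, (0 < q <= Q)%N -> (4 * N ^ 2 * q * B q = M * Q)%N.
Hypothesis Mq : forall q, (0 < q <= Q)%N -> (q %| M)%N.

Lemma sum_bool_le1 (I : finType) (P : pred I) :
  (forall x y, P x -> P y -> x = y) -> (\sum_x P x <= 1)%N.
Proof.
move=> u; have [x Px|nP] := pickP P; last by rewrite big1 // => x _; rewrite nP.
rewrite (bigD1 x) //= Px big1 // => y yx.
by apply/eqP; rewrite eqb0; apply: contra yx => Py; rewrite (u _ _ Py Px).
Qed.

(** The Fejer triangle of half-width B q around the frequency a (M/q) is written
    as a count of pairs (s, t) with s - t in a given class modulo M; its inverse
    Fourier transform is then visibly a squared geometric sum. *)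
Definition arc_hit (q a b : nat) (s t : nat) : bool :=
  (M%:Z %| b%:Z - (s%:Z - t%:Z + a%:Z * (M %/ q)%N%:Z))%Z.

Definition arc_count (q a b : nat) : nat :=
  \sum_(s < B q) \sum_(t < B q) arc_hit q a b s t.

Definition multiplier (b : nat) : R :=
  \sum_(1 <= q < Q.+1) \sum_(0 <= a < q | coprime a q) (arc_count q a b)%:R / (B q)%:R.

Lemma width_le q : (0 < q <= Q)%N -> (B q <= M)%N.
Proof.
move=> qQ; have /andP[q1 q2] := qQ.
have h : (Q <= 4 * N ^ 2 * q)%N.
  by apply: leq_trans QN _; rewrite expnS expn1; nia.
have := BE qQ => e; rewrite -(leq_pmul2l (_ : 0 < 4 * N ^ 2 * q)%N) ?e.
  by rewrite mulnC leq_mul2r h orbT.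
exact: leq_trans h.
Qed.

Lemma arc_count_le q a b : (0 < q <= Q)%N -> (arc_count q a b <= B q)%N.
Proof.
move=> qQ; have BM := width_le qQ.
rewrite -[leqRHS]card_ord -sum1_card; apply: leq_sum => s _.
apply: sum_bool_le1 => t t' ht ht'.
apply/val_inj/eqP => /=; rewrite -eqz_nat -subr_eq0 -(@small_dvd M) //.
  by have := rpredB ht ht'; congr (_ %| _)%Z; ring.
by have := ltn_ord t; have := ltn_ord t'; lia.
Qed.

Lemma arc_count_near q a b : (0 < q <= Q)%N -> coprime a q -> (0 < arc_count q a b)%N ->
  exists j : int, near_fraction N (Q%:R : R) (freq R M b) (a%:Z + j * q%:Z) q.
Proof.
move=> qQ cop; have /andP[q0 q2] := qQ.
rewrite lt0n /arc_count sum_nat_eq0 negb_forall => /existsP[s].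
rewrite sum_nat_eq0 negb_forall => /existsP[t]; rewrite eqb0 negbK => /dvdzP[j hj].
have ME : M = (M %/ q * q)%N by rewrite divnK // Mq.
have BR : 0 < (B q)%:R :> R by rewrite ltr0n B0.
have MR : 0 < M%:R :> R by rewrite ltr0n.
have qR : 0 < q%:R :> R by rewrite ltr0n.
have NR : 0 < N%:R :> R by rewrite ltr0n.
exists j; apply/and4P; split=> //; first by rewrite ler_nat.
  have := coprimezE q%:Z (a%:Z + j * q%:Z).
  rewrite /coprimez [_ + j * _]addrC gcdzMDl -/(coprimez _ _) coprimezE /= coprime_sym.
  by rewrite cop coprime_sym => <-.
have -> : freq R M b - (a%:Z + j * q%:Z)%:~R / q%:R = (s%:Z - t%:Z)%:~R / M%:R.
  have bE : b%:Z = s%:Z - t%:Z + (a%:Z + j * q%:Z) * (M %/ q)%N%:Z.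
    have : b%:Z = j * M%:Z + (s%:Z - t%:Z + a%:Z * (M %/ q)%N%:Z) by lia.
    by move=> ->; rewrite {1}ME PoszM; ring.
  have MRE : M%:R = (M %/ q)%:R * q%:R :> R by rewrite -natrM -ME.
  have kR : (M %/ q)%:R != 0 :> R.
    by apply/eqP => k0; move: MR; rewrite MRE k0 mul0r ltxx.
  rewrite /freq -[b%:R]/(b%:Z%:~R) bE intrD intrM -[(M %/ q)%N%:Z%:~R]/((M %/ q)%:R) MRE.
  by field; rewrite kR gt_eqF.
have -> : Q%:R / (4 * N%:R ^+ 2 * q%:R) = (B q)%:R / M%:R :> R.
  have BER : 4 * N%:R ^+ 2 * q%:R * (B q)%:R = M%:R * Q%:R :> R.
    by rewrite -natrX -!natrM BE.
  have -> : Q%:R = 4 * N%:R ^+ 2 * q%:R * (B q)%:R / M%:R :> R.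
    by rewrite BER mulrAC mulfV ?mul1r // gt_eqF.
  by field; rewrite !gt_eqF.
rewrite normrM [`|M%:R^-1|]ger0_norm ?invr_ge0 // ltr_pM2r ?invr_gt0 //.
rewrite -intr_norm -natr_absz ltr_nat.
by have := ltn_ord s; have := ltn_ord t; lia.
Qed.

Lemma sum_shift_lt (m n : nat) : (n <= \sum_(t < n) (t + m < n) + m)%N.
Proof.
have [mn|nm] := leqP m n; last by rewrite (leq_trans (ltnW nm)) // leq_addl.
have e : (\sum_(t < n - m) 1 = \sum_(t < n) (t + m < n))%N.
  rewrite (big_ord_widen n (fun=> 1%N) (leq_subr m n)) big_mkcond.
  by apply: eq_bigr => t _; rewrite ltn_subRL addnC; case: ltnP.
by rewrite -e sum1_card card_ord subnK.
Qed.

Lemma arc_count_ge q (a b : nat) (n : int) : (0 < q <= Q)%N ->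
  (M%:Z %| b%:Z - (n + a%:Z * (M %/ q)%N%:Z))%Z ->
  (B q <= arc_count q a b + `|n|)%N.
Proof.
move=> qQ hn; apply: leq_trans (sum_shift_lt `|n| (B q)) _; rewrite leq_add2r.
have [n0|n0] := leP 0 n.
  rewrite /arc_count exchange_big; apply: leq_sum => t _.
  case: ltnP => //= tB; rewrite (bigD1 (Ordinal tB)) //=.
  rewrite (_ : arc_hit _ _ _ _ _) // /arc_hit.
  by move: hn; congr (_ %| _)%Z; rewrite PoszD; lia.
apply: leq_sum => s _; case: ltnP => //= sB; rewrite (bigD1 (Ordinal sB)) //=.
rewrite (_ : arc_hit _ _ _ _ _) // /arc_hit.
by move: hn; congr (_ %| _)%Z; rewrite PoszD; lia.
Qed.

Lemma multiplier_minor b : (forall a q, ~~ near_fraction N (Q%:R : R) (freq R M b) a q) ->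
  multiplier b = 0.
Proof.
move=> minor; rewrite /multiplier big_nat_cond big1 // => q /andP[/andP[q0 qQ] _].
rewrite ltnS in qQ; have q0Q : (0 < q <= Q)%N by rewrite q0.
rewrite big1 // => a cop; have [->|c0] := posnP (arc_count q a b); first by rewrite mul0r.
by have [j nf] := arc_count_near q0Q cop c0; move/negP: (minor (a%:Z + j * q%:Z) q).
Qed.

(** Only the triangle around a/q contributes, and it misses the value 1 by at most
    the ratio of the distance to the half-width. *)
Lemma multiplier_major b (a : int) q : near_fraction N (Q%:R : R) (freq R M b) a q ->
  `|1 - multiplier b| <= 4 * N%:R ^+ 2 * q%:R * `|freq R M b - a%:~R / q%:R| / Q%:R.
Proof.
move=> nf; have /and4P[q0 qQ cop near] := nf; rewrite ler_nat in qQ.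
have q0Q : (0 < q <= Q)%N by rewrite q0.
have BR : 0 < (B q)%:R :> R by rewrite ltr0n B0.
have MR : 0 < M%:R :> R by rewrite ltr0n.
have qR : 0 < q%:R :> R by rewrite ltr0n.
have NR : 0 < N%:R :> R by rewrite ltr0n.
have QR : 0 < Q%:R :> R by rewrite ltr0n.
(* The arc in the multiplier is indexed by the residue of a modulo q. *)
pose a0 := `|(a %% q)%Z|%N.
have a0E : (a0%:Z = (a %% q)%Z) by rewrite /a0 abszE ger0_norm // modz_ge0 //; lia.
have aE : a = a0%:Z + (a %/ q)%Z * q%:Z by rewrite a0E addrC -divz_eq.
have a0q : (a0 < q)%N by rewrite -ltz_nat a0E ltz_pmod.
have cop0 : coprime a0 q.
  have := coprimezE q%:Z a; rewrite aE {1}addrC /coprimez gcdzMDl -/(coprimez _ _) coprimezE /= -aE.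
  by rewrite coprime_sym => ->; rewrite coprime_sym.
have ME : M = (M %/ q * q)%N by rewrite divnK // Mq.
pose n : int := b%:Z - a * (M %/ q)%N%:Z.
have hn : (M%:Z %| b%:Z - (n + a0%:Z * (M %/ q)%N%:Z))%Z.
  apply/dvdzP; exists (a %/ q)%Z; rewrite /n [in RHS]ME PoszM {1}aE; ring.
have uniq q' a' : (0 < q' <= Q)%N -> (a' < q')%N -> coprime a' q' -> (q', a') != (q, a0) -> arc_count q' a' b = 0%N.
  move=> q'Q a'q cop' ne; have [//|c0] := posnP (arc_count q' a' b).
  have [j nf'] := arc_count_near q'Q cop' c0.
  have QNR : Q%:R <= N%:R :> R by rewrite ler_nat.
  have [e1 e2] := near_fraction_uniq QNR nf nf'.
  case/eqP: ne; rewrite -e2; congr (_, _).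
  by apply/eqP; rewrite -eqz_nat a0E e1 -e2 addrC modzMDl modz_small //; lia.
have -> : multiplier b = (arc_count q a0 b)%:R / (B q)%:R.
  rewrite /multiplier (big_rem q) /= ?mem_index_iota ?q0 //.
  rewrite (big_rem a0) /= ?mem_index_iota ?cop0 //.
  rewrite [X in _ + X + _]big1_seq ?addr0; last first.
    move=> a' /andP[cop']; rewrite mem_rem_uniq ?iota_uniq // inE mem_index_iota.
    move=> /andP[ne a'q]; rewrite uniq ?mul0r //.
    by apply: contra ne => /eqP[->].
  rewrite [X in _ + X]big1_seq ?addr0 // => q' /andP[_].
  rewrite mem_rem_uniq ?iota_uniq // inE mem_index_iota ltnS => /andP[ne q'Q].
  rewrite big_nat_cond big1 // => a' /andP[/andP[_ a'q] cop'].
  by rewrite uniq ?mul0r //; apply: contra ne => /eqP[->].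
have := arc_count_ge q0Q hn; have := arc_count_le a0 b q0Q.
move: (arc_count q a0 b) => c cB cn.
have cBR : c%:R <= (B q)%:R :> R by rewrite ler_nat.
have cnR : (B q)%:R <= c%:R + `|n|%N%:R :> R by rewrite -natrD ler_nat.
have nE : `|n|%N%:R = M%:R * `|freq R M b - a%:~R / q%:R| :> R.
  rewrite natr_absz intr_norm -[X in X * _](ger0_norm (ler0n R M)) -normrM; congr `|_|.
  have MRE : M%:R = (M %/ q)%:R * q%:R :> R by rewrite -natrM -ME.
  rewrite /n intrB intrM /freq mulrBr mulrCA mulfV ?gt_eqF // mulr1; congr (_ - _).
  by rewrite MRE -[(M %/ q)%N%:Z%:~R]/((M %/ q)%:R); field; rewrite gt_eqF.
have BER : 4 * N%:R ^+ 2 * q%:R * (B q)%:R = M%:R * Q%:R :> R.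
  by rewrite -natrX -!natrM BE.
have -> : 4 * N%:R ^+ 2 * q%:R * `|freq R M b - a%:~R / q%:R| / Q%:R =
   `|n|%N%:R / (B q)%:R :> R.
  rewrite nE; have -> : M%:R = 4 * N%:R ^+ 2 * q%:R * (B q)%:R / Q%:R :> R.
    by rewrite BER mulfK // gt_eqF.
  by field; rewrite !gt_eqF.
have -> : 1 - c%:R / (B q)%:R = ((B q)%:R - c%:R) / (B q)%:R :> R.
  by field; rewrite gt_eqF.
rewrite normrM [`|(B q)%:R^-1|]ger0_norm ?invr_ge0 // ler_wpM2r ?invr_ge0 //.
by rewrite ger0_norm; lra.
Qed.

End Multiplier.

(** * The high-low decomposition *)
Section Core.
Variable R : realType.
Local Notation "x %:C" := (real_complex R x) : ring_scope.

Lemma cabs_sqsum_le N (al : R) : cabs (sqsum N al) <= N%:R.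
Proof.
apply: le_trans (cabs_sum _ _ _) _.
under eq_bigr do rewrite cabs_expi.
by rewrite sumr_const_nat ler_nat; lia.
Qed.

Definition weyl_bound (k c : R) := forall (N : nat) (Q al : R),
  (0 < N)%N -> 1 <= Q -> Q <= N%:R -> (forall a q, ~~ near_fraction N Q al a q) ->
  cabs (sqsum N al) <= c * (N%:R * Q `^ ((k - 1) / 2)).

Lemma weyl_boundP (k : R) : 0 < k -> k <= 1 -> exists2 c, 1 <= c & weyl_bound k c.
Proof.
move=> k0 k1; exists (500 / k); first by rewrite ler_pdivlMr // mul1r; lra.
have [c cE] : exists c, c = 500 / k by exists (500 / k).
have c1 : 1 <= c by rewrite cE ler_pdivlMr // mul1r; lra.
have c0 : 0 <= c by lra.
move=> N Q al N0 Q1 QN minor; have := weyl_minor k0 k1 N0 Q1 QN minor.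
rewrite -cE => h; have Q0 : 0 < Q by lra.
rewrite -ler_sqr ?nnegrE ?cabs_ge0 ?mulr_ge0 ?powR_ge0 //.
apply: le_trans h _; rewrite exprMn exprMn.
have -> : (Q `^ ((k - 1) / 2)) ^+ 2 = Q `^ (k - 1).
  by rewrite -powR_mulrn ?powR_ge0 // -powRrM divfK.
by rewrite ler_wpM2r ?mulr_ge0 ?powR_ge0 // expr2 ler_peMl.
Qed.

Section Fixed.
Variables (N Q M : nat) (B : nat -> nat).
Hypothesis N0 : (0 < N)%N.
Hypothesis Q0 : (0 < Q)%N.
Hypothesis QN : (Q <= N)%N.
Hypothesis M0 : (0 < M)%N.
Hypothesis B0 : forall q, (0 < q <= Q)%N -> (0 < B q)%N.
Hypothesis BE : forall q, (0 < q <= Q)%N -> (4 * N ^ 2 * q * B q = M * Q)%N.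
Hypothesis Mq : forall q, (0 < q <= Q)%N -> (q %| M)%N.

(** On the arc of a/q, set D = 4 N^2 q |al - a/q| < Q.  The frequency is minor at
    level D: an arc of level D containing it would be an arc of level Q, hence that
    of a/q, whose radius at level D is exactly |al - a/q|. *)
Lemma high_part (k c : R) (b : nat) : 0 < k -> k <= 1 -> 1 <= c -> weyl_bound k c ->
  cabs ((sqsum N (freq R M b))^*%C * (1 - (multiplier R Q M B b)%:C))
    <= c * (N%:R * Q%:R `^ ((k - 1) / 2)).
Proof.
move=> k0 k1 c1 weyl; rewrite cabsM cabs_conj.
have -> : 1 - (multiplier R Q M B b)%:C = (1 - multiplier R Q M B b)%:C.
  by rewrite [RHS]rmorphB rmorph1.
rewrite cabs_real; set al := freq R M b.
have NR : 0 < N%:R :> R by rewrite ltr0n.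
have QR : 0 < Q%:R :> R by rewrite ltr0n.
have Q1 : 1 <= Q%:R :> R by rewrite ler1n.
have QNR : Q%:R <= N%:R :> R by rewrite ler_nat.
have c0 : 0 < c by lra.
have [[a [q nf]]|none] := pselect (exists a q, near_fraction N (Q%:R : R) al a q); last first.
  have minor a q : ~~ near_fraction N (Q%:R : R) al a q.
    by apply/negP => nf; apply: none; exists a, q.
  rewrite (multiplier_minor N0 Q0 QN M0 B0 BE Mq minor) subr0 normr1 mulr1.
  exact: weyl.
have := multiplier_major N0 Q0 QN M0 B0 BE Mq nf.
have /and4P[q0 qQ cop near] := nf.
have qR : 0 < q%:R :> R by rewrite ltr0n.
have w0 : 0 < 4 * N%:R ^+ 2 * q%:R :> R by rewrite !mulr_gt0.
set D := 4 * N%:R ^+ 2 * q%:R * _ => mD.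
have D0 : 0 <= D by rewrite mulr_ge0 // ltW.
have DQ : D <= Q%:R by rewrite /D mulrC -ler_pdivlMr // ltW.
have e0 : 0 <= (1 - k) / 2 by lra.
(* Very close to a/q the defect 1/Q of the triangle alone suffices. *)
have [D1|D1] := leP D 1.
  apply: (@le_trans _ _ (N%:R * Q%:R^-1)).
    apply: ler_pM; rewrite ?cabs_ge0 ?cabs_sqsum_le //.
    by apply: le_trans mD _; rewrite -[leRHS]mul1r ler_wpM2r ?invr_ge0.
  rewrite -[leLHS]mul1r; apply: ler_pM; rewrite ?mulr_ge0 ?invr_ge0 //.
  by rewrite ler_pM2l // -[leLHS]powR_inv1 // ler_powR //; lra.
have Dm0 : 0 < D by lra.
have minor a' q' : ~~ near_fraction N D al a' q'.
  apply/negP => nf'; have /and4P[q'0 q'D cop' near'] := nf'.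
  have nf2 : near_fraction N (Q%:R : R) al a' q'.
    apply/and4P; split=> //; first exact: le_trans DQ.
    apply: lt_le_trans near' _; rewrite ler_wpM2r // invr_ge0 !mulr_ge0 //.
  have [e1 e2] := near_fraction_uniq QNR nf nf2.
  by move: near'; rewrite -e1 -e2 /D [_ * `|_|]mulrC mulfK ?gt_eqF // ltxx.
have W := weyl _ _ _ N0 (ltW D1) (le_trans DQ QNR) minor.
clearbody D.
apply: (@le_trans _ _ (c * (N%:R * D `^ ((k - 1) / 2)) * (D / Q%:R))).
  by apply: ler_pM; rewrite ?cabs_ge0.
rewrite -!mulrA ler_pM2l // ler_pM2l //.
rewrite mulrA ler_pdivrMr //.
have pw (x : R) : 0 < x -> x `^ ((k - 1) / 2) * x = x `^ ((k + 1) / 2).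
  move=> x0; rewrite -[X in _ * X]powRr1 ?(ltW x0) // -powRD ?(gt_eqF x0) ?implybT //.
  by congr (_ `^ _); lra.
rewrite !pw // ge0_ler_powR ?nnegrE //; lra.
Qed.

Lemma pick_residue (j : int) (G : int -> R[i]) :
  (forall x, G (x + M%:Z) = G x) ->
  \sum_(b < M) ((M%:Z %| b%:Z - j)%Z)%:R * G b%:Z = G j.
Proof.
move=> GM; have GMn x (n : nat) : G (x + n%:Z * M%:Z) = G x.
  elim: n => [|n IH]; first by rewrite mul0r addr0.
  have -> : x + n.+1%:Z * M%:Z = x + n%:Z * M%:Z + M%:Z by rewrite intS; ring.
  by rewrite GM.
have GMz x (n : int) : G (x + n * M%:Z) = G x.
  case: (intP n) => [|m|m]; first by rewrite mul0r addr0.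
    exact: GMn.
  by rewrite -(GMn _ m.+1) mulNr addrNK.
have r0 : 0 <= (j %% M)%Z by rewrite modz_ge0 //; lia.
have rM : (`|(j %% M)%Z| < M)%N by have := ltz_mod j (_ : M%:Z != 0); lia.
have rE : (`|(j %% M)%Z|%N)%:Z = (j %% M)%Z by rewrite gez0_abs.
rewrite (bigD1 (Ordinal rM)) //= rE big1 => [|b bne].
  rewrite addr0 (_ : (M %| _)%Z) ?mul1r.
    by rewrite {2}(divz_eq j M) addrC GMz.
  have -> : (j %% M)%Z - j = - (j %/ M)%Z * M%:Z by rewrite {2}(divz_eq j M); ring.
  by rewrite dvdz_mull.
case: (boolP (_ %| _)%Z) => [h|]; last by rewrite mul0r.
case/eqP: bne; apply: val_inj => /=; apply/eqP; rewrite -eqz_nat rE.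
rewrite -subr_eq0 -(@small_dvd M) //; last by have := ltn_ord b; lia.
have -> : b%:Z - (j %% M)%Z = (b%:Z - j) + (j %/ M)%Z * M by rewrite {2}(divz_eq j M); ring.
by rewrite rpredD // dvdz_mull.
Qed.

Lemma expi_period (z x : int) :
  expi (z%:~R * ((x + M%:Z)%:~R / M%:R)) = expi (z%:~R * (x%:~R / M%:R)) :> R[i].
Proof.
have M0R : M%:R != 0 :> R by rewrite pnatr_eq0 -lt0n.
rewrite intrD -[M%:Z%:~R]/(M%:R) mulrDl mulfV // mulrDr mulr1.
exact: expiDint.
Qed.

(** Each pair (s, t) counted by the multiplier selects one frequency modulo M, whose
    character factors into the contributions of a, of s and of t. *)
Lemma low_kernel (z : int) :
  \sum_(b < M) (multiplier R Q M B b)%:C * expi (z%:~R * freq R M b) =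
  \sum_(1 <= q < Q.+1) ramanujan R q z * (M%:R * fejer R (B q) M z)%:C.
Proof.
have MR : 0 < M%:R :> R by rewrite ltr0n.
pose e (x : int) : R[i] := expi (z%:~R * (x%:~R / M%:R)).
have hit q a s t : (0 < q <= Q)%N ->
    \sum_(b < M) (arc_hit M q a b s t)%:R * e b%:Z =
    expi (a%:R * (z%:~R / q%:R)) * (expi (s%:R * (z%:~R / M%:R)) * (expi (t%:R * (z%:~R / M%:R)))^*%C).
  move=> qQ; rewrite /arc_hit (pick_residue _ (expi_period z)) -expiN -!expiD.
  have MRE : M%:R = (M %/ q)%:R * q%:R :> R by rewrite -natrM divnK // Mq.
  have kR : (M %/ q)%:R != 0 :> R.
    by apply/eqP => kk; move: MR; rewrite MRE kk mul0r ltxx.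
  have qR : q%:R != 0 :> R by rewrite pnatr_eq0 -lt0n; case/andP: qQ.
  congr expi; rewrite intrD intrB intrM -!pmulrn MRE; field.
  by rewrite kR qR.
have cnt q a : (0 < q <= Q)%N ->
    \sum_(b < M) (arc_count M B q a b)%:R * e b%:Z =
    expi (a%:R * (z%:~R / q%:R)) * (cabs (geom (B q) (z%:~R / M%:R)) ^+ 2)%:C.
  move=> qQ; rewrite cabs_sqr /geom conjc_sum mulr_suml mulr_sumr.
  have E (b : 'I_M) : (arc_count M B q a b)%:R * e b%:Z =
      \sum_(s < B q) \sum_(t < B q) (arc_hit M q a b s t)%:R * e b%:Z.
    rewrite natr_sum mulr_suml; apply: eq_bigr => s _.
    by rewrite natr_sum mulr_suml.
  rewrite (eq_bigr _ (fun b _ => E b)) exchange_big; apply: eq_bigr => s _.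
  rewrite exchange_big /= mulr_sumr mulr_sumr; apply: eq_bigr => t _.
  exact: hit.
have E (b : 'I_M) : (multiplier R Q M B b)%:C * expi (z%:~R * freq R M b) =
    \sum_(1 <= q < Q.+1) \sum_(0 <= a < q | coprime a q)
      (B q)%:R^-1%:C * ((arc_count M B q a b)%:R * e b%:Z).
  rewrite /multiplier realc_sum mulr_suml; apply: eq_bigr => q _.
  rewrite realc_sum mulr_suml; apply: eq_bigr => a _.
  by rewrite realcM realc_nat -mulrA mulrCA.
rewrite (eq_bigr _ (fun b _ => E b)) exchange_big big_nat_cond [RHS]big_nat_cond.
apply: eq_bigr => q /andP[/andP[q1 qQ] _]; rewrite ltnS in qQ.
rewrite exchange_big /= mulr_suml; apply: eq_bigr => a _.
rewrite -mulr_sumr cnt ?q1 // mulrCA; congr (_ * _).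
have BR : 0 < (B q)%:R :> R by rewrite ltr0n B0 ?q1.
rewrite -realcM; congr (_%:C); rewrite /fejer; field.
by rewrite (gt_eqF BR) (gt_eqF MR).
Qed.

Lemma low_part (W : nat) (n : int) : (2 * (W + N ^ 2) <= M)%N -> (`|n| < W)%N ->
  cabs (inv_fourier M (fun b => (sqsum N (freq R M b))^*%C * (multiplier R Q M B b)%:C) n)
    <= M%:R * (30 / N%:R * (Q%:R * harmonic R Q ^+ 3)).
Proof.
move=> WM nW; rewrite /inv_fourier.
have E (b : 'I_M) : (sqsum N (freq R M b))^*%C * (multiplier R Q M B b)%:C * expi (n%:~R * freq R M b)
   = \sum_(N./2.+1 <= k < N.+1)
      (multiplier R Q M B b)%:C * expi ((n - (k ^ 2)%N%:Z)%:~R * freq R M b).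
  rewrite /sqsum conjc_sum -mulrA mulr_suml; apply: eq_bigr => k _.
  by rewrite mulrCA -expiN -expiD intrB mulrBl [- _ + _]addrC.
rewrite (eq_bigr _ (fun b _ => E b)) exchange_big /=.
under eq_bigr do rewrite low_kernel.
have MR : 0 < M%:R :> R by rewrite ltr0n.
have sup := @kernel_sup R N Q M B n N0 (introT andP (conj Q0 QN)) M0 B0 BE _.
apply: le_trans (ler_wpM2l (ltW MR) (sup _)); last first.
  by apply: leq_trans WM; rewrite leq_mul2l leq_add2r ltnW.
apply: le_trans (cabs_sum _ _ _) _; rewrite mulr_sumr; apply: ler_sum => k _.
apply: le_trans (cabs_sum _ _ _) _; rewrite mulr_sumr; apply: ler_sum => q _.
rewrite cabsM cabs_real ger0_norm; first by rewrite mulrCA.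
by rewrite mulr_ge0 ?fejer_ge0.
Qed.

End Fixed.

Lemma high_low (e : R) : 0 < e -> e <= 1 -> exists2 C : R, 0 < C &
  forall (N Q W : nat) (f g : nat -> R), (0 < N)%N -> (0 < Q <= N)%N ->
  (forall y, 0 <= f y) -> (forall y, 0 <= g y) -> (forall y, (W <= y)%N -> f y = 0) ->
  \sum_(N./2.+1 <= k < N.+1) \sum_(x < W) f (x + k ^ 2)%N * g x <=
    C * (N%:R^-1 * Q%:R `^ (1 + e) * ((\sum_(y < W) f y) * (\sum_(x < W) g x))
       + N%:R * Q%:R `^ (e - 2^-1) * ((\sum_(y < W) f y ^+ 2 + \sum_(x < W) g x ^+ 2) / 2)).
Proof.
move=> e0 e1; have [k kE] : exists k, k = e / 3 by exists (e / 3).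
have k0 : 0 < k by rewrite kE divr_gt0.
have k1 : k <= 1 by rewrite kE; lra.
have kV : 1 <= k^-1 by rewrite invf_ge1.
have kn0 : k != 0 by rewrite gt_eqF.
have [c c1 weyl] := weyl_boundP k0 k1.
have c0 : 0 < c by lra.
exists (30 / k ^+ 3 + c).
  by rewrite addr_gt0 // divr_gt0 // exprn_gt0.
move=> N Q W f g N0 /andP[Q0 QN] f0 g0 fW.
(* The factorial makes M divisible by every q <= N; the last factor makes it
   larger than the window, which excludes wrap-around. *)
pose V := (N`! * (W + N ^ 2).+1)%N; pose M := (4 * N ^ 2 * V)%N.
pose B q := (V %/ q * Q)%N.
have V0 : (0 < V)%N by rewrite muln_gt0 fact_gt0.
have M0 : (0 < M)%N by rewrite /M muln_gt0 V0 andbT muln_gt0 expn_gt0 N0.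
have qV q : (0 < q <= Q)%N -> (q %| V)%N.
  move=> /andP[q0 qQ]; rewrite dvdn_mulr // dvdn_fact // q0 /=.
  exact: leq_trans QN.
have B0 q : (0 < q <= Q)%N -> (0 < B q)%N.
  move=> qQ; rewrite muln_gt0 Q0 andbT divn_gt0; first by rewrite dvdn_leq // qV.
  by case/andP: qQ.
have BE q : (0 < q <= Q)%N -> (4 * N ^ 2 * q * B q = M * Q)%N.
  move=> qQ; rewrite /B /M -mulnA [(q * _)%N]mulnA [(q * (V %/ q))%N]mulnC divnK ?qV //.
  by rewrite mulnA.
have Mq q : (0 < q <= Q)%N -> (q %| M)%N by move=> qQ; rewrite dvdn_mull // qV.
have VW : (W + N ^ 2 < V)%N by rewrite /V leq_pmull ?fact_gt0.
have WM : (2 * (W + N ^ 2) <= M)%N.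
  rewrite /M -mulnA; apply: leq_mul => //; apply: leq_trans (ltnW VW) _.
  by rewrite leq_pmull // expn_gt0 N0.
have WM' : (W + N ^ 2 < M)%N.
  by apply: leq_trans VW _; rewrite /M leq_pmull // muln_gt0 expn_gt0 N0.
have NR : 0 < N%:R :> R by rewrite ltr0n.
have QR : 0 < Q%:R :> R by rewrite ltr0n.
have Q1 : 1 <= Q%:R :> R by rewrite ler1n.
apply: le_trans (transference M0 WM' f0 g0 fW
  (fun n nW => low_part N0 Q0 QN M0 B0 BE Mq WM nW)
  (fun b _ => high_part N0 Q0 QN M0 B0 BE Mq b k0 k1 c1 weyl)) _.
have sf : 0 <= \sum_(y < W) f y by rewrite sumr_ge0.
have sg : 0 <= \sum_(y < W) g y by rewrite sumr_ge0.
have sf2 : 0 <= \sum_(y < W) f y ^+ 2 by rewrite sumr_ge0 // => *; rewrite sqr_ge0.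
have sg2 : 0 <= \sum_(y < W) g y ^+ 2 by rewrite sumr_ge0 // => *; rewrite sqr_ge0.
rewrite mulrDr; apply: lerD.
  rewrite -[leLHS]mulrA [leRHS]mulrA ler_wpM2r ?mulr_ge0 //.
  have H3 : Q%:R * harmonic R Q ^+ 3 <= Q%:R `^ (1 + e) / k ^+ 3.
    have -> : Q%:R `^ (1 + e) / k ^+ 3 = Q%:R * (Q%:R `^ k / k) ^+ 3.
      have e3 : (Q%:R `^ k) ^+ 3 = Q%:R `^ e :> R.
        by rewrite -powR_mulrn ?powR_ge0 // -powRrM kE divfK.
      rewrite expr_div_n e3 mulrA powRD ?(gt_eqF QR) ?implybT // powRr1 //.
    rewrite ler_pM2l // lerXn2r ?nnegrE ?harmonic_ge0 ?divr_ge0 ?powR_ge0 ?(ltW k0) //.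
    exact: harmonic_le.
  apply: le_trans (ler_wpM2l _ H3) _; first by rewrite divr_ge0.
  have -> : 30 / N%:R * (Q%:R `^ (1 + e) / k ^+ 3) = 30 / k ^+ 3 * (N%:R^-1 * Q%:R `^ (1 + e)).
    by field; rewrite kn0 gt_eqF.
  by rewrite ler_wpM2r ?mulr_ge0 ?invr_ge0 ?powR_ge0 // lerDl (ltW c0).
rewrite [leRHS]mulrA ler_wpM2r ?divr_ge0 ?addr_ge0 //.
apply: ler_pM; rewrite ?mulr_ge0 ?powR_ge0 ?invr_ge0 ?(ltW c0) //.
  by rewrite lerDr divr_ge0 // exprn_ge0 // ltW.
rewrite ler_pM2l // ler_powR // kE; lra.
Qed.

End Core.

(** * Interpolation between level sets *)
Section Levels.
Variable R : realType.

(** The bilinear form of the unnormalized average over the squares of the members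
    of [r]. *)
Definition sqform (r : seq nat) (W : nat) (f g : nat -> R) : R :=
  \sum_(k <- r) \sum_(x < W) f (x + k ^ 2)%N * g x.

Definition dyadic (N : nat) : seq nat := index_iota N./2.+1 N.+1.

Lemma sqformZ r W (f g : nat -> R) (s t : R) :
  sqform r W (fun y => s * f y) (fun y => t * g y) = s * t * sqform r W f g.
Proof.
rewrite /sqform mulr_sumr; apply: eq_bigr => k _; rewrite mulr_sumr.
by apply: eq_bigr => x _; ring.
Qed.

Lemma sum_shift_le (W s : nat) (f : nat -> R) : (forall y, 0 <= f y) ->
  (forall y, (W <= y)%N -> f y = 0) -> \sum_(x < W) f (x + s)%N <= \sum_(y < W) f y.
Proof.
move=> f0 fW; rewrite -(big_mkord xpredT (fun x => f (x + s)%N)) -(big_mkord xpredT f).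
rewrite -{1}[0%N]addn0 -[X in \sum_(_ <= _ < X) f (_ + _)%N](addnK s W) -[(0 + 0)%N]/(0%N).
rewrite -(big_addn 0 (W + s) s xpredT f) add0n.
rewrite [leLHS](_ : _ = \sum_(s <= i < W + s) f i) //.
have [sW|Ws] := leqP s W.
  rewrite (@big_cat_nat _ _ _ W) //= ?leq_addr // [X in _ + X]big_nat_cond.
  rewrite [X in _ + X]big1 ?addr0; last by move=> i /andP[/andP[iW _] _]; rewrite fW.
  by rewrite [leRHS](@big_cat_nat _ _ _ s) //= lerDr sumr_ge0.
rewrite [leLHS]big_nat_cond [leLHS]big1; first by rewrite sumr_ge0.
move=> i /andP[/andP[si _] _].
by rewrite fW // ltnW // (leq_trans Ws).
Qed.

Lemma sqform_l2 (r : seq nat) (W : nat) (f g : nat -> R) :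
  (forall y, 0 <= f y) -> (forall y, (W <= y)%N -> f y = 0) ->
  sqform r W f g <= (size r)%:R * ((\sum_(y < W) f y ^+ 2 + \sum_(x < W) g x ^+ 2) / 2).
Proof.
move=> f0 fW; set c := _ / 2.
have -> : (size r)%:R * c = \sum_(k <- r) c.
  by rewrite big_const_seq count_predT iter_addr_0 mulr_natl.
apply: ler_sum => k _; apply: (@le_trans _ _ (\sum_(x < W) (f (x + k ^ 2)%N ^+ 2 + g x ^+ 2) / 2)).
  by apply: ler_sum => x _; have := sqr_ge0 (f (x + k ^ 2)%N - g x); lra.
rewrite -mulr_suml big_split /= ler_wpM2r ?invr_ge0 // lerD2r.
apply: (@sum_shift_le W (k ^ 2) (fun y => f y ^+ 2)) => y; first by rewrite sqr_ge0.
by move=> yW; rewrite fW // expr0n.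
Qed.

Lemma sum_squares_le (r : seq nat) (W x : nat) (f : nat -> R) : uniq r ->
  (forall y, 0 <= f y) -> (forall y, (W <= y)%N -> f y = 0) ->
  \sum_(k <- r) f (x + k ^ 2)%N <= \sum_(y < W) f y.
Proof.
move=> ur f0 fW.
apply: (@le_trans _ _ (\sum_(k <- r) \sum_(y < W | (y == x + k ^ 2 :> nat)%N) f y)).
  apply: ler_sum => k _; have [kW|Wk] := ltnP (x + k ^ 2)%N W.
    by rewrite (big_pred1 (Ordinal kW)).
  by rewrite fW // sumr_ge0.
rewrite (exchange_big_dep xpredT) //=; apply: ler_sum => y _.
have [k hk|no] := pickP (fun k : 'I_y.+1 => (y == x + k ^ 2 :> nat)%N); last first.
  rewrite big_pred0 // => k; apply/negP => yk.
  have ky : (k < y.+1)%N by rewrite ltnS (eqP yk); nia.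
  by have := no (Ordinal ky); rewrite /= yk.
apply: (@sum_one_hit _ _ _ _ (k : nat)) => // k' /eqP.
by rewrite {1}(eqP hk) => /eqP; rewrite eqn_add2l eqn_exp2r // => /eqP.
Qed.

Lemma sqform_l1 (r : seq nat) (W : nat) (f g : nat -> R) : uniq r ->
  (forall y, 0 <= f y) -> (forall y, 0 <= g y) -> (forall y, (W <= y)%N -> f y = 0) ->
  sqform r W f g <= (\sum_(y < W) f y) * (\sum_(x < W) g x).
Proof.
move=> ur f0 g0 fW; rewrite /sqform exchange_big mulr_sumr /=; apply: ler_sum => x _.
by rewrite -mulr_suml ler_wpM2r // sum_squares_le.
Qed.

Lemma sum_geometric_le (r : R) (n : nat) (m : int) : 0 <= r -> r < 1 ->
  \sum_(0 <= b < n) r ^+ `|b%:Z - m|%N <= 2 / (1 - r).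
Proof.
move=> r0 r1.
have F0 i : 0 <= r ^+ i by rewrite exprn_ge0.
have Fd i j : (i <= j)%N -> r ^+ j <= r ^+ i by move=> ij; rewrite ler_wiXn2l // ltW.
have G k : \sum_(i < k) r ^+ i <= (1 - r)^-1.
  have h : (1 - r) * \sum_(i < k) r ^+ i = 1 - r ^+ k.
    elim: k => [|k IH]; first by rewrite big_ord0 mulr0 expr0 subrr.
    by rewrite big_ord_recr /= mulrDr IH exprS; ring.
  have p : 0 < 1 - r by lra.
  rewrite -(ler_pM2l p) h mulfV ?gt_eqF //; have := F0 k; lra.
have -> : 2 / (1 - r) = (1 - r)^-1 + (1 - r)^-1 by ring.
rewrite (bigID (fun b : nat => m <= b%:Z)) /=; apply: lerD.
  apply: le_trans (sum_inj_le (v := fun b : nat => `|b%:Z - m|%N) F0 Fd (iota_uniq _ _) _ (leqnn _)) (G _).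
  by move=> b b'; rewrite !mem_filter => /andP[h _] /andP[h' _]; lia.
apply: le_trans (sum_inj_le (v := fun b : nat => `|b%:Z - m|%N) F0 Fd (iota_uniq _ _) _ (leqnn _)) (G _).
by move=> b b'; rewrite !mem_filter => /andP[h _] /andP[h' _]; lia.
Qed.

(** Levels are powers of 4, so that the parameter Q matched to a product of size
    4^c is the integer 2^c. *)
Definition in_level (i : int) (t : R) : Prop :=
  t = 0 \/ 4 `^ i%:~R <= t < 4 `^ (i + 1)%:~R.

Section Level.
Variables (p : R) (i : int) (W : nat) (f : nat -> R).
Hypothesis p1 : 1 < p.
Hypothesis p2 : p <= 2.
Hypothesis fi : forall y, in_level i (f y).

Let p_neq0 : p != 0.
Proof. by rewrite gt_eqF // (lt_trans _ p1). Qed.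

Lemma level_ge0 y : 0 <= f y.
Proof. by case: (fi y) => [->//|/andP[h _]]; apply: le_trans h; rewrite powR_ge0. Qed.

Lemma level_l1 : \sum_(y < W) f y <= 4 `^ (i%:~R * (1 - p)) * \sum_(y < W) f y `^ p.
Proof.
rewrite mulr_sumr; apply: ler_sum => y _.
case: (fi y) => [->|/andP[h _]]; first by rewrite powR0 ?mulr0.
have t0 : 0 < f y by apply: lt_le_trans h; rewrite powR_gt0.
have e : f y = f y `^ (1 - p) * f y `^ p.
  by rewrite -powRD ?(gt_eqF t0) ?implybT // subrK powRr1 ?(ltW t0).
rewrite {1}e ler_wpM2r ?powR_ge0 // powRrM -[1 - p]opprB !powRN.
rewrite lef_pV2 ?posrE ?powR_gt0 //.
by rewrite ge0_ler_powR ?nnegrE ?powR_ge0 ?(ltW t0) ?subr_ge0 ?(ltW p1).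
Qed.

(** The scaling factor makes the square of the scaled function comparable with the
    p-th power of the function itself. *)
Lemma level_l2 :
  \sum_(y < W) (4 `^ (- (i%:~R * (1 - p / 2))) * f y) ^+ 2 <= 4 * \sum_(y < W) f y `^ p.
Proof.
rewrite mulr_sumr; apply: ler_sum => y _.
case: (fi y) => [->|/andP[h h']].
  by rewrite mulr0 expr0n powR0 ?mulr0.
have t0 : 0 < f y by apply: lt_le_trans h; rewrite powR_gt0.
have t2 : f y ^+ 2 = f y `^ (2 - p) * f y `^ p.
  rewrite -powRD ?(gt_eqF t0) ?implybT // subrK -powR_mulrn ?ltW //.
rewrite exprMn t2 mulrA ler_wpM2r ?powR_ge0 //.
have s2 : f y `^ (2 - p) <= (4 `^ (i + 1)%:~R) `^ (2 - p).
  by rewrite ge0_ler_powR ?nnegrE ?powR_ge0 ?(ltW t0) ?(ltW h') // subr_ge0.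
apply: le_trans (ler_wpM2l _ s2) _; first by rewrite sqr_ge0.
rewrite -powR_mulrn ?powR_ge0 // -!powRrM -powRD ?(gt_eqF (ltr0n _ 4)) ?implybT //.
rewrite -[leRHS]powRr1 // ler_powR //; first by lra.
by rewrite intrD; have hp := p1; lra.
Qed.

End Level.

(** For c = i + j <= 0 the trivial l^2 bound gains 2^(c (2 - p)).  For c > 0 take
    Q = 2^c in [high_low] when Q <= N; when Q > N the trivial l^1 bound is already
    as good as the low part at level N. *)
Lemma pair_bound (p : R) : 3 / 2 < p -> p < 2 ->
  exists (C r : R), [/\ 0 < C, 0 <= r, r < 1 &
  forall (N W : nat) (i j : int) (f g : nat -> R), (0 < N)%N ->
  (forall y, in_level i (f y)) -> (forall y, in_level j (g y)) ->
  (forall y, (W <= y)%N -> f y = 0) ->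
  \sum_(y < W) f y `^ p <= N%:R ^+ 2 -> \sum_(x < W) g x `^ p <= N%:R ^+ 2 ->
  sqform (dyadic N) W f g <=
    C * N%:R * r ^+ `|(i + j)%R|%N * (\sum_(y < W) f y `^ p + \sum_(x < W) g x `^ p)].
Proof.
move=> p32 p2; pose eta := p - 3 / 2.
have [C [C0 HL]] : exists C, 0 < C /\ forall (N Q W : nat) (f g : nat -> R), (0 < N)%N -> (0 < Q <= N)%N ->
  (forall y, 0 <= f y) -> (forall y, 0 <= g y) -> (forall y, (W <= y)%N -> f y = 0) ->
  sqform (dyadic N) W f g <=
    C * (N%:R^-1 * Q%:R `^ (1 + eta / 2) * ((\sum_(y < W) f y) * (\sum_(x < W) g x))
       + N%:R * Q%:R `^ (eta / 2 - 2^-1) * ((\sum_(y < W) f y ^+ 2 + \sum_(x < W) g x ^+ 2) / 2)).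
  have [| |C C0 H] := @high_low R (eta / 2); rewrite /eta; [lra|lra|].
  by exists C; split.
pose d := Num.min (2 - p) (eta / 2).
have d0 : 0 < d by rewrite lt_min /eta; lra.
have d1 : d <= 2 - p by rewrite ge_min lexx.
have d2 : d <= eta / 2 by rewrite ge_min lexx orbT.
pose r : R := 2 `^ (- d).
have rE m : r ^+ m = 2 `^ (- (m%:R * d)).
  by rewrite -powR_mulrn ?powR_ge0 // -powRrM mulrC mulrN.
exists (3 * C + 2), r; split.
- by rewrite addr_gt0 // mulr_gt0.
- exact: powR_ge0.
- rewrite /r powRN invf_lt1 ?powR_gt0 //.
  have := @gt0_ltr_powR _ d d0 1 2; rewrite powR1 !nnegrE; apply => //.
  by rewrite ltr1n.
move=> N W i j f g N0 fi gj fW uN vN.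
have p1 : 1 < p by lra.
have p2' := ltW p2.
have f0 := level_ge0 fi; have g0 := level_ge0 gj.
have NR : 0 < N%:R :> R by rewrite ltr0n.
have four0 : (4 : R) != 0 by rewrite pnatr_eq0.
have four : (4 : R) = 2 `^ 2 by rewrite -[2 in X in _ `^ X]/(2%:R) powR_mulrn // expr2 -natrM.
have f1 := level_l1 W p1 fi; have g1 := level_l1 W p1 gj.
have f2 := level_l2 W p1 p2' fi; have g2 := level_l2 W p1 p2' gj.
set u := \sum_(y < W) f y `^ p in uN f1 f2 *.
set v := \sum_(y < W) g y `^ p in vN g1 g2 *.
have u0 : 0 <= u by rewrite sumr_ge0 // => *; rewrite powR_ge0.
have v0 : 0 <= v by rewrite sumr_ge0 // => *; rewrite powR_ge0.
set sf := 4 `^ (- (i%:~R * (1 - p / 2))) in f2; set sg := 4 `^ (- (j%:~R * (1 - p / 2))) in g2.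
have sf0 : 0 <= sf by rewrite powR_ge0.
have sg0 : 0 <= sg by rewrite powR_ge0.
pose f' y := sf * f y; pose g' y := sg * g y.
have f'0 y : 0 <= f' y by rewrite mulr_ge0.
have g'0 y : 0 <= g' y by rewrite mulr_ge0.
have f'W y : (W <= y)%N -> f' y = 0 by move=> yW; rewrite /f' fW // mulr0.
(* Scaling f and g by sf and sg balances their l^2 norms; K undoes it. *)
pose K : R := 4 `^ ((i + j)%:~R * (1 - p / 2)).
have K0 : 0 <= K by rewrite powR_ge0.
have K1 : K * (sf * sg) = 1.
  rewrite /K /sf /sg -!powRD ?four0 ?implybT // intrD.
  by rewrite -[RHS](powRr0 4); congr (_ `^ _); ring.
have SK : sqform (dyadic N) W f g = K * sqform (dyadic N) W f' g'.
  by rewrite sqformZ mulrA K1 mul1r.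
have l2 : (\sum_(y < W) f' y ^+ 2 + \sum_(y < W) g' y ^+ 2) / 2 <= 2 * (u + v).
  have := lerD f2 g2; rewrite -/u -/v; lra.
set m := `|(i + j)%R|%N.
have N0' := ltW NR.
have rm0 : 0 <= r ^+ m by rewrite exprn_ge0 // powR_ge0.
have NC : 0 <= N%:R * r ^+ m * (u + v) by rewrite !mulr_ge0 // addr_ge0.
have -> : (3 * C + 2) * N%:R * r ^+ m * (u + v) = (3 * C + 2) * (N%:R * r ^+ m * (u + v)) by ring.
have CNC : 0 <= C * (N%:R * r ^+ m * (u + v)) by rewrite mulr_ge0 // ltW.
have twopow (x : R) : x <= - d -> 2 `^ (m%:R * x) <= r ^+ m.
  by move=> xd; rewrite rE ler_powR ?ler1n // -mulrN ler_wpM2l.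
have [c0|c0] := leP (i + j) 0.
  have KE : K = 2 `^ (m%:R * (p - 2)).
    have cR : (i + j)%:~R = - m%:R :> R by rewrite /m natr_absz ler0_norm // mulrNz opprK.
    by rewrite /K cR four -powRrM; congr (_ `^ _); field.
  have Kr : K <= r ^+ m by rewrite KE twopow //; lra.
  apply: (@le_trans _ _ (K * (N%:R * (2 * (u + v))))).
    rewrite SK ler_wpM2l //; apply: le_trans (sqform_l2 _ _ f'0 f'W) _.
    apply: ler_pM => //; first by rewrite divr_ge0 ?addr_ge0 // sumr_ge0 // => *; rewrite sqr_ge0.
    by rewrite ler_nat /dyadic size_iota subSS leq_subr.
  apply: le_trans (ler_wpM2r _ Kr) _; first by rewrite !mulr_ge0 // addr_ge0.
  lra.
pose Q := (2 ^ m)%N.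
have Q0 : (0 < Q)%N by rewrite expn_gt0.
have QR : 0 < Q%:R :> R by rewrite ltr0n.
have QE (x : R) : Q%:R `^ x = 2 `^ (m%:R * x) by rewrite natrX -powR_mulrn // powRrM.
have cm : (i + j)%:~R = m%:R :> R.
  by rewrite /m natr_absz gtr0_norm.
have KE : K = Q%:R `^ (2 - p).
  by rewrite QE /K cm four -powRrM; congr (_ `^ _); field.
have uv : u * v <= N%:R ^+ 2 * ((u + v) / 2).
  have h1 := ler_wpM2r v0 uN; have h2 := ler_wpM2l u0 vN; lra.
have l1 : (\sum_(y < W) f y) * (\sum_(x < W) g x) <= Q%:R `^ (2 - 2 * p) * (N%:R ^+ 2 * ((u + v) / 2)).
  apply: (@le_trans _ _ ((4 `^ (i%:~R * (1 - p)) * u) * (4 `^ (j%:~R * (1 - p)) * v))).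
    by apply: ler_pM; rewrite ?sumr_ge0.
  have -> : 4 `^ (i%:~R * (1 - p)) * u * (4 `^ (j%:~R * (1 - p)) * v) =
      Q%:R `^ (2 - 2 * p) * (u * v).
    have -> : Q%:R `^ (2 - 2 * p) = 4 `^ (i%:~R * (1 - p)) * 4 `^ (j%:~R * (1 - p)).
      rewrite -powRD ?four0 ?implybT // -mulrDl -intrD cm QE four -powRrM; congr (_ `^ _); ring.
    by ring.
  by rewrite ler_wpM2l ?powR_ge0.
have [QN|NQ] := leqP Q N.
  have h := HL N Q W f' g' N0 (introT andP (conj Q0 QN)) f'0 g'0 f'W.
  rewrite SK; apply: le_trans (ler_wpM2l K0 h) _.
  have sums : K * ((\sum_(y < W) f' y) * (\sum_(x < W) g' x)) = (\sum_(y < W) f y) * (\sum_(x < W) g x).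
    rewrite /f' /g' -!mulr_sumr -[RHS]mul1r -K1; ring.
  have t1 : K * (N%:R^-1 * Q%:R `^ (1 + eta / 2) * ((\sum_(y < W) f' y) * (\sum_(x < W) g' x)))
      <= N%:R * r ^+ m * (u + v) / 2.
    rewrite mulrCA sums; apply: le_trans (ler_wpM2l _ l1) _.
      by rewrite mulr_ge0 ?invr_ge0 ?powR_ge0.
    have -> : N%:R^-1 * Q%:R `^ (1 + eta / 2) * (Q%:R `^ (2 - 2 * p) * (N%:R ^+ 2 * ((u + v) / 2)))
       = Q%:R `^ (1 + eta / 2 + (2 - 2 * p)) * (N%:R * (u + v) / 2).
      rewrite [Q%:R `^ (_ + (_ - _))]powRD ?(gt_eqF QR) ?implybT //; field.
      by rewrite gt_eqF.
    have -> : N%:R * r ^+ m * (u + v) / 2 = r ^+ m * (N%:R * (u + v) / 2) by ring.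
    rewrite ler_wpM2r ?divr_ge0 ?mulr_ge0 ?addr_ge0 // QE twopow //.
    by rewrite /eta in d2 *; lra.
  have t2 : K * (N%:R * Q%:R `^ (eta / 2 - 2^-1) *
       ((\sum_(y < W) f' y ^+ 2 + \sum_(x < W) g' x ^+ 2) / 2)) <= 2 * (N%:R * r ^+ m * (u + v)).
    apply: (@le_trans _ _ (K * (N%:R * Q%:R `^ (eta / 2 - 2^-1) * (2 * (u + v))))).
      by rewrite ler_wpM2l // ler_wpM2l ?mulr_ge0 ?powR_ge0.
    have -> : K * (N%:R * Q%:R `^ (eta / 2 - 2^-1) * (2 * (u + v))) =
        Q%:R `^ (2 - p + (eta / 2 - 2^-1)) * (2 * (N%:R * (u + v))).
      by rewrite [Q%:R `^ (_ + (_ - _))]powRD ?(gt_eqF QR) ?implybT // KE; ring.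
    have -> : 2 * (N%:R * r ^+ m * (u + v)) = r ^+ m * (2 * (N%:R * (u + v))) by ring.
    rewrite ler_wpM2r ?mulr_ge0 ?addr_ge0 // QE twopow //.
    by rewrite /eta in d2 *; lra.
  rewrite mulrCA mulrDr.
  apply: le_trans (ler_wpM2l (ltW C0) (lerD t1 t2)) _; lra.
apply: le_trans (sqform_l1 _ f0 g0 fW) _; first exact: iota_uniq.
apply: le_trans l1 _.
apply: (@le_trans _ _ (Q%:R `^ (2 - 2 * p) * (N%:R * Q%:R * ((u + v) / 2)))).
  rewrite ler_wpM2l ?powR_ge0 // ler_wpM2r ?divr_ge0 ?addr_ge0 //.
  by rewrite expr2 ler_pM2l // ler_nat ltnW.
have -> : Q%:R `^ (2 - 2 * p) * (N%:R * Q%:R * ((u + v) / 2)) =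
    Q%:R `^ (2 - 2 * p + 1) * (N%:R * (u + v) / 2).
  by rewrite [Q%:R `^ (_ + 1)]powRD ?(gt_eqF QR) ?implybT // powRr1 ?(ltW QR) //; ring.
have h : Q%:R `^ (2 - 2 * p + 1) <= r ^+ m.
  by rewrite QE twopow //; move: d2; rewrite /eta; lra.
apply: le_trans (ler_wpM2r _ h) _; first by rewrite divr_ge0 ?mulr_ge0 ?addr_ge0.
lra.
Qed.

End Levels.

(** * Summation over levels, dyadic blocks, and duality *)
Section Bounds.
Variable R : realType.

Definition level (t : R) : int := Num.floor (ln t / ln 4).

(** The cell of the floor of log_4 t. *)
Lemma levelP t : 0 < t -> 4 `^ (level t)%:~R <= t < 4 `^ (level t + 1)%:~R.
Proof.
move=> t0; have l4 : 0 < ln (4 : R) by rewrite ln_gt0 // ltr1n.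
have lnE : t = 4 `^ (ln t / ln 4).
  by rewrite /powR pnatr_eq0 /= divfK ?gt_eqF // lnK ?posrE.
have /andP[h1 h2] := floor_itv (ln t / ln 4).
rewrite [X in _ <= X < _]lnE; apply/andP; split.
  by rewrite ler_powR // ler1n.
rewrite /powR pnatr_eq0 /= ltr_expR ltr_pM2r //.
Qed.

Lemma level_split (n m : nat) (l : int) (c : bool) (x : R) : (`|l| <= m)%N -> (2 * m < n)%N ->
  \sum_(0 <= a < n) (if c && (l == a%:Z - m%:Z) then x else 0) = if c then x else 0.
Proof.
move=> lm mn; case: c => /=; last by rewrite big1.
have lE : l = `|(l + m%:Z)%R|%N%:Z - m%:Z by lia.
have ln : (`|(l + m%:Z)%R| < n)%N by lia.
rewrite big_mkord (bigD1 (Ordinal ln)) //= -lE eqxx big1 ?addr0 // => a.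
rewrite -val_eqE /= => ane; case: eqP => // la; case/eqP: ane; lia.
Qed.

(** Cut f and g into their levels; the bound of [pair_bound] depends on the two
    levels through their sum only, so for a fixed level of f one sums a two-sided
    geometric series over the levels of g, and vice versa. *)
Lemma dyadic_bound_unit (p : R) : 3 / 2 < p -> p < 2 -> exists2 C : R, 0 < C &
  forall (N W : nat) (f g : nat -> R), (0 < N)%N ->
  (forall y, 0 <= f y) -> (forall y, 0 <= g y) -> (forall y, (W <= y)%N -> f y = 0) ->
  \sum_(y < W) f y `^ p <= N%:R ^+ 2 -> \sum_(x < W) g x `^ p <= N%:R ^+ 2 ->
  sqform (dyadic N) W f g <= C * N%:R ^+ 3.
Proof.
move=> p32 p2; have [C [r [C0 r0 r1 HP]]] := pair_bound p32 p2.
have r1' : 0 < 1 - r by lra.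
exists (4 * C / (1 - r)); first by rewrite divr_gt0 // mulr_gt0.
move=> N W f g N0 f0 g0 fW uN vN.
have pn0 : p != 0 by rewrite gt_eqF //; lra.
(* Any bound m for the finitely many levels that occur would do; it shifts the
   index of a level to a natural number. *)
pose m := (\sum_(y < W) `|level (f y)| + \sum_(y < W) `|level (g y)|)%N.
pose n := (2 * m).+1.
have mf y : (y < W)%N -> (`|level (f y)| <= m)%N.
  by move=> yW; rewrite /m (bigD1 (Ordinal yW)) //= -addnA leq_addr.
have mg y : (y < W)%N -> (`|level (g y)| <= m)%N.
  by move=> yW; rewrite /m addnC (bigD1 (Ordinal yW)) //= -addnA leq_addr.
pose cut (h : nat -> R) (a y : nat) : R :=
  if ((y < W)%N && (0 < h y)) && (level (h y) == a%:Z - m%:Z) then h y else 0.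
have cut_level h a y : in_level (a%:Z - m%:Z) (cut h a y).
  rewrite /cut; case: ifP => [/andP[/andP[_ h0] /eqP <-]|_]; last by left.
  by right; apply: levelP.
have cutW h a y : (W <= y)%N -> cut h a y = 0 by rewrite /cut ltnNge => ->.
have split h y : (forall y, 0 <= h y) -> (y < W)%N -> (`|level (h y)| <= m)%N ->
    h y = \sum_(0 <= a < n) cut h a y.
  move=> h0 yW hm; rewrite /cut level_split // yW /=.
  by case: ifP => // /negbT; rewrite -leNgt => hle; apply/eqP; rewrite eq_le hle h0.
have splitp h y : (forall y, 0 <= h y) -> (y < W)%N -> (`|level (h y)| <= m)%N ->
    h y `^ p = \sum_(0 <= a < n) cut h a y `^ p.
  move=> h0 yW hm.
  have E a : cut h a y `^ p =
      if ((y < W)%N && (0 < h y)) && (level (h y) == a%:Z - m%:Z) then h y `^ p else 0.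
    by rewrite /cut; case: ifP => // _; rewrite powR0.
  under eq_bigr do rewrite E; rewrite level_split // yW /=.
  case: ifP => // /negbT; rewrite -leNgt => hle.
  by have -> : h y = 0 by [apply/eqP; rewrite eq_le hle h0]; rewrite powR0.
pose u a := \sum_(y < W) cut f a y `^ p; pose v a := \sum_(y < W) cut g a y `^ p.
have uE : \sum_(0 <= a < n) u a = \sum_(y < W) f y `^ p.
  by rewrite exchange_big; apply: eq_bigr => y _; rewrite -splitp ?mf.
have vE : \sum_(0 <= a < n) v a = \sum_(y < W) g y `^ p.
  by rewrite exchange_big; apply: eq_bigr => y _; rewrite -splitp ?mg.
have u0 a : 0 <= u a by rewrite sumr_ge0 // => *; rewrite powR_ge0.
have v0 a : 0 <= v a by rewrite sumr_ge0 // => *; rewrite powR_ge0.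
have part (w : nat -> R) a : (forall a, 0 <= w a) -> (a \in index_iota 0 n) -> w a <= \sum_(0 <= a < n) w a.
  by move=> w0 an; rewrite (big_rem a) //= lerDl sumr_ge0.
have -> : sqform (dyadic N) W f g =
    \sum_(0 <= a < n) \sum_(0 <= b < n) sqform (dyadic N) W (cut f a) (cut g b).
  rewrite /sqform.
  under [RHS]eq_bigr do rewrite exchange_big.
  rewrite [RHS]exchange_big; apply: eq_bigr => k _ /=.
  under [RHS]eq_bigr do rewrite exchange_big.
  rewrite [RHS]exchange_big; apply: eq_bigr => x _ /=.
  under [RHS]eq_bigr do rewrite -mulr_sumr.
  rewrite -mulr_suml -(split g) ?mg //; congr (_ * _).
  have [yW|Wy] := ltnP (x + k ^ 2)%N W; first by rewrite -split ?mf.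
  by rewrite fW // big1 // => a _; rewrite cutW.
have pairs a b : a \in index_iota 0 n -> b \in index_iota 0 n ->
    sqform (dyadic N) W (cut f a) (cut g b) <=
    C * N%:R * (r ^+ `|(a%:Z - (2 * m%:Z - b%:Z))%R|%N * (u a + v b)).
  move=> an bn; have -> : a%:Z - (2 * m%:Z - b%:Z) = (a%:Z - m%:Z) + (b%:Z - m%:Z) by ring.
  rewrite [leRHS]mulrA; apply: HP => //.
  - by move=> y; apply: cutW.
  - by apply: le_trans uN; rewrite -uE; apply: part.
  - by apply: le_trans vN; rewrite -vE; apply: part.
pose rho (a b : nat) := r ^+ `|(a%:Z - (2 * m%:Z - b%:Z))%R|%N.
have rhoC a b : rho a b = r ^+ `|(b%:Z - (2 * m%:Z - a%:Z))%R|%N.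
  by rewrite /rho; congr (r ^+ `|_|%N); ring.
have NR : 0 <= C * N%:R by rewrite mulr_ge0 // ltW.
apply: (@le_trans _ _ (C * N%:R * (\sum_(0 <= a < n) u a * (2 / (1 - r)) + \sum_(0 <= b < n) v b * (2 / (1 - r))))).
  apply: (@le_trans _ _ (\sum_(0 <= a < n) \sum_(0 <= b < n) C * N%:R * (rho a b * (u a + v b)))).
    rewrite big_seq [leRHS]big_seq; apply: ler_sum => a an.
    by rewrite big_seq [leRHS]big_seq; apply: ler_sum => b bn; apply: pairs.
  under eq_bigr do rewrite -mulr_sumr.
  rewrite -mulr_sumr ler_wpM2l //.
  have -> : \sum_(0 <= a < n) \sum_(0 <= b < n) rho a b * (u a + v b) =
     \sum_(0 <= a < n) u a * (\sum_(0 <= b < n) rho a b) + \sum_(0 <= b < n) v b * (\sum_(0 <= a < n) rho a b).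
    under [X in _ = _ + X]eq_bigr do rewrite mulr_sumr.
    rewrite [X in _ = _ + X]exchange_big -big_split; apply: eq_bigr => a _ /=.
    by rewrite mulr_sumr -big_split; apply: eq_bigr => b _ /=; ring.
  apply: lerD; apply: ler_sum => a _; rewrite ler_wpM2l //.
    under eq_bigr do rewrite rhoC; exact: sum_geometric_le.
  exact: sum_geometric_le.
rewrite -!mulr_suml uE vE.
have h : \sum_(y < W) f y `^ p * (2 / (1 - r)) + \sum_(x < W) g x `^ p * (2 / (1 - r)) <= 4 / (1 - r) * N%:R ^+ 2.
  have -> : 4 / (1 - r) * N%:R ^+ 2 = N%:R ^+ 2 * (2 / (1 - r)) + N%:R ^+ 2 * (2 / (1 - r)) by ring.
  rewrite -!mulr_suml; apply: lerD; rewrite ler_wpM2r ?divr_ge0 // ltW //.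
rewrite -!mulr_suml in h; apply: le_trans (ler_wpM2l NR h) _.
by rewrite le_eqVlt; apply/orP; left; apply/eqP; ring.
Qed.

(** Rescaling f and g to the normalization in which their natural size is 1. *)
Lemma dyadic_bound (p : R) : 3 / 2 < p -> p < 2 -> exists2 C : R, 0 < C &
  forall (N W : nat) (U : R) (f g : nat -> R), (0 < N)%N -> 0 < U ->
  (forall y, 0 <= f y) -> (forall y, 0 <= g y) -> (forall y, (W <= y)%N -> f y = 0) ->
  \sum_(y < W) f y `^ p <= U -> \sum_(x < W) g x `^ p <= U ->
  sqform (dyadic N) W f g <= C * (N%:R `^ (3 - 4 / p) * U `^ (2 / p)).
Proof.
move=> p32 p2; have [C C0 HC] := dyadic_bound_unit p32 p2.
exists C => // N W U f g N0 U0 f0 g0 fW uU vU.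
have NR : 0 < N%:R :> R by rewrite ltr0n.
have p0 : 0 < p by lra.
have N2 : 0 < N%:R ^+ 2 :> R by rewrite exprn_gt0.
pose s := (N%:R ^+ 2 / U) `^ p^-1.
have s0 : 0 < s by rewrite powR_gt0 // divr_gt0.
have sp : s `^ p = N%:R ^+ 2 / U.
  by rewrite -powRrM mulVf ?gt_eqF // powRr1 // ltW // divr_gt0.
have scale h : (forall y, 0 <= h y) -> \sum_(y < W) h y `^ p <= U ->
    \sum_(y < W) (s * h y) `^ p <= N%:R ^+ 2.
  move=> h0 hU; under eq_bigr do rewrite powRM ?h0 ?(ltW s0) // sp.
  by rewrite -mulr_sumr mulrAC ler_pdivrMr // ler_pM2l.
have := HC N W (fun y => s * f y) (fun y => s * g y) N0.
move=> /(_ (fun y => mulr_ge0 (ltW s0) (f0 y)) (fun y => mulr_ge0 (ltW s0) (g0 y))).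
move=> /(_ _ (scale f f0 uU) (scale g g0 vU)) H.
have {}H := H (fun y yW => etrans (congr1 (fun t => s * t) (fW y yW)) (mulr0 s)).
rewrite sqformZ in H.
have s2 : s * s = (N%:R ^+ 2) `^ (2 / p) / U `^ (2 / p).
  have -> : s * s = s `^ 2 by rewrite -[2]/(2%:R) powR_mulrn ?(ltW s0).
  rewrite -powRrM [p^-1 * 2]mulrC powRM ?invr_ge0 ?(ltW U0) ?(ltW N2) //.
  by rewrite -[U^-1]powR_inv1 ?(ltW U0) // -powRrM mulN1r powRN.
have NE : (N%:R ^+ 2) `^ (2 / p) = N%:R `^ (4 / p).
  rewrite -powR_mulrn ?(ltW NR) // -powRrM; congr (_ `^ _); field.
  by rewrite gt_eqF.
have NE2 : N%:R `^ (3 - 4 / p) = N%:R ^+ 3 / N%:R `^ (4 / p).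
  by rewrite powRB ?(gt_eqF NR) ?implybT // -[3]/(3%:R) powR_mulrn ?(ltW NR).
have a0 : 0 < N%:R `^ (4 / p) by rewrite powR_gt0.
have b0 : 0 < U `^ (2 / p) by rewrite powR_gt0.
rewrite s2 NE in H.
rewrite -(ler_pM2l (divr_gt0 a0 b0)); apply: le_trans H _.
rewrite NE2 le_eqVlt; apply/orP; left; apply/eqP; field.
by rewrite (gt_eqF a0) (gt_eqF b0).
Qed.

(** Strong induction on N through [1, N] = [1, N/2] + (N/2, N]: the exponent
    3 - 4/p is positive, so halving N gains a constant factor h < 1 and C/(1 - h)
    is stable.  The case p = 2 is the l^2 bound. *)
Lemma square_sums_bound (p : R) : 3 / 2 < p -> p <= 2 -> exists2 C : R, 0 < C &
  forall (N W : nat) (U : R) (f g : nat -> R), 0 < U ->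
  (forall y, 0 <= f y) -> (forall y, 0 <= g y) -> (forall y, (W <= y)%N -> f y = 0) ->
  \sum_(y < W) f y `^ p <= U -> \sum_(x < W) g x `^ p <= U ->
  sqform (index_iota 1 N.+1) W f g <= C * (N%:R `^ (3 - 4 / p) * U `^ (2 / p)).
Proof.
move=> p32; rewrite le_eqVlt => /orP[/eqP p2|p2].
  exists 1 => // N W U f g U0 f0 g0 fW; rewrite p2.
  have -> : 3 - 4 / 2 = 1 :> R by lra.
  rewrite divff ?pnatr_eq0 // !powRr1 ?(ltW U0) //.
  under eq_bigr do rewrite -[2]/(2%:R) powR_mulrn //.
  under [X in _ -> X <= _ -> _]eq_bigr do rewrite -[2]/(2%:R) powR_mulrn //.
  move=> uU vU; apply: le_trans (sqform_l2 _ _ f0 fW) _.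
  by rewrite size_iota subn1 /= mul1r ler_wpM2l //; lra.
have [C C0 HC] := dyadic_bound p32 p2.
pose s := 3 - 4 / p.
have p0 : 0 < p by lra.
have s0 : 0 < s.
  have : 4 / p < 3 by rewrite ltr_pdivrMr //; lra.
  by rewrite /s; lra.
pose h : R := 2^-1 `^ s.
have h1 : h < 1.
  have := @gt0_ltr_powR _ s s0 2^-1 1; rewrite powR1 !nnegrE; apply => //; lra.
have h0 : 0 <= h by rewrite powR_ge0.
exists (C / (1 - h)); first by rewrite divr_gt0 //; lra.
move=> N W U f g U0 f0 g0 fW uU vU; rewrite -/s.
have V0 : 0 <= U `^ (2 / p) by rewrite powR_ge0.
elim/ltn_ind: N => N IH; have [->|N0] := posnP N.
  rewrite /sqform big_nil mulr_ge0 ?divr_ge0 ?mulr_ge0 ?powR_ge0 ?(ltW C0) //; lra.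
have NR : 0 < N%:R :> R by rewrite ltr0n.
have lt2 : (N./2 < N)%N by rewrite ltn_half_double -addnn -[X in (X < _)%N]addn0 ltn_add2l.
have -> : index_iota 1 N.+1 = index_iota 1 N./2.+1 ++ dyadic N.
  rewrite /dyadic /index_iota !subSS !subn0 -[X in iota 1 X = _](subnKC (ltnW lt2)).
  by rewrite iotaD add1n.
rewrite /sqform big_cat /=.
have half : N./2%:R `^ s <= N%:R `^ s * h.
  rewrite -powRM ?invr_ge0 // ge0_ler_powR ?nnegrE ?mulr_ge0 ?invr_ge0 ?(ltW s0) //.
  by rewrite ler_pdivlMr // -natrM ler_nat muln2 -geq_half_double.
apply: le_trans (lerD (IH _ lt2) (HC N W U f g N0 U0 f0 g0 fW uU vU)) _; rewrite -/s.
apply: (@le_trans _ _ (C / (1 - h) * (N%:R `^ s * h * U `^ (2 / p)) + C * (N%:R `^ s * U `^ (2 / p)))).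
  rewrite lerD2r ler_wpM2l ?ler_wpM2r // divr_ge0 ?(ltW C0) // subr_ge0 ltW //.
rewrite le_eqVlt; apply/orP; left; apply/eqP; field.
by rewrite subr_eq0 eq_sym lt_eqF.
Qed.

(** Duality: with s the exponent conjugate to p, test [square_sums_bound] against
    g = kap r^(s-1), where r is the sum to be estimated. *)
Lemma mean_bound (p : R) : 3 / 2 < p -> p <= 2 -> exists2 C : R, 0 < C &
  forall (N : nat) (F : nat -> R), (0 < N)%N -> (forall y, 0 <= F y) ->
  (forall y, (2 * N ^ 2 <= y)%N -> F y = 0) ->
  ((N ^ 2)%:R^-1 * \sum_(x < (N ^ 2)%N)
     (N%:R^-1 * \sum_(1 <= k < N.+1) F (x + k ^ 2)%N) `^ (p / (p - 1))) `^ (p / (p - 1))^-1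
  <= C * ((2 * N ^ 2)%:R^-1 * \sum_(y < (2 * N ^ 2)%N) F y `^ p) `^ p^-1.
Proof.
move=> p32 p2; have [C C0 HC] := square_sums_bound p32 p2.
exists (2 * C); first by rewrite mulr_gt0.
move=> N F N0 F0 FW; pose W := (2 * N ^ 2)%N; rewrite -/W.
have NR : 0 < N%:R :> R by rewrite ltr0n.
have p0 : 0 < p by lra.
have pm : 0 < p - 1 by lra.
pose s := p / (p - 1).
have s0 : 0 < s by rewrite divr_gt0.
have sV : s^-1 = 1 - p^-1 by rewrite /s; field; rewrite !gt_eqF.
have sp : (s - 1) * p = s by rewrite /s; field; rewrite gt_eqF.
rewrite -/s.
pose r x := \sum_(1 <= k < N.+1) F (x + k ^ 2)%N.
have r0 x : 0 <= r x by rewrite sumr_ge0.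
pose S := \sum_(x < (N ^ 2)%N) r x `^ s.
pose U := \sum_(y < W) F y `^ p.
have S0 : 0 <= S by rewrite sumr_ge0 // => *; rewrite powR_ge0.
have U0 : 0 <= U by rewrite sumr_ge0 // => *; rewrite powR_ge0.
have -> : (N ^ 2)%:R^-1 * \sum_(x < (N ^ 2)%N) (N%:R^-1 * r x) `^ s = N%:R `^ (- 2 - s) * S.
  under eq_bigr do rewrite powRM ?r0 ?invr_ge0 //.
  rewrite -mulr_sumr mulrA; congr (_ * _).
  rewrite powRB ?(gt_eqF NR) ?implybT // powRN -[2]/(2%:R) powR_mulrn // natrX; congr (_ * _).
  by rewrite -[N%:R^-1]powR_inv1 // -powRrM mulN1r powRN.
rewrite -/U.
have [S00|Sn0] := eqVneq S 0.
  rewrite S00 mulr0 powR0 ?invr_eq0 ?gt_eqF // !mulr_ge0 ?powR_ge0 ?(ltW C0) //.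
have Sp : 0 < S by rewrite lt_neqAle eq_sym Sn0.
have Up : 0 < U.
  rewrite lt_neqAle U0 andbT eq_sym; apply/eqP => U00; move/eqP: Sn0; apply.
  have Fz y : F y = 0.
    have [Wy|yW] := leqP W y; first exact: FW.
    have := U00 => /eqP; rewrite psumr_eq0; last by move=> *; rewrite powR_ge0.
    by move=> /allP /(_ (Ordinal yW) (mem_index_enum _)) /=; rewrite powR_eq0 (gt_eqF p0) /= andbT => /eqP.
  rewrite /S big1 // => x _; rewrite /r big1 ?powR0 ?gt_eqF //.
(* The factor that normalizes the p-norm of g to that of F. *)
pose kap := (U / S) `^ p^-1.
have kap0 : 0 < kap by rewrite powR_gt0 // divr_gt0.
pose g x := if (x < N ^ 2)%N then kap * r x `^ (s - 1) else 0.
have g0 x : 0 <= g x by rewrite /g; case: ifP => // _; rewrite mulr_ge0 ?powR_ge0 // ltW.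
have NW : (N ^ 2 <= W)%N by rewrite leq_pmull.
have cutsum (h : nat -> R) : \sum_(x < W) (if (x < N ^ 2)%N then h x else 0) = \sum_(x < (N ^ 2)%N) h x.
  by rewrite -big_mkcond -(big_ord_widen W h NW).
have gU : \sum_(x < W) g x `^ p <= U.
  have -> : \sum_(x < W) g x `^ p = \sum_(x < W) (if (x < N ^ 2)%N then U / S * r x `^ s else 0).
    apply: eq_bigr => x _; rewrite /g; case: ifP => _; last by rewrite powR0 ?gt_eqF.
    rewrite powRM ?powR_ge0 ?(ltW kap0) // -!powRrM mulVf ?gt_eqF // powRr1 ?divr_ge0 //.
    by rewrite sp.
  by rewrite (cutsum (fun x => U / S * r x `^ s)) -mulr_sumr -/S divfK // gt_eqF.
have := HC N W U F g Up F0 g0 FW (lexx _) gU.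
have -> : sqform (index_iota 1 N.+1) W F g = kap * S.
  rewrite /sqform exchange_big /=.
  have -> : \sum_(x < W) \sum_(1 <= k < N.+1) F (x + k ^ 2)%N * g x =
     \sum_(x < W) (if (x < N ^ 2)%N then kap * r x `^ s else 0).
    apply: eq_bigr => x _; rewrite -mulr_suml -/(r x) /g; case: ifP => _; last by rewrite mulr0.
    rewrite mulrCA; congr (_ * _); have [->|rx] := eqVneq (r x) 0.
      by rewrite mul0r powR0 // gt_eqF.
    by rewrite -[X in X * _]powRr1 // -powRD ?rx ?implybT // addrC subrK.
  by rewrite (cutsum (fun x => kap * r x `^ s)) -mulr_sumr.
move=> H.
have kE : kap = U `^ p^-1 / S `^ p^-1.
  by rewrite /kap powRM ?invr_ge0 // -[S^-1]powR_inv1 // -powRrM mulN1r powRN.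
have Us : 0 < U `^ p^-1 by rewrite powR_gt0.
have Ss : 0 < S `^ p^-1 by rewrite powR_gt0.
have H2 : S `^ s^-1 <= C * (N%:R `^ (3 - 4 / p) * U `^ p^-1).
  rewrite -(ler_pM2l Us).
  have -> : U `^ p^-1 * S `^ s^-1 = kap * S.
    by rewrite kE sV powRB ?(gt_eqF Sp) ?implybT // powRr1 //; ring.
  have -> : U `^ p^-1 * (C * (N%:R `^ (3 - 4 / p) * U `^ p^-1)) = C * (N%:R `^ (3 - 4 / p) * U `^ (2 / p)).
    have -> : 2 / p = p^-1 + p^-1 by ring.
    by rewrite [U `^ (_ + _)]powRD ?(gt_eqF Up) ?implybT //; ring.
  exact: H.
rewrite powRM ?powR_ge0 // -powRrM.
apply: le_trans (ler_wpM2l _ H2) _; first by rewrite powR_ge0.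
have -> : N%:R `^ ((- 2 - s) * s^-1) * (C * (N%:R `^ (3 - 4 / p) * U `^ p^-1)) =
   C * (N%:R `^ (- (2 / p)) * U `^ p^-1).
  have -> : N%:R `^ (- (2 / p)) = N%:R `^ ((- 2 - s) * s^-1) * N%:R `^ (3 - 4 / p).
    rewrite -powRD ?(gt_eqF NR) ?implybT //; congr (_ `^ _).
    by rewrite mulrBl mulfV ?(gt_eqF s0) // sV; field; rewrite gt_eqF.
  by ring.
have -> : (W%:R^-1 * U) `^ p^-1 = 2 `^ (- p^-1) * (N%:R `^ (- (2 / p)) * U `^ p^-1).
  rewrite powRM ?invr_ge0 // mulrA; congr (_ * _).
  rewrite /W natrM natrX -powR_inv1 ?mulr_ge0 ?sqr_ge0 // -powRrM mulN1r powRM ?sqr_ge0 //.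
  congr (_ * _); rewrite -powR_mulrn // -powRrM; congr (_ `^ _); ring.
set X := N%:R `^ _ * _; have X0 : 0 <= X by rewrite mulr_ge0 ?powR_ge0.
have two : 1 <= 2 * 2 `^ (- p^-1) :> R.
  rewrite -[X in X * _]powRr1 // -powRD ?pnatr_eq0 ?implybT //.
  rewrite -[leLHS](powRr0 2) ler_powR ?ler1n // subr_ge0.
  by rewrite invf_le1 //; lra.
have -> : 2 * C * (2 `^ (- p^-1) * X) = C * X * (2 * 2 `^ (- p^-1)) by ring.
by rewrite ler_peMr // mulr_ge0 // ltW.
Qed.

End Bounds.

(** * Intervals of integers, and the two halves of the theorem *)
Section Final.
Variable R : realType.

Lemma zitv_seq (a : int) (n : nat) :
  zitv a (a + n%:Z - 1) = [set` [seq a + i%:Z | i <- iota 0 n]]%classic.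
Proof.
apply/seteqP; split => x /=; rewrite /zitv /=.
  move=> /andP[ax xn]; apply/mapP; exists `|(x - a)%R|%N; last lia.
  by rewrite mem_iota; lia.
by case/mapP => i; rewrite mem_iota => i_n ->; lia.
Qed.

Lemma uniq_shift (a : int) (n : nat) : uniq [seq a + i%:Z | i <- iota 0 n].
Proof. by rewrite map_inj_uniq ?iota_uniq // => i j /addrI []. Qed.

Lemma zlength_zitv (a : int) (n : nat) : zlength (zitv a (a + n%:Z - 1)) = n.
Proof.
rewrite /zlength zitv_seq -[RHS](size_iota 0 n) -(size_map (fun i => a + i%:Z)).
apply/perm_size/uniq_perm; rewrite ?uniq_shift ?fset_uniq //.
by move=> x; rewrite in_fset_set; [apply/idP/idP; rewrite inE | exact: finite_seq].
Qed.

Lemma lp_mean_zitv (a : int) (n : nat) (p : R) (f : int -> R[i]) :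
  lp_mean (zitv a (a + n%:Z - 1)) p f =
    (n%:R^-1 * \sum_(i < n) cabs (f (a + i%:Z)) `^ p) `^ p^-1.
Proof.
rewrite /lp_mean zlength_zitv zitv_seq -fsbig_seq ?uniq_shift // big_map.
by rewrite -(big_mkord xpredT (fun i => cabs (f (a + i%:Z)) `^ p)) /index_iota subn0.
Qed.

Lemma zitv_length (a b : int) (n : nat) : a <= b -> zlength (zitv a b) = n ->
  b = a + n%:Z - 1.
Proof.
move=> ab; have {1}-> : b = a + `|(b - a + 1)%R|%N%:Z - 1 by lia.
by rewrite zlength_zitv => <-; lia.
Qed.

Lemma improving_above (p : R) : 3 / 2 < p -> p <= 2 -> exists C : R, improving_ineq p C.
Proof.
move=> p32 p2; have [C C0 HC] := mean_bound p32 p2.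
exists C => N a b f N1 ab len supp.
have bE := zitv_length ab len.
have b2E : b *+ 2 - a + 1 = a + (2 * N ^ 2)%N%:Z - 1.
  by rewrite bE mulr2n PoszM; ring.
have p0 : 0 < p by lra.
have s0 : 0 < p / (p - 1) by rewrite divr_gt0 //; lra.
pose F y := cabs (f (a + y%:Z)).
have F0 y : 0 <= F y := cabs_ge0 _.
have FW y : (2 * N ^ 2 <= y)%N -> F y = 0.
  move=> yW; rewrite /F; suff -> : f (a + y%:Z) = 0 by rewrite cabs0.
  apply: contrapT => /eqP fn0; have := supp _ fn0.
  by rewrite /zitv_double /zitv /= b2E; lia.
rewrite /zitv_double b2E bE !lp_mean_zitv; apply: le_trans (HC N F N1 F0 FW).
rewrite ge0_ler_powR ?nnegrE ?invr_ge0 ?(ltW s0) ?mulr_ge0 ?invr_ge0 ?sumr_ge0 //;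
  try by move=> *; rewrite powR_ge0.
rewrite ler_wpM2l ?invr_ge0 //; apply: ler_sum => i _.
rewrite ge0_ler_powR ?nnegrE ?(ltW s0) ?cabs_ge0 ?mulr_ge0 ?invr_ge0 ?sumr_ge0 //.
rewrite /square_avg cabsM.
have -> : cabs (N%:R^-1 : R[i]) = N%:R^-1.
  have -> : (N%:R^-1 : R[i]) = (N%:R^-1 : R)%:C%C by rewrite fmorphV rmorph_nat.
  by rewrite cabs_real ger0_norm // invr_ge0.
rewrite ler_wpM2l ?invr_ge0 //; apply: le_trans (cabs_sum _ _ _) _.
by apply: ler_sum => k _; rewrite /F PoszD addrA.
Qed.

(** The translate x + k^2 meets N^2 + 1 for at most one k, and does so at exactly N
    points x of [1, N^2]. *)
Lemma delta_mean (N : nat) (p : R) : (0 < N)%N -> 0 < p ->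
  let f := fun x : int => ((x == (N ^ 2)%N%:Z + 1)%:R : R[i]) in
  lp_mean (zitv 1 (N ^ 2)%N%:Z) p (square_avg N f) = (N%:R^-1 * N%:R^-1 `^ p) `^ p^-1.
Proof.
move=> N0 p0 f.
have NR : 0 < N%:R :> R by rewrite ltr0n.
have -> : (N ^ 2)%N%:Z = 1 + (N ^ 2)%N%:Z - 1 by ring.
rewrite lp_mean_zitv; congr (_ `^ _).
have avg (i : nat) : cabs (square_avg N f (1 + i%:Z)) `^ p =
    \sum_(1 <= k < N.+1 | (i + k ^ 2 == N ^ 2)%N) N%:R^-1 `^ p.
  have -> : square_avg N f (1 + i%:Z) =
      (N%:R^-1 * \sum_(1 <= k < N.+1 | (i + k ^ 2 == N ^ 2)%N) 1 : R)%:C%C.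
    rewrite rmorphM fmorphV rmorph_nat rmorph_sum /square_avg /=; congr (_ * _).
    rewrite [RHS]big_mkcond; apply: eq_bigr => k _; rewrite /f.
    have -> : (1 + i%:Z + (k ^ 2)%N%:Z == (N ^ 2)%N%:Z + 1) = (i + k ^ 2 == N ^ 2)%N.
      by rewrite -addrA addrC (inj_eq (addIr 1)) -PoszD eqz_nat.
    by case: ifP; rewrite ?rmorph1.
  rewrite cabs_real ger0_norm ?mulr_ge0 ?invr_ge0 ?sumr_ge0 //.
  have [k hk|no] := pickP (fun k : 'I_N.+1 => (0 < k)%N && (i + k ^ 2 == N ^ 2)%N).
    have uniqk (V : R) : \sum_(1 <= k < N.+1 | (i + k ^ 2 == N ^ 2)%N) V = V.
      case/andP: hk => k0 /eqP hk.
      have kr : (k : nat) \in index_iota 1 N.+1 by rewrite mem_index_iota k0 ltn_ord.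
      rewrite big_mkcond (bigD1_seq (k : nat)) ?iota_uniq //= hk eqxx big1 ?addr0 // => j jk.
      case: eqP => // hj; case/eqP: jk; apply/eqP; rewrite -(eqn_exp2r _ _ (isT : 0 < 2)%N).
      by rewrite -(eqn_add2l i) hj hk.
    by rewrite !uniqk mulr1.
  have zero (V : R) : \sum_(1 <= k < N.+1 | (i + k ^ 2 == N ^ 2)%N) V = 0.
    rewrite big_nat_cond big1 // => k /andP[/andP[k0 kN] hk].
    by have := no (Ordinal kN); rewrite /= k0 hk.
  by rewrite !zero mulr0 powR0 // gt_eqF.
under eq_bigr do rewrite avg.
have -> : \sum_(i < (N ^ 2)%N) \sum_(1 <= k < N.+1 | (i + k ^ 2 == N ^ 2)%N) N%:R^-1 `^ p
    = N%:R * N%:R^-1 `^ p.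
  rewrite (exchange_big_dep xpredT) //= big_nat_cond.
  rewrite (eq_bigr (fun=> N%:R^-1 `^ p)).
    by rewrite -big_nat_cond sumr_const_nat subn1 /= mulr_natl.
  move=> k /andP[/andP[k0 kN] _].
  have k2 : (k ^ 2 <= N ^ 2)%N by rewrite leq_sqr -ltnS.
  have lt : (N ^ 2 - k ^ 2 < N ^ 2)%N by rewrite ltn_subrL !expn_gt0 k0 N0.
  rewrite (big_pred1 (Ordinal lt)) // => i.
  by rewrite /= -val_eqE /= -[RHS](eqn_add2r (k ^ 2)) subnK.
by rewrite natrX; field; rewrite gt_eqF.
Qed.

(** By [delta_mean] a constant C would satisfy N^(3/p - 2) <= |C| for all N. *)
Lemma not_improving_below (p : R) : 1 < p -> p < 3 / 2 -> ~ exists C : R, improving_ineq p C.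
Proof.
move=> p1 p32 [C HC].
have p0 : 0 < p by lra.
pose s := p / (p - 1).
have s0 : 0 < s by rewrite divr_gt0 //; lra.
have sV : s^-1 = 1 - p^-1 by rewrite /s; field; rewrite !gt_eqF //; lra.
pose e := 3 / p - 2.
have e0 : 0 < e.
  have : 2 < 3 / p by rewrite ltr_pdivlMr //; lra.
  by rewrite /e; lra.
have main (N : nat) : (0 < N)%N -> N%:R `^ e <= `|C|.
  move=> N0; have NR : 0 < N%:R :> R by rewrite ltr0n.
  pose f := fun x : int => ((x == (N ^ 2)%N%:Z + 1)%:R : R[i]).
  have N2 : (0 < N ^ 2)%N by rewrite expn_gt0 N0.
  have bE : (N ^ 2)%N%:Z = 1 + (N ^ 2)%N%:Z - 1 by ring.
  have len : zlength (zitv 1 (N ^ 2)%N%:Z) = (N ^ 2)%N by rewrite {1}bE zlength_zitv.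
  have supp : supported_on f (zitv_double 1 (N ^ 2)%N%:Z).
    move=> x /=; rewrite /f; have [->|_] := eqVneq x ((N ^ 2)%N%:Z + 1); last by rewrite eqxx.
    move=> _.
    by rewrite /zitv_double /zitv /=; lia.
  have ab : 1 <= (N ^ 2)%N%:Z by lia.
  have := HC N 1 (N ^ 2)%N%:Z f N0 ab len supp.
  rewrite delta_mean // -/s.
  have -> : zitv_double 1 (N ^ 2)%N%:Z = zitv 1 (1 + (2 * N ^ 2)%N%:Z - 1).
    by rewrite /zitv_double; congr zitv; rewrite PoszM mulr2n; ring.
  rewrite lp_mean_zitv.
  have -> : \sum_(i < (2 * N ^ 2)%N) cabs (f (1 + i%:Z)) `^ p = 1.
    have lt : (N ^ 2 < 2 * N ^ 2)%N by rewrite mul2n -addnn -[X in (X < _)%N]addn0 ltn_add2l.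
    have e1 : (1 + (N ^ 2)%N%:Z == (N ^ 2)%N%:Z + 1) by rewrite addrC eqxx.
    rewrite (bigD1 (Ordinal lt)) //= /f e1 cabs1 powR1 big1 ?addr0 // => i.
    rewrite -val_eqE /= => ine; rewrite [1 + _]addrC (inj_eq (addIr 1)) eqz_nat (negPf ine).
    by rewrite cabs0 powR0 // gt_eqF.
  rewrite mulr1 => H.
  have {}H : N%:R `^ (- 2 + p^-1) <= `|C| * N%:R `^ (- (2 / p)).
    have -> : N%:R `^ (- 2 + p^-1) = (N%:R^-1 * N%:R^-1 `^ s) `^ s^-1.
      rewrite -[X in X * _]powRr1 ?invr_ge0 // -powRD ?invr_eq0 ?(gt_eqF NR) ?implybT //.
      rewrite -[N%:R^-1]powR_inv1 // -!powRrM; congr (_ `^ _).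
      by rewrite mulrDl mulfV ?gt_eqF // sV; ring.
    apply: le_trans H _; apply: (@le_trans _ _ (`|C| * (2 * N ^ 2)%:R^-1 `^ p^-1)).
      by rewrite ler_wpM2r ?powR_ge0 // ler_norm.
    have -> : N%:R `^ (- (2 / p)) = (N%:R ^+ 2)^-1 `^ p^-1.
      rewrite -[(_ ^+ 2)^-1]powR_inv1 ?sqr_ge0 // -powR_mulrn // -!powRrM; congr (_ `^ _); ring.
    rewrite ler_wpM2l // ge0_ler_powR ?nnegrE ?invr_ge0 ?sqr_ge0 ?(ltW p0) //.
    have N2R : 0 < (2 * N ^ 2)%:R :> R by rewrite ltr0n muln_gt0.
    have NN : N%:R ^+ 2 <= (2 * N ^ 2)%:R :> R.
      by rewrite natrM natrX ler_peMl ?sqr_ge0 // ler1n.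
    by rewrite lef_pV2 ?posrE // exprn_gt0.
  have a0 : 0 < N%:R `^ (- (2 / p)) by rewrite powR_gt0.
  rewrite -(ler_pM2r a0) -powRD ?(gt_eqF NR) ?implybT //.
  by apply: le_trans H; rewrite le_eqVlt; apply/orP; left; apply/eqP; congr (_ `^ _); rewrite /e; field; rewrite gt_eqF.
pose N := (Num.truncn (`|C| `^ e^-1)).+1.
have := main N (ltn0Sn _); rewrite leNgt => /negP; apply.
have /andP[_ h] := truncn_itv (powR_ge0 `|C| e^-1); rewrite -/N in h.
have := @gt0_ltr_powR _ e e0 (`|C| `^ e^-1) N%:R; rewrite !nnegrE powR_ge0 ler0n.
by move=> /(_ isT isT h); rewrite -powRrM mulVf ?gt_eqF // powRr1.
Qed.

End Final.

Theorem theorem1p1 :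
  forall R : realType,
    (forall p : R, 3 / 2 < p -> p <= 2 -> exists C : R, improving_ineq p C) /\
    (forall p : R, 1 < p -> p < 3 / 2 -> ~ exists C : R, improving_ineq p C).
Proof.
by move=> R; split=> p; [exact: improving_above | exact: not_improving_below].
Qed.
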